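(* Assume that for every $t\in[0,T]$ the set $C(t)$ is a compact interval of $\mathbb R$, and that there exist $r>0$ and a continuous function $\gamma:[0,T]\to\mathbb R$ with $\gamma(t)\in C(t)$ and $[\gamma(t)-r,\gamma(t)+r]\subset\mathrm{int}(C(t))$ for every $t\in[0,T]$. Assume that the kernel $K$ is bounded and that $\{u\in\mathbb R: K(u)\neq 0\}=\,]A,B[$ for some real numbers $A<B$. Let $L>0$ and assume that $b$ is Lipschitz continuous with $|b(0)|+\|b\|_{\mathrm{Lip}}\leqslant L$. Then there exists a deterministic constant $\mathfrak c_{C,H,K,L,T}>0$, depending only on $C$, $H$, $K$, $L$ and $T$, such that $$\sup_{t\in[0,T]}\mathbb E\big(|\widehat\tau_\varepsilon(t)-\tau(t)|^2\big)\leqslant \mathfrak c_{C,H,K,L,T}\big(\varepsilon^2+h_\varepsilon^2+\varepsilon^2h_\varepsilon^{2H-2}\big)\quad\text{for every }\varepsilon>0.$$ In particular, if moreover $\varepsilon=o(h_\varepsilon^{1-H})$ as $\varepsilon\to0$, then the estimator $\widehat\tau_\varepsilon$ is consistent, i.e. for every $t\in[0,T]$, $\widehat\tau_\varepsilon(t)\to\tau(t)$ in probability as $\varepsilon\to0$.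
   Context: Setting. $T>0$; $b:\mathbb R\to\mathbb R$ is Lipschitz continuous with Lipschitz semi-norm $\|b\|_{\mathrm{Lip}}=\sup_{s\neq t}|b(t)-b(s)|/|t-s|$; $B^H$ is a (standard) fractional Brownian motion with Hurst index $H\in\,]1/2,1[$; $C:[0,T]\rightrightarrows\mathbb R$ is a multifunction that is Lipschitz continuous for the Hausdorff distance; $x_0\in C(0)$. For a closed convex set $D\subset\mathbb R$ and $z\in\mathbb R$, the normal cone is $\mathcal N_D(z)=\{v\in\mathbb R:\forall w\in D,\ v(w-z)\leqslant 0\}$. For a continuous function $f$ of finite $1$-variation on $[0,T]$, $Df$ is its differential (Stieltjes) measure, $|Df|$ the variation measure of $Df$. For $\varepsilon>0$, $(X_\varepsilon,Y_\varepsilon)$ is the solution of the Skorokhod reflection problem: $X_\varepsilon,Y_\varepsilon$ have continuous paths on $[0,T]$, $Y_\varepsilon$ is of finite $1$-variation, $X_\varepsilon(t)\in C(t)$ for all $t$, $Y_\varepsilon(0)=x_0$, $$X_\varepsilon(t)=\int_0^t b(X_\varepsilon(s))ds+\varepsilon B^H(t)+Y_\varepsilon(t),\qquad -\frac{dDY_\varepsilon}{d|DY_\varepsilon|}(t)\in\mathcal N_{C(t)}(X_\varepsilon(t))\ \ |DY_\varepsilon|\text{-a.e.}$$ $(x,y)$ is the solution of the deterministic problem with $\varepsilon=0$: $x,y$ continuous, $y$ of finite $1$-variation, $x(t)\in C(t)$ for all $t$, $y(0)=x_0$, $x(t)=\int_0^t b(x(s))ds+y(t)$, $-\frac{dDy}{d|Dy|}(t)\in\mathcal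 N_{C(t)}(x(t))$ $|Dy|$-a.e. Under the hypotheses on $C$ in the claim, both problems have a unique solution, and $x,y$ are Lipschitz continuous (known). Trend and estimator. The trend is $\tau(t)=\int_0^t b(x(u))du+y(t)-x_0$, $t\in[0,T]$. A kernel is a measurable function $K:\mathbb R\to\mathbb R_+$ with $\int_{\mathbb R}K(u)du=1$. The bandwidth $h_\varepsilon>0$ is deterministic, with $h_\varepsilon\to0$ as $\varepsilon\to0$. The estimator is $$\widehat\tau_\varepsilon(t)=\frac1{h_\varepsilon}\int_0^t\int_0^TK\Big(\frac{s-u}{h_\varepsilon}\Big)dX_\varepsilon(s)\,du,\quad t\in[0,T],$$ where integration with respect to $dX_\varepsilon(s)$ means $b(X_\varepsilon(s))ds+\varepsilon\,dB^H(s)+dY_\varepsilon(s)$, the integral against $B^H$ being the Wiener integral and that against $Y_\varepsilon$ the Lebesgue–Stieltjes integral. *)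

(* Defs.v *)
From HB Require Import structures.
From mathcomp Require Import all_boot all_order all_algebra.
From mathcomp Require Import all_classical all_reals all_analysis.

Set Implicit Arguments.
Unset Strict Implicit.
Unset Printing Implicit Defensive.

Import Order.TTheory GRing.Theory Num.Theory.
Import numFieldNormedType.Exports.

Local Open Scope classical_set_scope.
Local Open Scope ring_scope.

Section deterministic_notions.
Context {R : realType}.
Implicit Types (T : R) (f b K : R -> R) (C : R -> set R).

Definition lip_seminorm b : R :=
  sup [set `|b p.1 - b p.2| / `|p.1 - p.2| | p in [set p : R * R | p.1 != p.2]].

Definition hausdorff_dist (A B : set R) : \bar R :=
  maxe (ereal_sup [set edist_inf B a | a in A])
       (ereal_sup [set edist_inf A b | b in B]).

Definition hausdorff_lipschitz T C : Prop :=
  exists k : R, forall s t : R, s \in `[0, T] -> t \in `[0, T] ->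
    (hausdorff_dist (C s) (C t) <= (k * `|s - t|)%:E)%E.

Definition normal_cone (D : set R) (z : R) : set R :=
  [set v | forall w, D w -> v * (w - z) <= 0].

Definition is_kernel K : Prop :=
  [/\ measurable_fun setT K, forall u, 0 <= K u &
      (\int[lebesgue_measure]_u (K u)%:E = 1)%E].

End deterministic_notions.

Section signed_measures.
Context {d} {E : measurableType d} {R : realType}.
Implicit Types nu : {charge set E -> \bar R}.

Lemma hahn_sets_ex nu :
  exists PN : set E * set E, hahn_decomposition nu PN.1 PN.2.
Proof. by have [P [N PN]] := Hahn_decomposition nu; exists (P, N). Qed.

(* The positive and negative parts of [nu] do not depend, as measures, on the
   Hahn decomposition that is selected here. *)
Definition hahn_sets nu : {PN | hahn_decomposition nu PN.1 PN.2} :=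
  cid (hahn_sets_ex nu).

Definition variation_measure nu : set E -> \bar R :=
  charge_variation (svalP (hahn_sets nu)).

HB.instance Definition _ nu := Measure.on (variation_measure nu).

Let variation_measure_fin nu : fin_num_fun (variation_measure nu).
Proof. by move=> A mA; rewrite /variation_measure fin_num_measure. Qed.

HB.instance Definition _ nu := @Measure_isFinite.Build _ _ _
  (variation_measure nu) (@variation_measure_fin nu).

Definition charge_integral nu (D : set E) (g : E -> R) : R :=
  \int[jordan_pos (svalP (hahn_sets nu))]_(x in D) g x -
  \int[jordan_neg (svalP (hahn_sets nu))]_(x in D) g x.

End signed_measures.

Section stieltjes.
Context {R : realType}.
Implicit Types (T : R) (f : R -> R).

(* [nu] is seen as a signed measure on [0, T]: it is carried by ]0, T], and a
   continuous [f] gives no mass to the point 0. *)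
Definition is_differential_measure T f
    (nu : {charge set (measurableTypeR R) -> \bar R}) : Prop :=
  (forall s t : R, 0 <= s -> s <= t -> t <= T ->
     nu `]s, t]%classic = (f t - f s)%:E) /\
  (forall A : set (measurableTypeR R), measurable A ->
     A `&` `]0, T]%classic = set0 -> nu A = 0%E).

(* The two clauses determine the signed measure on Borel sets, and it exists
   when [f] is continuous and of bounded variation on [0, T]; the null charge
   is only a default value for other functions. *)
Definition differential_measure T f :
    {charge set (measurableTypeR R) -> \bar R} :=
  match pselect (exists nu, is_differential_measure T f nu) with
  | left ex_nu => sval (cid ex_nu)
  | right _ => czero
  end.

(* The Radon-Nikodym density of [D f] with respect to [|D f|]. *)
Definition differential_density T f : R -> R :=
  let Df := differential_measure T f in
  fun t => fine (Radon_Nikodym Df (variation_measure Df) t).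

End stieltjes.

Section reflection.
Context {R : realType}.

(* [w] is the driving path: [eps * B^H] for the perturbed problem and 0 for the
   limit problem. *)
Definition skorokhod_solution (T : R) (C : R -> set R) (b : R -> R) (x0 : R)
    (w x y : R -> R) : Prop :=
  [/\ {within `[0, T], continuous x} /\ {within `[0, T], continuous y},
      bounded_variation 0 T y,
      forall t : R, t \in `[0, T] -> C t (x t),
      y 0 = x0 /\
      (forall t : R, t \in `[0, T] ->
         x t = \int[lebesgue_measure]_(s in `[0, t]) b (x s) + w t + y t) &
      {ae variation_measure (differential_measure T y), forall t : R,
         t \in `[0, T] ->
         normal_cone (C t) (x t) (- differential_density T y t)}].

Definition trend (b : R -> R) (x0 : R) (x y : R -> R) (t : R) : R :=
  \int[lebesgue_measure]_(u in `[0, t]) b (x u) + y t - x0.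

End reflection.

Section fractional_brownian_motion.
Context {R : realType} {d} {Omega : measurableType d}.
Variable P : probability Omega R.

(* Degenerate (constant) Gaussian variables are allowed; they are singled out
   because [normal_prob m 0] is not the Dirac mass at [m]. *)
Definition is_gaussian (Z : Omega -> R) : Prop :=
  exists m s : R, forall A : set R, measurable A ->
    P (Z @^-1` A) = if s == 0 then \d_m A else normal_prob m s A.

Definition gaussian_process (T : R) (B : R -> {RV P >-> R}) : Prop :=
  forall (n : nat) (a t : 'I_n -> R), (forall i, t i \in `[0, T]) ->
    is_gaussian (fun omega => \sum_(i < n) a i * B (t i) omega).

Definition is_fBm (T H : R) (B : R -> {RV P >-> R}) : Prop :=
  [/\ gaussian_process T B,
      forall t : R, t \in `[0, T] -> ('E_P[B t] = 0)%E,
      forall s t : R, s \in `[0, T] -> t \in `[0, T] ->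
        covariance P (B s) (B t) =
        (2^-1 * (s `^ (2 * H) + t `^ (2 * H) - `|t - s| `^ (2 * H)))%:E &
      {ae P, forall omega, {within `[0, T], continuous (fun t : R => B t omega)}}].

(* A list of triples (a, s, t) encodes the step function
   \sum a * \1_(]s, t]). *)
Definition step_in (T : R) (l : seq (R * R * R)) : Prop :=
  forall p, p \in l -> [/\ 0 <= p.1.2, p.1.2 <= p.2 & p.2 <= T].

Definition step_fun (l : seq (R * R * R)) (u : R) : R :=
  \sum_(p <- l) p.1.1 * \1_`]p.1.2, p.2] u.

Definition step_integral (B : R -> {RV P >-> R}) (l : seq (R * R * R))
    (omega : Omega) : R :=
  \sum_(p <- l) p.1.1 * (B p.2 omega - B p.1.2 omega).

(* For H > 1/2, the squared norm of the space |H| of functions that is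
   continuously embedded in the reproducing Hilbert space of B^H: on step
   functions of constant sign it is the second moment of the integral, and in
   general it dominates it. *)
Definition absH_norm2 (T H : R) (phi : R -> R) : \bar R :=
  ((H * (2 * H - 1))%:E *
   \int[lebesgue_measure]_(s in `[0%R, T])
     \int[lebesgue_measure]_(u in `[0%R, T]) (`|phi s| * `|phi u| * `|s - u| `^ (2 * H - 2))%:E)%E.

(* The Wiener integral of a deterministic function over [0, T], as the
   L^2-limit of the integrals of approximating step functions; it is unique up
   to almost sure equality. *)
Definition is_wiener_integral (T H : R) (B : R -> {RV P >-> R})
    (phi : R -> R) (W : Omega -> R) : Prop :=
  [/\ measurable_fun `[0, T] phi, measurable_fun setT W &
      exists l : nat -> seq (R * R * R),
      [/\ forall n, step_in T (l n),
          absH_norm2 T H (fun u => phi u - step_fun (l n) u) @[n --> \oo]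
            --> 0%E &
          ('E_P[fun omega => ((W omega - step_integral B (l n) omega) ^+ 2)%R])%E
            @[n --> \oo] --> 0%E]].

(* Each Wiener integral is only defined almost surely, so that its integral
   with respect to [u] is taken along a jointly measurable version [W]; two such
   versions give almost surely the same value, by Fubini's theorem. *)
Definition is_trend_estimator (T H : R) (b : R -> R) (K : R -> R)
    (B : R -> {RV P >-> R}) (eps h : R) (X Y tau_hat : R -> {RV P >-> R}) :
    Prop :=
  exists W : R -> Omega -> R,
  [/\ measurable_fun (`[0, T] `*` setT)
        (fun p : measurableTypeR R * Omega => W p.1 p.2),
      forall u : R, u \in `[0, T] ->
        is_wiener_integral T H B (fun s => K ((s - u) / h)) (W u) &
      forall t : R, t \in `[0, T] ->
        {ae P, forall omega, tau_hat t omega =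
          h^-1 * \int[lebesgue_measure]_(u in `[0, t])
            (\int[lebesgue_measure]_(s in `[0, T])
               (K ((s - u) / h) * b (X s omega))
             + eps * W u omega
             + charge_integral
                 (differential_measure T (fun s => Y s omega)) `[0, T]
                 (fun s => K ((s - u) / h)))}].

Definition cvg_in_probability0 (Z : R -> Omega -> R) (z : R) : Prop :=
  forall delta : R, 0 < delta ->
    P [set omega | delta <= `|Z eps omega - z|] @[eps --> 0^'+] --> 0%E.

End fractional_brownian_motion.

(* Main.v *)
Require Import Defs.
From HB Require Import structures.
From mathcomp Require Import all_boot all_order all_algebra.
From mathcomp Require Import all_classical all_reals all_analysis.
From mathcomp Require Import measurable_realfun ring lra.

(** Write [X = (X - eps * B) + eps * B] in the estimator.  By Tonelli's theorem and
    the substitution [u = s - h * v], integrating it in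
    [u] over [0, t] turns the part driven by [X - eps * B] into an average over
    [v], with weight [K v], of the increments of [X - eps * B] over the windows
    ]h v, h v + t] cut to [0, T] ([drift_smoothing] for the drift,
    [charge_smoothing] for the reflection term); what remains is [eps / h] times
    the time integral of the Wiener integrals of the kernel.  The trend is the
    increment [x t - x 0], and [K] has total mass 1 and is carried by
    [-rho, rho], so [estimator_error_le] bounds the error, path by path, by
      [2 * sup |X - eps * B - x| + 2 * Lam * h * rho + eps / h * |integral of W|],
    where [Lam] is a Lipschitz constant of [x].  Each term is then estimated by
    its own argument.

    In dimension one the reflection problem is stable for the uniform norm,
    whatever the variation of the regulators: as long as one solution is above
    another one, the regulator of the first can only decrease and that of the
    second can only increase, because each solution sees a point of [C] on the
    other side.  The distance between the regulators is therefore at most the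
    running maximum of the distance between the unreflected parts
    ([regulator_dist_le]), and a Gronwall argument gives [skorokhod_stability]:
    the first term is at most a constant times [eps * sup |B|].  The second
    moment of [sup |B|] is finite by chaining along the dyadic points, since the
    increments have variance [|t - s| ^ (2 H)] with [2 H > 1]
    ([fBm_sup_moment]).

    The limit path is Lipschitz by the same monotonicity: if it moved faster
    than the sets and the drift together, it would leave points of [C] behind,
    and the regulator would have to pull it back ([solution_lipschitz]).

    For the Wiener integrals, the covariance of [B] is a double integral of the
    kernel [H (2 H - 1) |r - q| ^ (2 H - 2)] ([fBm_cov_riesz]), so that the
    second moment of a step integral is at most the squared norm
    [absH_norm2] ([step_second_moment]).  A function bounded by [M] and carried
    by an interval of length [l] has squared norm at most [2 H M^2 l^(2 H)], and
    closeness in this norm implies closeness in L^1, which is enough to compare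
    the norms of the function and of its approximations.  This gives
    [wiener_moment], hence a contribution of order
    [(eps / h)^2 * h^(2 H) = eps^2 * h^(2 H - 2)] to the risk
    ([estimator_risk_le]).  The constants involve only [C], [H], [K], [L] and
    [T], and consistency follows by Chebyshev's inequality. *)

Set Implicit Arguments.
Unset Strict Implicit.
Unset Printing Implicit Defensive.

Import Order.TTheory GRing.Theory Num.Theory.
Import numFieldNormedType.Exports.

Local Open Scope classical_set_scope.
Local Open Scope ring_scope.


(** * Clamping to the time interval *)

Section clamping.
Context {R : realType}.
Implicit Types (T : R) (f : R -> R).

(** Composing with [clamp T] extends a function given on [0, T] to the line, with
    constant values outside; continuity within [0, T] becomes continuity. *)
Definition clamp T (s : R) : R := Num.max 0 (Num.min s T).

Lemma clamp_itv T s : 0 <= T -> clamp T s \in `[0, T].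
Proof. by move=> T0; rewrite in_itv/= le_max lexx/= ge_max T0 ge_min lexx orbT. Qed.

Lemma clamp_id T s : s \in `[0, T] -> clamp T s = s.
Proof. by rewrite in_itv/= => /andP[s0 sT]; rewrite /clamp min_l// max_r. Qed.

Lemma clamp_le T : {homo clamp T : s t / s <= t}.
Proof.
move=> s t st; rewrite /clamp ge_max !le_max lexx/=; apply/orP; right.
by rewrite le_min !ge_min st lexx/= orbT.
Qed.

Lemma clamp_lip T s t : `|clamp T s - clamp T t| <= `|s - t|.
Proof.
wlog st : s t / s <= t => [wl|].
  by case: (leP s t) => [|/ltW] st; [|rewrite distrC [leRHS]distrC]; exact: wl.
rewrite distrC ger0_norm ?subr_ge0 ?clamp_le// [leRHS]distrC ger0_norm ?subr_ge0//.
rewrite /clamp /Num.max /Num.min.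
by case: (ltP s T) => ?; case: (ltP t T) => ?; do !case: (ltP 0) => ?; lra.
Qed.

Lemma clamp_continuous T : continuous (clamp T).
Proof.
move=> s; apply/cvgrPdist_le => e e0; near=> t.
by rewrite (le_trans (clamp_lip _ _ _))//; near: t; exact: cvgr_dist_le.
Unshelve. all: by end_near. Qed.

Lemma continuous_clamp_comp T f : 0 <= T -> {within `[0, T], continuous f} ->
  continuous (f \o clamp T).
Proof.
move=> T0 /subspace_continuousP cf s.
have Ts : `[0, T]%classic (clamp T s) by exact: clamp_itv.
apply: (@cvg_comp _ _ _ (clamp T) f (nbhs s) _ _ _ (cf _ Ts)) => A cA.
have : nbhs s (clamp T @^-1` [set u | `[0, T]%classic u -> A u]) by exact: clamp_continuous cA.
by apply: filterS => u /=; apply; exact: clamp_itv.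
Qed.

End clamping.

(** * Differential measures and densities *)

Section differential_measure_exists.
Context {R : realType}.
Implicit Types (T : R) (f : R -> R).

(** The constant extension of [f] outside [0, T] is continuous and nondecreasing;
    its Stieltjes measure is restricted to ]0, T], where it is finite. *)
Lemma nondecreasing_differential_measure T f : 0 < T ->
  {within `[0, T], continuous f} ->
  {in `[0, T] &, {homo f : s t / s <= t}} ->
  exists nu, is_differential_measure T f nu.
Proof.
move=> T0 cf ndf; have T0' := ltW T0.
pose g := f \o clamp T.
have gnd : {homo g : s t / s <= t}.
  by move=> s t st; apply: ndf; rewrite ?clamp_itv// clamp_le.
have grc : right_continuous g.
  by apply: right_continuousW; exact: continuous_clamp_comp.
pose G : cumulative R R := HB.pack g (isCumulative.Build R _ R g gnd grc).
pose m := lebesgue_stieltjes_measure G.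
have mE a b : a <= b -> m `]a, b]%classic = (g b - g a)%:E.
  move=> ab; rewrite /m/= /lebesgue_stieltjes_measure /measure_extension measurable_mu_extE/=; last exact: is_ocitv.
  by rewrite wlength_itv_bnd.
have mD : measurable (`]0, T]%classic : set (measurableTypeR R)) by exact: measurable_itv.
have mDy : (m `]0%R, T]%classic < +oo)%E by rewrite mE// ltry.
exists (charge_of_finite_measure (mfrestr mD mDy)); split => [s t s0 st tT|A mA A0].
  transitivity (m (`]s, t]%classic `&` `]0, T]%classic)) => //.
  rewrite setIidl; last first.
    move=> x /=; rewrite !in_itv/= => /andP[sx xt].
    by rewrite (le_lt_trans s0 sx) (le_trans xt tT).
  by rewrite mE// /g/= !clamp_id// in_itv/= ?s0 ?(le_trans s0 st) ?tT ?(le_trans st tT).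
transitivity (m (A `&` `]0, T]%classic)) => //.
by rewrite A0; exact: (measure0 m).
Qed.

Lemma differential_measureB T f g mu nu :
  is_differential_measure T f mu -> is_differential_measure T g nu ->
  is_differential_measure T (f \- g) (cadd mu (copp nu)).
Proof.
move=> [mf m0] [nf n0]; split => [s t s0 st tT|A mA A0].
  transitivity (mu `]s, t]%classic - nu `]s, t]%classic)%E => //.
  by rewrite mf// nf// -EFinB; congr (_%:E); rewrite /=; ring.
by transitivity (mu A - nu A)%E => //; rewrite m0// n0// oppe0 adde0.
Qed.

(** Jordan decomposition: [f = V - (V - f)], where the total variation [V] and
    [V - f] are both continuous and nondecreasing. *)
Lemma differential_measureP T f : 0 < T ->
  {within `[0, T], continuous f} -> bounded_variation 0 T f ->
  is_differential_measure T f (differential_measure T f).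
Proof.
move=> T0 cf bvf; rewrite /differential_measure; case: pselect => [ex|]; first exact: svalP.
case; pose V := fine \o total_variation 0 ^~ f.
have T0' := ltW T0.
have cV : {within `[0, T], continuous V} by exact: total_variation_continuous.
have fV t : t \in `[0, T] -> total_variation 0 t f \is a fin_num.
  rewrite in_itv/= => /andP[t0 tT]; apply/bounded_variationP => //.
  exact: bounded_variationl bvf.
have ndV : {in `[0, T] &, {homo V : s t / s <= t}}.
  move=> s t sT tT st; apply: fine_le; rewrite ?fV//.
  exact: (@total_variation_nondecreasing _ 0 T).
have ndW : {in `[0, T] &, {homo V \- f : s t / s <= t}}.
  move=> s t sT tT st /=.
  have [s0 t0] : 0 <= s /\ 0 <= t by move: sT tT; rewrite !in_itv/= => /andP[-> _] /andP[-> _].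
  have : (total_variation 0 t f = total_variation 0 s f + total_variation s t f)%E.
    exact: total_variationD.
  have stfin : total_variation s t f \is a fin_num.
    apply/bounded_variationP => //.
    move: sT tT; rewrite !in_itv/= => /andP[_ sT] /andP[_ tT].
    by apply: (bounded_variationr s0 st); exact: bounded_variationl bvf.
  have := total_variation_ge f st.
  rewrite /V/= => h ->; rewrite fineD ?fV// lerBDl.
  have : `|f t - f s| <= fine (total_variation s t f) by rewrite -lee_fin fineK.
  have := ler_norm (f t - f s); lra.
have [mu muP] := nondecreasing_differential_measure T0 cV ndV.
have cW : {within `[0, T], continuous (V \- f)}.
  by move=> x; apply: cvgB; [exact: cV|exact: cf].
have [nu nuP] := nondecreasing_differential_measure T0 cW ndW.
have := differential_measureB muP nuP.
have -> : V \- (V \- f) = f by apply/funext => x /=; rewrite subKr.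
by exists (cadd mu (copp nu)).
Qed.

End differential_measure_exists.

Lemma ae_le0_integral d (S : measurableType d) (R : realType)
    (mu : {measure set S -> \bar R}) (D : set S) (f : S -> \bar R) :
  measurable D -> measurable_fun D f ->
  {ae mu, forall x, D x -> f x <= 0}%E -> (\int[mu]_(x in D) f x <= 0)%E.
Proof.
move=> mD mf f0; rewrite integralE.
have -> : (\int[mu]_(x in D) f^\+ x = 0)%E; last by rewrite sub0e oppe_le0; exact: integral_ge0.
rewrite -[RHS](integral0 mu D); apply: ae_eq_integral => //.
- exact: measurable_funepos.
- by apply: filterS f0 => x fx0 Dx; rewrite funeposE; apply/max_idPr; exact: fx0.
Qed.

Lemma ae_ge0_integral d (S : measurableType d) (R : realType)
    (mu : {measure set S -> \bar R}) (D : set S) (f : S -> \bar R) :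
  measurable D -> measurable_fun D f ->
  {ae mu, forall x, D x -> 0 <= f x}%E -> (0 <= \int[mu]_(x in D) f x)%E.
Proof.
move=> mD mf f0; rewrite integralE.
have -> : (\int[mu]_(x in D) f^\- x = 0)%E; last by rewrite sube0; exact: integral_ge0.
rewrite -[RHS](integral0 mu D); apply: ae_eq_integral => //.
- exact: measurable_funeneg.
- by apply: filterS f0 => x fx0 Dx; rewrite funenegE; apply/max_idPr; rewrite leeNl oppe0; exact: fx0.
Qed.

Section density_sign.
Context {R : realType}.
Implicit Types (T : R) (f : R -> R).

Lemma variation_measure_dominates (nu : {charge set (measurableTypeR R) -> \bar R}) :
  nu `<< variation_measure nu.
Proof.
apply/null_content_dominatesP => A mA v0; apply/eqP.
by rewrite -abse_eq0 eq_le abse_ge0 andbT -v0 abse_charge_variation.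
Qed.

(** Lets [filterS] be applied to properties that hold almost everywhere for the
    variation measure. *)
Global Instance ae_variation_filter (nu : {charge set (measurableTypeR R) -> \bar R}) :
  Filter (nbhs (almost_everywhere (variation_measure nu))).
Proof. exact: (ae_filter_ringOfSetsType (variation_measure nu)). Qed.

(** The increment [f t - f s] is the integral over ]s, t] of the density against
    the variation measure, so it inherits the sign of the density. *)
Lemma density_le0_nonincreasing T f s t : 0 < T ->
  {within `[0, T], continuous f} -> bounded_variation 0 T f ->
  0 <= s -> s <= t -> t <= T ->
  {ae variation_measure (differential_measure T f), forall r : R,
    r \in `]s, t] -> differential_density T f r <= 0} ->
  f t <= f s.
Proof.
move=> T0 cf bvf s0 st tT d0.
have [/(_ s t s0 st tT) fE _] := differential_measureP T0 cf bvf.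
have dom := @variation_measure_dominates (differential_measure T f).
rewrite -subr_le0 -lee_fin -fE.
rewrite (Radon_Nikodym_integral dom); last exact: measurable_itv.
apply: ae_le0_integral.
- exact: measurable_itv.
- by apply: measurable_funTS; exact: measurable_int (Radon_Nikodym_integrable dom).
- apply: filterS d0 => r h rst.
  have := h rst; rewrite /differential_density -lee_fin fineK//.
  exact: Radon_Nikodym_fin_num.
Qed.

Lemma density_ge0_nondecreasing T f s t : 0 < T ->
  {within `[0, T], continuous f} -> bounded_variation 0 T f ->
  0 <= s -> s <= t -> t <= T ->
  {ae variation_measure (differential_measure T f), forall r : R,
    r \in `]s, t] -> 0 <= differential_density T f r} ->
  f s <= f t.
Proof.
move=> T0 cf bvf s0 st tT d0.
have [/(_ s t s0 st tT) fE _] := differential_measureP T0 cf bvf.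
have dom := @variation_measure_dominates (differential_measure T f).
rewrite -subr_ge0 -lee_fin -fE.
rewrite (Radon_Nikodym_integral dom); last exact: measurable_itv.
apply: ae_ge0_integral.
- exact: measurable_itv.
- by apply: measurable_funTS; exact: measurable_int (Radon_Nikodym_integrable dom).
- apply: filterS d0 => r h rst.
  have := h rst; rewrite /differential_density -lee_fin fineK//.
  exact: Radon_Nikodym_fin_num.
Qed.

End density_sign.

(** * Monotonicity and stability of the reflection term *)

(** The last time before [t] at which [g <= 0]: by compactness it is attained. *)
Lemma last_exit (R : realType) (g : R -> R) (a t : R) : a <= t ->
  continuous g -> g a <= 0 -> 0 < g t ->
  exists s, [/\ a <= s, s < t, g s <= 0 & forall r, r \in `]s, t] -> 0 < g r].
Proof.
move=> at_ cg ga gt.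
pose A := `[a, t]%classic `&` g @^-1` [set x | x <= 0].
have cA : compact A.
  apply: (subclosed_compact _ (@segment_compact _ a t)); last by move=> x [].
  apply: closedI; first exact: itv_closed.
  by apply: closed_comp => [x _|]; [exact: cg|exact: closed_le].
have A0 : A !=set0 by exists a; split => //=; rewrite in_itv/= lexx.
have cid : {within A, continuous (fun x : R => x)}.
  by apply: continuous_subspaceT => x; exact: cvg_id.
have [s /[!inE]-[/= + gs] smax] := compact_EVT_max A0 cA cid.
rewrite in_itv/= => /andP[as_ st].
exists s; split => //.
  by rewrite lt_neqAle st andbT; apply/eqP => E; move: gs; rewrite E leNgt gt.
move=> r; rewrite in_itv/= => /andP[sr rt]; rewrite ltNge; apply/negP => gr.
have /smax : r \in A.
  by rewrite inE; split => //=; rewrite in_itv/= rt (le_trans as_ (ltW sr)).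
by rewrite leNgt sr.
Qed.

Section reflection_monotone.
Context {R : realType}.
Variables (T : R) (C : R -> set R) (b : R -> R) (x0 : R) (w x y : R -> R).
Hypothesis T_gt0 : 0 < T.
Hypothesis sol : skorokhod_solution T C b x0 w x y.

(** A point of [C r] strictly below [x r] leaves only vectors that point upwards
    in the normal cone, and the density is the opposite of such a vector. *)
Lemma regulator_nonincreasing s t : 0 <= s -> s <= t -> t <= T ->
  (forall r, r \in `]s, t] -> exists2 p, C r p & p < x r) -> y t <= y s.
Proof.
move=> s0 st tT below; have [[_ cy] bvy _ _ cone] := sol.
apply: (density_le0_nonincreasing T_gt0 cy bvy s0 st tT).
apply: filterS cone => r cone_r rst.
have rT : r \in `[0, T].
  move: rst; rewrite !in_itv/= => /andP[sr rt].
  by rewrite (le_trans s0 (ltW sr)) (le_trans rt tT).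
have [p Cp px] := below r rst.
have := cone_r rT p Cp; rewrite nmulr_lle0 ?subr_lt0//.
by rewrite oppr_ge0.
Qed.

Lemma regulator_nondecreasing s t : 0 <= s -> s <= t -> t <= T ->
  (forall r, r \in `]s, t] -> exists2 p, C r p & x r < p) -> y s <= y t.
Proof.
move=> s0 st tT above; have [[_ cy] bvy _ _ cone] := sol.
apply: (density_ge0_nondecreasing T_gt0 cy bvy s0 st tT).
apply: filterS cone => r cone_r rst.
have rT : r \in `[0, T].
  move: rst; rewrite !in_itv/= => /andP[sr rt].
  by rewrite (le_trans s0 (ltW sr)) (le_trans rt tT).
have [p Cp px] := above r rst.
have := cone_r rT p Cp; rewrite pmulr_lle0 ?subr_gt0//.
by rewrite oppr_le0.
Qed.

End reflection_monotone.

Section reflection_stability.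
Context {R : realType}.
Variables (T : R) (C : R -> set R) (b : R -> R) (x0 : R).
Hypothesis T_gt0 : 0 < T.

(** After the last time at which [y' - y <= m], the unreflected parts are too close
    to prevent [x' > x].  Each path is then a point of [C] that lies on one side
    of the other path, so [y'] decreases and [y] increases: the difference cannot
    grow above [m]. *)
Lemma regulator_le w x y w' x' y' t m :
  skorokhod_solution T C b x0 w x y -> skorokhod_solution T C b x0 w' x' y' ->
  t \in `[0, T] ->
  (forall s, s \in `[0, t] -> `|(x' s - y' s) - (x s - y s)| <= m) ->
  y' t - y t <= m.
Proof.
move=> sol sol' /[dup] tT; rewrite {1}in_itv/= => /andP[t0 tT'] Em.
have [[_ cy] _ Cx [y0 _] _] := sol.
have [[_ cy'] _ Cx' [y0' _] _] := sol'.
rewrite leNgt; apply/negP => mt.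
have T0 := ltW T_gt0.
have zT : (0 : R) \in `[0, T] by rewrite in_itv/= lexx.
have m0 : 0 <= m by apply: le_trans (Em 0 _) => //; rewrite in_itv/= lexx.
pose g r := (y' \o clamp T) r - (y \o clamp T) r - m.
have cg : continuous g.
  move=> r; apply: cvgB; last exact: cvg_cst.
  by apply: cvgB; exact: continuous_clamp_comp.
have gE r : r \in `[0, T] -> g r = y' r - y r - m by move=> rT; rewrite /g/= clamp_id.
have [||s [s0 st gs gpos]] := @last_exit _ g 0 t t0 cg.
- by rewrite gE// y0 y0' subrr sub0r oppr_le0.
- by rewrite gE// subr_gt0.
have sT : s \in `[0, T] by rewrite in_itv/= s0 (le_trans (ltW st)).
have xx' r : r \in `]s, t] -> x r < x' r.
  move=> rst.
  have rt : r \in `[0, t].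
    by move: rst; rewrite !in_itv/= => /andP[sr ->]; rewrite (le_trans s0 (ltW sr)).
  have rT : r \in `[0, T].
    by move: rt; rewrite !in_itv/= => /andP[-> rt]; rewrite (le_trans rt).
  have := gpos r rst; rewrite gE// => h.
  have := Em r rt; rewrite ler_norml => /andP[h' _]; lra.
have rT r : r \in `]s, t] -> r \in `[0, T].
  by rewrite !in_itv/= => /andP[sr rt]; rewrite (le_trans s0 (ltW sr)) (le_trans rt).
have d1 : y' t <= y' s.
  apply: (regulator_nonincreasing T_gt0 sol') => // [|r rst]; first exact: ltW.
  by exists (x r); [exact: Cx (rT _ rst)|exact: xx'].
have d2 : y s <= y t.
  apply: (regulator_nondecreasing T_gt0 sol) => // [|r rst]; first exact: ltW.
  by exists (x' r); [exact: Cx' (rT _ rst)|exact: xx'].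
by move: gs; rewrite gE//; lra.
Qed.

Lemma regulator_dist_le w x y w' x' y' t m :
  skorokhod_solution T C b x0 w x y -> skorokhod_solution T C b x0 w' x' y' ->
  t \in `[0, T] ->
  (forall s, s \in `[0, t] -> `|(x' s - y' s) - (x s - y s)| <= m) ->
  `|y' t - y t| <= m.
Proof.
move=> sol sol' tT Em; rewrite ler_norml; apply/andP; split; last exact: (regulator_le sol sol').
rewrite lerNl opprB; apply: (regulator_le sol' sol) => // s sT.
by rewrite distrC; exact: Em.
Qed.

End reflection_stability.

(** * Lipschitz drifts and integrals of continuous functions *)
Section lipschitz_drift.
Context {R : realType}.
Implicit Types (b x f : R -> R) (L T : R).
Local Notation mu := (@lebesgue_measure R).

Lemma lip_seminormP b u v : lipschitz b ->
  `|b u - b v| <= lip_seminorm b * `|u - v|.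
Proof.
move=> [M [_ /(_ (M + 1))]]; rewrite ltrDl ltr01 => /(_ isT) bM.
have [->|uv] := eqVneq u v; first by rewrite !subrr normr0 mulr0.
have uv0 : 0 < `|u - v| by rewrite normr_gt0 subr_eq0.
rewrite -ler_pdivrMr//; apply: ub_le_sup; last by exists (u, v).
exists (M + 1) => _ [[p q]/= pq <-].
rewrite ler_pdivrMr ?normr_gt0 ?subr_eq0//.
exact: (bM (p, q)).
Qed.

Lemma lip_seminorm_ge0 b : lipschitz b -> 0 <= lip_seminorm b.
Proof.
move=> bL; have := lip_seminormP 1 0 bL; rewrite subr0 normr1 mulr1.
exact: le_trans.
Qed.

Lemma lip_seminorm_le b L u v : lipschitz b -> `|b 0| + lip_seminorm b <= L ->
  `|b u - b v| <= L * `|u - v|.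
Proof.
move=> bL bL'; apply: (le_trans (lip_seminormP u v bL)); apply: ler_wpM2r => //.
by apply: le_trans bL'; rewrite lerDr.
Qed.

Lemma lip_growth b L u : lipschitz b -> `|b 0| + lip_seminorm b <= L ->
  `|b u| <= L * (1 + `|u|).
Proof.
move=> bL bL'; have := lip_seminormP u 0 bL; rewrite subr0 => h.
have -> : b u = b 0 + (b u - b 0) by ring.
apply: (le_trans (ler_normD _ _)).
apply: (@le_trans _ _ (`|b 0| + lip_seminorm b * `|u|)); first by rewrite lerD2l.
have := lip_seminorm_ge0 bL; have := normr_ge0 (b 0); have := normr_ge0 u; nra.
Qed.

Lemma lip_continuous b : lipschitz b -> continuous b.
Proof.
move=> bL u; apply/cvgrPdist_le => e e0.
have k0 : 0 < lip_seminorm b + 1 by rewrite ltr_pwDr// lip_seminorm_ge0.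
near=> v; apply: (le_trans (lip_seminormP u v bL)).
apply: (@le_trans _ _ ((lip_seminorm b + 1) * `|u - v|)).
  by rewrite ler_wpM2r// lerDl.
rewrite -ler_pdivlMl//; near: v; apply: cvgr_dist_le => //.
by rewrite mulr_gt0// invr_gt0.
Unshelve. all: by end_near. Qed.

Lemma within_comp b x T : lipschitz b -> {within `[0, T], continuous x} ->
  {within `[0, T], continuous (b \o x)}.
Proof.
move=> bL cx u; apply: (@continuous_comp (subspace `[0, T]) R R x b u).
  exact: cx.
exact: lip_continuous.
Qed.

Lemma within_itv_integrable f (s t : R) : {within `[s, t], continuous f} ->
  mu.-integrable `[s, t] (EFin \o f).
Proof. by move=> cf; apply: continuous_compact_integrable => //; exact: segment_compact. Qed.

Lemma subitv_within f T (s t : R) : 0 <= s -> t <= T ->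
  {within `[0, T], continuous f} -> {within `[s, t], continuous f}.
Proof.
move=> s0 tT cf; apply: continuous_subspaceW cf => r /=.
by rewrite !in_itv/= => /andP[sr rt]; rewrite (le_trans s0 sr) (le_trans rt tT).
Qed.

(** The bound is asked on the half-open interval only, which is where the
    increment of the primitive lives. *)
Lemma Rintegral_increment_le f T M s t : {within `[0, T], continuous f} ->
  0 <= s -> s <= t -> t <= T ->
  (forall r, r \in `]s, t] -> `|f r| <= M) ->
  `|\int[mu]_(r in `[0, t]) f r - \int[mu]_(r in `[0, s]) f r| <= M * (t - s).
Proof.
move=> cf s0 st tT fM.
have ift : mu.-integrable `[0, t] (EFin \o f).
  by apply: within_itv_integrable; exact: subitv_within cf.
have ifst : mu.-integrable `]s, t] (EFin \o f).
  apply: (integrableS _ _ _ ift) => //; apply: subset_itvr.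
  by rewrite bnd_simp.
rewrite Rintegral_itvB//.
have mst : (mu `]s, t] = (t - s)%:E)%E.
  rewrite lebesgue_measure_itv/= lte_fin -EFinD; case: ltP => // ts.
  by have -> : s = t; [apply/eqP; rewrite eq_le st ts|rewrite subrr].
apply: (le_trans (le_normr_Rintegral _ ifst)) => //.
have -> : M * (t - s) = \int[mu]_(r in `]s, t]) cst M r.
  by rewrite Rintegral_cst//= mst.
apply: le_Rintegral => //.
- exact: integrable_norm.
- apply: measurable_bounded_integrable => //.
  + by rewrite /= lebesgue_measure_itv/=; case: ifP => _; rewrite -?EFinB ltry.
  + by exists `|M|; split; [exact: num_real|move=> z zM r _ /=; exact: ltW].
Qed.

End lipschitz_drift.

(** * Stability of the reflection problem *)

Lemma Rintegral_expR (R : realType) (l t : R) : 0 < l -> 0 <= t ->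
  \int[@lebesgue_measure R]_(s in `[0, t]) expR (l * s) = l^-1 * (expR (l * t) - 1).
Proof.
move=> l0; rewrite le_eqVlt => /predU1P[<-|t0].
  by rewrite set_itv1 Rintegral_set1 mulr0 expR0 subrr mulr0.
have d (s : R) : is_derive s 1 (fun s : R => l^-1 * expR (l * s)) (expR (l * s)).
  have -> : expR (l * s) = l^-1 *: (l *: expR (l * s)).
    by rewrite /GRing.scale/= mulKf// lt0r_neq0.
  apply: (@is_deriveZ _ _ _ (fun s : R => expR (l * s))).
  have -> : l *: expR (l * s) = expR (l * s) * (l *: 1).
    by rewrite /GRing.scale/=; ring.
  apply: (@is_derive1_comp _ expR (fun s : R => l * s)).
have c : continuous (fun s : R => expR (l * s)).
  move=> s; apply: continuous_comp; last exact: continuous_expR.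
  by apply: cvgM; [exact: cvg_cst|exact: cvg_id].
rewrite /Rintegral (@continuous_FTC2 _ _ (fun s => l^-1 * expR (l * s)))//=.
- by rewrite mulr0 expR0 mulr1; ring.
- exact: continuous_subspaceT.
- split => [s _||]; first exact: ex_derive.
  + by apply: cvg_at_right_filter; apply: cvgM; [exact: cvg_cst|exact: c].
  + by apply: cvg_at_left_filter; apply: cvgM; [exact: cvg_cst|exact: c].
- by move=> s _; rewrite derive1E; exact: derive_val.
Qed.

Section stability.
Context {R : realType}.
Variables (T L : R) (C : R -> set R) (b : R -> R) (x0 : R).
Hypotheses (T_gt0 : 0 < T) (L_gt0 : 0 < L).
Hypotheses (b_lip : lipschitz b) (bL : `|b 0| + lip_seminorm b <= L).
Local Notation mu := (@lebesgue_measure R).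

(** The unreflected parts differ by at most [W] plus the integral of
    [L * |x' - x|], and [|x' - x|] is at most twice the running maximum of their
    distance by [regulator_dist_le].  The resulting Gronwall inequality is closed
    in a weighted norm. *)
Lemma skorokhod_stability w x y w' x' y' W t :
  skorokhod_solution T C b x0 w x y -> skorokhod_solution T C b x0 w' x' y' ->
  (forall s, s \in `[0, T] -> `|w' s - w s| <= W) -> t \in `[0, T] ->
  `|(x' t - w' t) - (x t - w t)| <= (4 * expR (4 * L * T) + 1) * W.
Proof.
move=> sol sol' wW tT.
have [[cx cy] _ _ [_ xE] _] := sol.
have [[cx' cy'] _ _ [_ xE'] _] := sol'.
have T0 := ltW T_gt0.
have W0 : 0 <= W by apply: le_trans (wW _ tT).
pose E s := (x' s - y' s) - (x s - y s).
(* With the weight of rate [4 * L], the drift returns only one half of the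
   maximum [G] of the weighted error, so that [G <= G / 2 + W]. *)
pose e s := expR (- (4 * L * s)) * `|E s|.
have cE : {within `[0, T], continuous E}.
  by move=> s; apply: cvgB; apply: cvgB; [exact: cx'|exact: cy'|exact: cx|exact: cy].
have ce : {within `[0, T], continuous e}.
  move=> s; apply: cvgM; last by apply: cvg_norm; exact: cE.
  apply: (@continuous_subspaceT _ _ _ (fun s : R => expR (- (4 * L * s)))) => r.
  apply: continuous_comp; last exact: continuous_expR.
  by apply: cvgN; apply: cvgM; [exact: cvg_cst|exact: cvg_id].
have [p pT emax] := EVT_max T0 ce.
have exp_inv s : expR (4 * L * s) * expR (- (4 * L * s)) = 1.
  by rewrite -expRD subrr expR0.
pose G := e p.
have G0 : 0 <= G by rewrite /G /e mulr_ge0// expR_ge0.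
have EG s : s \in `[0, T] -> `|E s| <= G * expR (4 * L * s).
  move=> sT; have -> : `|E s| = e s * expR (4 * L * s).
    by rewrite /e mulrAC [expR (- _) * _]mulrC exp_inv mul1r.
  by apply: ler_wpM2r; [exact: expR_ge0|exact: emax].
have DG s : s \in `[0, T] -> `|y' s - y s| <= G * expR (4 * L * s).
  move=> sT; apply: (regulator_dist_le T_gt0 sol sol' sT) => r rs.
  have rT : r \in `[0, T].
    by move: rs sT; rewrite !in_itv/= => /andP[-> rs] /andP[_]; exact: le_trans.
  apply: (le_trans (EG r rT)); apply: ler_wpM2l => //; rewrite ler_expR.
  by move: rs; rewrite in_itv/= => /andP[_ rs]; rewrite ler_wpM2l// mulr_ge0// ltW.
have xG s : s \in `[0, T] -> `|x' s - x s| <= 2 * (G * expR (4 * L * s)).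
  move=> sT; have -> : x' s - x s = E s + (y' s - y s) by rewrite /E; ring.
  by apply: (le_trans (ler_normD _ _)); have := EG s sT; have := DG s sT; lra.
have p0 : 0 <= p by move: pT; rewrite in_itv/= => /andP[].
have pT' : p <= T by move: pT; rewrite in_itv/= => /andP[].
have Ep : `|E p| <= 2^-1 * (G * expR (4 * L * p)) + W.
  have ib : mu.-integrable `[0, p] (EFin \o (b \o x)).
    by apply: within_itv_integrable; apply: (subitv_within _ pT' (within_comp b_lip cx)).
  have ib' : mu.-integrable `[0, p] (EFin \o (b \o x')).
    by apply: within_itv_integrable; apply: (subitv_within _ pT' (within_comp b_lip cx')).
  have ibb : mu.-integrable `[0, p] (EFin \o ((b \o x') \- (b \o x))).
    apply: within_itv_integrable => r; apply: cvgB.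
      exact: (subitv_within _ pT' (within_comp b_lip cx')).
    exact: (subitv_within _ pT' (within_comp b_lip cx)).
  have -> : E p = \int[mu]_(s in `[0, p]) (b (x' s) - b (x s)) + (w' p - w p).
    by rewrite /E xE// xE'// RintegralB//; ring.
  apply: (le_trans (ler_normD _ _)); apply: lerD; last exact: wW.
  apply: (le_trans (le_normr_Rintegral _ ibb)) => //.
  apply: (@le_trans _ _ (\int[mu]_(s in `[0, p]) (2 * L * G * expR (4 * L * s)))).
    apply: le_Rintegral => //.
    - exact: integrable_norm.
    - apply: within_itv_integrable; apply: continuous_subspaceT => r.
      apply: cvgM; first exact: cvg_cst.
      apply: continuous_comp; last exact: continuous_expR.
      by apply: cvgM; [exact: cvg_cst|exact: cvg_id].
    - move=> s /= sp; have sT : s \in `[0, T].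
        by move: sp; rewrite !in_itv/= => /andP[-> sp]; exact: le_trans pT'.
      apply: (le_trans (lip_seminorm_le _ _ b_lip bL)).
      have -> : 2 * L * G * expR (4 * L * s) = L * (2 * (G * expR (4 * L * s))) by ring.
      by apply: ler_wpM2l; [exact: ltW|exact: xG].
  rewrite RintegralZl//; last first.
    apply: within_itv_integrable; apply: continuous_subspaceT => r.
    apply: continuous_comp; last exact: continuous_expR.
    by apply: cvgM; [exact: cvg_cst|exact: cvg_id].
  rewrite Rintegral_expR//; last by rewrite mulr_gt0.
  have -> : 2 * L * G * ((4 * L)^-1 * (expR (4 * L * p) - 1)) =
      2^-1 * (G * (expR (4 * L * p) - 1)) by field; exact: lt0r_neq0.
  by nra.
have GW : G <= 2 * W.
  have : G <= 2^-1 * G + W.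
    have e1 : expR (- (4 * L * p)) <= 1.
      by rewrite -expR0 ler_expR oppr_le0 !mulr_ge0// ltW.
    rewrite {1}/G /e; apply: (le_trans (ler_wpM2l (expR_ge0 _) Ep)).
    rewrite mulrDr; apply: lerD.
      rewrite mulrCA; apply: ler_wpM2l; first by rewrite invr_ge0.
      by rewrite mulrCA [_ * expR (4 * L * p)]mulrC exp_inv mulr1.
    by have := expR_ge0 (- (4 * L * p)); nra.
  lra.
have t0T : expR (4 * L * t) <= expR (4 * L * T).
  rewrite ler_expR; move: tT; rewrite in_itv/= => /andP[_ tT].
  by rewrite ler_wpM2l// mulr_ge0// ltW.
have -> : x' t - w' t - (x t - w t) = E t + (y' t - y t) - (w' t - w t).
  by rewrite /E; ring.
apply: (le_trans (ler_normB _ _)); rewrite mulrDl mul1r.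
apply: lerD; last exact: wW.
apply: (le_trans (ler_normD _ _)).
have := EG t tT; have := DG t tT; have := expR_ge0 (4 * L * T).
have := expR_ge0 (4 * L * t); nra.
Qed.

End stability.

(** * Lipschitz regularity of the limit path *)

Section limit_regularity.
Context {R : realType}.
Variables (T : R) (C : R -> set R).
Hypothesis T_gt0 : 0 < T.

(** The distance to [C t] is an infimum that may fail to be attained.  A larger
    constant gives a strict inequality for it as soon as [s != t], hence an
    actual point of [C t]. *)
Lemma hausdorff_lipschitz_near : hausdorff_lipschitz T C ->
  exists2 k : R, 0 < k & forall s t x, s \in `[0, T] -> t \in `[0, T] ->
    s != t -> C s x -> exists2 p, C t p & `|x - p| < k * `|s - t|.
Proof.
move=> [k0 Ck]; exists (`|k0| + 1); first by rewrite ltr_pwDr.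
move=> s t x sT tT st Cx.
have st0 : 0 < `|s - t| by rewrite normr_gt0 subr_eq0.
have : (edist_inf (C t) x < ((`|k0| + 1) * `|s - t|)%:E)%E.
  apply: (@le_lt_trans _ _ (k0 * `|s - t|)%:E).
    apply: le_trans (Ck s t sT tT); rewrite /hausdorff_dist le_max; apply/orP; left.
    by apply: ereal_sup_ubound; exists x.
  by rewrite lte_fin ltr_pM2r// ltr_pwDr// ler_norm.
move=> /ereal_inf_lt[_ [p Cp <-]] /edist_lt_ball; rewrite /ball/= => h.
by exists p.
Qed.

(** Bounds the drift along every path that stays in [C], by a constant that
    depends on [C] and [T] only. *)
Lemma hausdorff_lipschitz_bounded : hausdorff_lipschitz T C -> compact (C 0) ->
  exists2 M : R, 0 < M & forall t z, t \in `[0, T] -> C t z -> `|z| <= M.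
Proof.
move=> /hausdorff_lipschitz_near[k k0 near] /compact_bounded[M0 [_ bM]].
have T0 := ltW T_gt0.
exists (`|M0| + 1 + k * T); first by rewrite addr_gt0 ?ltr_pwDr// mulr_gt0.
have bM' z : C 0 z -> `|z| <= `|M0| + 1.
  by apply: bM; rewrite ltr_pwDr// ler_norm.
move=> t z tT Cz; have [t0|t0] := eqVneq t 0.
  by rewrite t0 in Cz; apply: (le_trans (bM' _ Cz)); rewrite lerDl mulr_ge0// ltW.
have zT : (0 : R) \in `[0, T] by rewrite in_itv/= lexx.
have [p Cp zp] := near t 0 z tT zT t0 Cz.
have -> : z = p + (z - p) by ring.
apply: (le_trans (ler_normD _ _)); apply: lerD; first exact: bM'.
apply: (le_trans (ltW zp)); rewrite subr0; apply: ler_wpM2l; first exact: ltW.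
by move: tT; rewrite in_itv/= => /andP[t0' tT]; rewrite ger0_norm.
Qed.

Section speed.
Variables (b : R -> R) (x0 : R) (x y : R -> R) (k M : R).
Hypothesis sol : skorokhod_solution T C b x0 (fun=> 0) x y.
Hypothesis b_lip : lipschitz b.
Hypothesis bM : forall t z, t \in `[0, T] -> C t z -> `|b z| <= M.
Hypothesis near : forall s t x, s \in `[0, T] -> t \in `[0, T] ->
    s != t -> C s x -> exists2 p, C t p & `|x - p| < k * `|s - t|.
Hypothesis k_gt0 : 0 < k.

Let sub_itv s t r : s \in `[0, T] -> t \in `[0, T] -> r \in `[s, t] -> r \in `[0, T].
Proof.
rewrite !in_itv/= => /andP[s0 _] /andP[_ tT] /andP[sr rt].
by rewrite (le_trans s0 sr) (le_trans rt tT).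
Qed.

Let itv_ge0 s : s \in `[0, T] -> 0 <= s. Proof. by rewrite in_itv/= => /andP[]. Qed.

Let itv_leT s : s \in `[0, T] -> s <= T. Proof. by rewrite in_itv/= => /andP[]. Qed.

Let M_ge0 : 0 <= M.
Proof.
have [_ _ Cx _ _] := sol.
have zT : (0 : R) \in `[0, T] by rewrite in_itv/= lexx ltW.
exact: le_trans (bM zT (Cx _ zT)).
Qed.

Let drift_le s t : s \in `[0, T] -> t \in `[0, T] -> s <= t ->
  `|(x t - y t) - (x s - y s)| <= M * (t - s).
Proof.
move=> sT tT st; have [[cx cy] _ Cx [_ xE] _] := sol.
rewrite (xE t)// (xE s)// !addr0 !addrK.
have s0 := itv_ge0 sT; have tT' := itv_leT tT.
apply: (Rintegral_increment_le (within_comp b_lip cx)) => // r rst.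
have rT : r \in `[0, T].
  by apply: (sub_itv sT tT); move: rst; rewrite !in_itv/= => /andP[/ltW -> ->].
exact: bM (Cx _ rT).
Qed.

(** Suppose that [x] rises above the line of slope [k + M] issued from [x s].
    Since [C r] has a point within [k * (r - s)] of [x s], after the last crossing
    of that line there is always a point of [C r] below [x r]: the regulator is
    nonincreasing, and [x] rises by the drift only, at speed at most [M]. *)
Lemma solution_increase s t : s \in `[0, T] -> t \in `[0, T] -> s <= t ->
  x t - x s <= (k + M) * (t - s).
Proof.
move=> sT tT st; have [[cx cy] _ Cx _ _] := sol.
rewrite leNgt; apply/negP => fast.
pose g r := (x \o clamp T) r - x s - (k + M) * (r - s).
have cg : continuous g.
  move=> r; apply: cvgB.
    by apply: cvgB; [apply: continuous_clamp_comp => //; exact: ltW|exact: cvg_cst].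
  by apply: cvgM; [exact: cvg_cst|apply: cvgB; [exact: cvg_id|exact: cvg_cst]].
have gE r : r \in `[0, T] -> g r = x r - x s - (k + M) * (r - s).
  by move=> rT; rewrite /g/= clamp_id.
have [||q [sq qt gq gpos]] := @last_exit _ g s t st cg.
- by rewrite gE// !subrr mulr0 subrr.
- by rewrite gE// subr_gt0.
have qT : q \in `[0, T] by apply: (sub_itv sT tT); rewrite in_itv/= sq ltW.
have rq r : r \in `]q, t] -> r \in `[0, T].
  by move=> rqt; apply: (sub_itv qT tT); move: rqt; rewrite !in_itv/= => /andP[/ltW -> ->].
have yqt : y t <= y q.
  have q0 := itv_ge0 qT; have tT' := itv_leT tT.
  apply: (regulator_nonincreasing T_gt0 sol) => //; first exact: ltW.
  move=> r rqt; have rT := rq r rqt.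
  have sr : s < r.
    by move: rqt; rewrite in_itv/= => /andP[qr _]; exact: le_lt_trans qr.
  have [|p Cp xp] := near sT rT _ (Cx _ sT); first by rewrite lt_eqF.
  exists p => //; have := gpos r rqt; rewrite gE//.
  have sr0 : 0 <= r - s by rewrite subr_ge0 ltW.
  move: xp; rewrite [`|s - r|]distrC (ger0_norm sr0) ltr_norml => /andP[xp _].
  have : 0 <= M * (r - s) by rewrite mulr_ge0.
  lra.
have := drift_le qT tT (ltW qt); rewrite ler_norml => /andP[_ dr].
move: gq; rewrite gE//.
have : 0 <= k * (t - q) by rewrite mulr_ge0// ?subr_ge0; apply: ltW.
lra.
Qed.

(** The mirror image of [solution_increase]: points of [C r] above [x r] keep the
    regulator nondecreasing. *)
Lemma solution_decrease s t : s \in `[0, T] -> t \in `[0, T] -> s <= t ->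
  x s - x t <= (k + M) * (t - s).
Proof.
move=> sT tT st; have [[cx cy] _ Cx _ _] := sol.
rewrite leNgt; apply/negP => fast.
pose g r := x s - (x \o clamp T) r - (k + M) * (r - s).
have cg : continuous g.
  move=> r; apply: cvgB.
    by apply: cvgB; [exact: cvg_cst|apply: continuous_clamp_comp => //; exact: ltW].
  by apply: cvgM; [exact: cvg_cst|apply: cvgB; [exact: cvg_id|exact: cvg_cst]].
have gE r : r \in `[0, T] -> g r = x s - x r - (k + M) * (r - s).
  by move=> rT; rewrite /g/= clamp_id.
have [||q [sq qt gq gpos]] := @last_exit _ g s t st cg.
- by rewrite gE// !subrr mulr0 subrr.
- by rewrite gE// subr_gt0.
have qT : q \in `[0, T] by apply: (sub_itv sT tT); rewrite in_itv/= sq ltW.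
have rq r : r \in `]q, t] -> r \in `[0, T].
  by move=> rqt; apply: (sub_itv qT tT); move: rqt; rewrite !in_itv/= => /andP[/ltW -> ->].
have yqt : y q <= y t.
  have q0 := itv_ge0 qT; have tT' := itv_leT tT.
  apply: (regulator_nondecreasing T_gt0 sol) => //; first exact: ltW.
  move=> r rqt; have rT := rq r rqt.
  have sr : s < r.
    by move: rqt; rewrite in_itv/= => /andP[qr _]; exact: le_lt_trans qr.
  have [|p Cp xp] := near sT rT _ (Cx _ sT); first by rewrite lt_eqF.
  exists p => //; have := gpos r rqt; rewrite gE//.
  have sr0 : 0 <= r - s by rewrite subr_ge0 ltW.
  move: xp; rewrite [`|s - r|]distrC (ger0_norm sr0) ltr_norml => /andP[_ xp].
  have : 0 <= M * (r - s) by rewrite mulr_ge0.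
  lra.
have := drift_le qT tT (ltW qt); rewrite ler_norml => /andP[dr _].
move: gq; rewrite gE//.
have : 0 <= k * (t - q) by rewrite mulr_ge0// ?subr_ge0; apply: ltW.
lra.
Qed.

Lemma solution_lipschitz s t : s \in `[0, T] -> t \in `[0, T] ->
  `|x t - x s| <= (k + M) * `|t - s|.
Proof.
wlog st : s t / s <= t => [wl|] sT tT.
  by case: (leP s t) => [|/ltW] st; [|rewrite distrC [`|t - s|]distrC]; exact: wl.
rewrite [`|t - s|]ger0_norm ?subr_ge0// ler_norml lerNl opprB.
by rewrite solution_increase ?solution_decrease.
Qed.

End speed.

End limit_regularity.

(** * Smoothing by the kernel as an average over windows *)

Section affine_substitution.
Context {R : realType}.
Local Notation mu := (@lebesgue_measure R).

(** Lebesgue measure is [h] times its image under [v |-> s - h * v], because both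
    agree on the intervals ]a, b]. *)
Lemma ge0_integral_reflect_scale (s h : R) (f : R -> \bar R) : 0 < h ->
  measurable_fun setT f -> (forall r, (0 <= f r)%E) ->
  (\int[mu]_u f u = h%:E * \int[mu]_v f (s - h * v)%R)%E.
Proof.
move=> h0 mf f0.
pose phi (v : measurableTypeR R) : measurableTypeR R := s - h * v.
have mphi : measurable_fun setT phi.
  by apply: measurable_funB => //; exact: measurable_funM.
pose pf : {measure set (measurableTypeR R) -> \bar R} :=
  measure_function_pushforward__canonical__measure_function_Measure mu mphi.
pose m := mscale (NngNum (ltW h0)) pf.
have muE A : measurable A -> mu A = m A.
  apply: lebesgue_measure_unique => _ [[a b] _ <-].
  transitivity (h%:E * mu (phi @^-1` `]a, b]%classic))%E; last by [].
  rewrite /=.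
  have -> : phi @^-1` `]a, b]%classic = `[(s - b) / h, (s - a) / h[%classic.
    apply/seteqP; split => v /=; rewrite !in_itv/= /phi ler_pdivrMr// ltr_pdivlMr// => /andP[av vb];
      by apply/andP; split; lra.
  rewrite !lebesgue_measure_itv/= !lte_fin.
  have -> : ((s - b) / h < (s - a) / h) = (a < b).
    by rewrite ltr_pM2r ?invr_gt0// ltrD2l ltrN2.
  case: ifPn => ab; last by rewrite mule0.
  by rewrite -EFinD -EFinM; congr (_%:E); field; exact: lt0r_neq0.
transitivity (\int[m]_u f u)%E.
  by apply: eq_measure_integral => A mA _; exact: muE.
rewrite ge0_integral_mscale//=; congr (_ * _)%E.
by rewrite /pf ge0_integral_pushforward//= preimage_setT.
Qed.

End affine_substitution.

Section smoothing.
Context {R : realType}.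
Local Notation lam := (@lebesgue_measure R).
Variables (mu : {sigma_finite_measure set (measurableTypeR R) -> \bar R}).
Variables (T h t : R) (K : R -> R) (beta : measurableTypeR R -> R).
Hypotheses (h_gt0 : 0 < h).
Hypotheses (mK : measurable_fun setT K) (K_ge0 : forall u, 0 <= K u).
Hypotheses (mbeta : measurable_fun `[0, T] beta).
Hypotheses (beta_ge0 : forall s, s \in `[0, T] -> 0 <= beta s).

(** The points [s] of [0, T] for which [u = s - h * v] ranges in ]0, t]: the domain
    of integration in [s], for a fixed [v], after the substitution in [u]. *)
Definition window (v : R) : set (measurableTypeR R) :=
  `]h * v, h * v + t]%classic `&` `[0, T]%classic.

Let G : measurableTypeR R -> R := beta \_ `[0, T].

Let mG : measurable_fun setT G.
Proof. by apply/(measurable_restrictT _ _).1. Qed.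

Let G_ge0 s : 0 <= G s.
Proof. by rewrite /G patchE; case: ifPn => // /[!inE]; exact: beta_ge0. Qed.

Let k (p : measurableTypeR R * measurableTypeR R) : \bar R :=
  (K ((p.2 - p.1) / h) * G p.2 * \1_(`]0, t]%classic) p.1)%:E.

Let mk : measurable_fun setT k.
Proof.
apply/measurable_EFinP; apply: measurable_funM; first apply: measurable_funM.
- apply: measurableT_comp => //; apply: measurable_funM => //.
  by apply: measurable_funB; [exact: measurable_snd|exact: measurable_fst].
- by apply: measurableT_comp => //; exact: measurable_snd.
- by apply: measurableT_comp; [exact: measurable_indic|exact: measurable_fst].
Qed.

Let k_ge0 p : (0 <= k p)%E.
Proof. by rewrite lee_fin !mulr_ge0. Qed.

Lemma window_integrandE v :
  ((K v)%:E * \int[mu]_(s in window v) (beta s)%:E = \int[mu]_s k (s - h * v, s)%R)%E.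
Proof.
have mT : measurable (`[0, T]%classic : set (measurableTypeR R)) by exact: measurable_itv.
rewrite -ge0_integralZl//; last 4 first.
- exact: measurableI.
- by apply/measurable_EFinP; apply: (measurable_funS mT _ mbeta); exact: subIsetr.
- by move=> s [_ sT]; rewrite lee_fin; exact: beta_ge0.
- by rewrite lee_fin.
rewrite [LHS]integral_mkcond; apply: eq_integral => s _.
rewrite /k/= patchE indicE.
have -> : (s - (s - h * v)) / h = v by field; exact: lt0r_neq0.
rewrite /G patchE /window in_setI.
have -> : (s - h * v \in `]0, t]%classic) = (s \in `]h * v, h * v + t]%classic).
  by rewrite !mem_setE !in_itv/= subr_gt0 lerBlDl.
case: (s \in `]h * v, _]%classic); case: (s \in `[0, T]%classic) => //=;
  by rewrite ?mulr0 ?mulr1 ?mul0r ?EFinM.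
Qed.

Let mk' : measurable_fun setT
  (fun p : measurableTypeR R * measurableTypeR R => k (p.2 - h * p.1, p.2)).
Proof.
apply: (measurableT_comp mk); apply: measurable_fun_pair; last exact: measurable_snd.
apply: measurable_funB; first exact: measurable_snd.
by apply: measurable_funM => //; exact: measurable_fst.
Qed.

Lemma measurable_window_integral :
  measurable_fun setT (fun v : measurableTypeR R => (K v)%:E * \int[mu]_(s in window v) (beta s)%:E)%E.
Proof.
have := @measurable_fun_fubini_tonelli_F _ _ _ _ _ mu _ mk' (fun p => k_ge0 _).
by apply: eq_measurable_fun => v _; rewrite window_integrandE.
Qed.

Lemma measurable_smoothing_integral : measurable_fun setT
  (fun u : measurableTypeR R => \int[mu]_(s in `[0%R, T]) (K ((s - u) / h)%R * beta s)%:E)%E.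
Proof.
pose k0 (p : measurableTypeR R * measurableTypeR R) : \bar R :=
  (K ((p.2 - p.1) / h) * G p.2)%:E.
have mk0 : measurable_fun setT k0.
  apply/measurable_EFinP; apply: measurable_funM.
    apply: measurableT_comp => //; apply: measurable_funM => //.
    by apply: measurable_funB; [exact: measurable_snd|exact: measurable_fst].
  by apply: measurableT_comp => //; exact: measurable_snd.
have k0_ge0 p : (0 <= k0 p)%E by rewrite lee_fin mulr_ge0.
have := @measurable_fun_fubini_tonelli_F _ _ _ _ _ mu _ mk0 k0_ge0.
apply: eq_measurable_fun => u _; rewrite /fubini_F [RHS]integral_mkcond.
apply: eq_integral => s _; rewrite /k0/= /G !patchE; case: ifPn => //.
by rewrite mulr0.
Qed.

(** Tonelli's theorem, the substitution [u = s - h * v] in the inner integral, and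
    Tonelli's theorem again.  The integration starts at 0 excluded, which is
    harmless since a single [u] is Lebesgue negligible, and makes the windows
    half-open. *)
Lemma ge0_integral_smoothing :
  (\int[lam]_(u in `[0%R, t]) \int[mu]_(s in `[0%R, T]) (K ((s - u) / h) * beta s)%:E =
   h%:E * \int[lam]_v ((K v)%:E * \int[mu]_(s in window v) (beta s)%:E))%E.
Proof.
have mT : measurable (`[0, T]%classic : set (measurableTypeR R)) by exact: measurable_itv.
have Fk u : u \in `]0, t] ->
    (\int[mu]_(s in `[0%R, T]) (K ((s - u) / h) * beta s)%:E = \int[mu]_s k (u, s))%E.
  move=> ut; rewrite integral_mkcond; apply: eq_integral => s _.
  rewrite /k/= indicE mem_set// mulr1 /G !patchE; case: ifPn => //.
  by rewrite mulr0.
have Fk0 u : u \notin `]0, t] -> (\int[mu]_s k (u, s) = 0)%E.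
  move=> ut; apply: integral0_eq => s _.
  by rewrite /k/= indicE memNset ?mulr0//=; exact/negP.
have mF : measurable_fun setT (fun u => \int[mu]_s k (u, s))%E.
  exact: (@measurable_fun_fubini_tonelli_F _ _ _ _ _ mu k).
transitivity (\int[lam]_u \int[mu]_s k (u, s))%E.
  rewrite -integral_itv_obnd_cbnd; last first.
    apply: (@eq_measurable_fun _ _ _ _ _ (fun u => \int[mu]_s k (u, s))%E).
      by move=> u /[!inE] ut; rewrite Fk.
    exact: measurable_funTS.
  rewrite [LHS]integral_mkcond; apply: eq_integral => u _; rewrite patchE.
  by case: ifPn => [/[!inE]|] ut; [exact: Fk|rewrite Fk0//; move: ut; rewrite notin_setE => /negP].
rewrite fubini_tonelli//.
transitivity (\int[mu]_s (h%:E * \int[lam]_v k (s - h * v, s)%R))%E.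
  apply: eq_integral => s _.
  apply: (@ge0_integral_reflect_scale _ s h (fun u => k (u, s))) => //.
  apply: (measurableT_comp mk); apply: measurable_fun_pair => //.
pose k' (p : measurableTypeR R * measurableTypeR R) := k (p.2 - h * p.1, p.2).
rewrite ge0_integralZl//; last 3 first.
- exact: (@measurable_fun_fubini_tonelli_G _ _ _ _ _ lam k' mk' (fun p => k_ge0 _)).
- by move=> s _; exact: integral_ge0.
- by rewrite lee_fin ltW.
congr (_ * _)%E.
rewrite -(@fubini_tonelli _ _ _ _ _ lam mu k' mk' (fun p => k_ge0 _)).
by apply: eq_integral => v _; rewrite window_integrandE.
Qed.

Variables (M N : R).
Hypotheses (K_le : forall u, K u <= M).
Hypotheses (beta_le : forall s, s \in `[0, T] -> beta s <= N).
Hypothesis muT : (mu `[0%R, T]%classic < +oo)%E.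

Let integrable_itv (g : measurableTypeR R -> R) (c : R) : measurable_fun `[0, T] g ->
  (forall s, s \in `[0, T] -> 0 <= g s <= c) ->
  mu.-integrable `[0, T] (EFin \o g).
Proof.
move=> mg gc; apply: measurable_bounded_integrable => //.
exists c; split; first exact: num_real.
move=> x cx s sT; have /andP[g0 g1] := gc s sT.
by rewrite /= ger0_norm// (le_trans g1)// ltW.
Qed.

Let K_beta u s : s \in `[0, T] -> 0 <= K ((s - u) / h) * beta s <= M * N.
Proof.
move=> sT; rewrite mulr_ge0 ?beta_ge0//=; apply: ler_pM => //; first exact: beta_ge0.
exact: beta_le.
Qed.

Let mK_beta u : measurable_fun (`[0, T] : set (measurableTypeR R)) (fun s => K ((s - u) / h) * beta s).
Proof.
apply: measurable_funM => //; apply: measurableT_comp => //.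
by apply: measurable_funM => //; exact: measurable_funB.
Qed.

Let phiE u : (\int[mu]_(s in `[0%R, T]) (K ((s - u) / h) * beta s)%:E)%E =
  (\int[mu]_(s in `[0, T]) (K ((s - u) / h) * beta s))%:E.
Proof.
rewrite /Rintegral fineK//; apply: integrable_fin_num => //.
exact: integrable_itv (mK_beta u) (K_beta u).
Qed.

Let psiE v : (\int[mu]_(s in window v) (beta s)%:E)%E = (\int[mu]_(s in window v) beta s)%:E.
Proof.
rewrite /Rintegral fineK//; apply: integrable_fin_num => //; first exact: measurableI.
have : mu.-integrable `[0, T] (EFin \o beta).
  by apply: (@integrable_itv _ N) => // s sT; rewrite beta_ge0//= beta_le.
apply: integrableS => //; first exact: measurableI.
exact: subIsetr.
Qed.

Lemma smoothing_integrable : lam.-integrable `[0, t]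
  (EFin \o (fun u => \int[mu]_(s in `[0, T]) (K ((s - u) / h) * beta s))).
Proof.
apply: measurable_bounded_integrable => //.
- by rewrite /= lebesgue_measure_itv/=; case: ifP => _; rewrite -?EFinB ltry.
- apply/measurable_EFinP; apply: measurable_funTS.
  have := measurable_smoothing_integral; apply: eq_measurable_fun => u _.
  by rewrite phiE.
- exists (M * N * fine (mu `[0, T]%classic)); split; first exact: num_real.
  move=> x cx u ut /=; rewrite ger0_norm; last first.
    apply: Rintegral_ge0 => s sT; exact: (andP (K_beta u sT)).1.
  apply: le_trans (ltW cx).
  rewrite -[leRHS](@Rintegral_cst _ _ _ mu `[0, T]%classic)//.
  apply: le_Rintegral => //.
  + exact: integrable_itv (mK_beta u) (K_beta u).
  + apply: (@integrable_itv (cst (M * N)) (M * N)) => // s sT.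
    by rewrite lexx andbT; have /andP[] := K_beta u sT; exact: le_trans.
  + by move=> s sT; exact: (andP (K_beta u sT)).2.
Qed.

Let smoothing_EFin :
  ((\int[lam]_(u in `[0%R, t]) \int[mu]_(s in `[0%R, T]) (K ((s - u) / h) * beta s))%:E =
   h%:E * \int[lam]_v (K v * \int[mu]_(s in window v) beta s)%:E)%E.
Proof.
rewrite {1}/Rintegral fineK; last exact: integrable_fin_num smoothing_integrable.
transitivity (\int[lam]_(u in `[0%R, t]) \int[mu]_(s in `[0%R, T]) (K ((s - u) / h) * beta s)%:E)%E.
  by apply: eq_integral => u _; rewrite phiE.
rewrite ge0_integral_smoothing; congr (_ * _)%E.
by apply: eq_integral => v _; rewrite EFinM psiE.
Qed.

(** The finite value comes from the other side of [ge0_integral_smoothing]. *)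
Lemma window_integrable : lam.-integrable setT
  (EFin \o (fun v => K v * \int[mu]_(s in window v) beta s)).
Proof.
apply/integrableP; split.
  have := measurable_window_integral; apply: eq_measurable_fun => v _ /=.
  by rewrite EFinM psiE.
have -> : (\int[lam]_v `|(EFin \o (fun v => K v * \int[mu]_(s in window v) beta s)%R) v|
    = \int[lam]_v (K v * \int[mu]_(s in window v) beta s)%:E)%E.
  apply: eq_integral => v _; rewrite gee0_abs//= lee_fin mulr_ge0//.
  by apply: Rintegral_ge0 => s [_ sT]; exact: beta_ge0.
have hE : h%:E != 0%E :> \bar R by rewrite eqe lt0r_neq0.
have := smoothing_EFin; case: (\int[lam]_v _)%E => [r|//|//] /=; rewrite ?ltry//.
by rewrite gt0_muley// lte_fin.
Qed.

Lemma smoothing_Rintegral :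
  h^-1 * \int[lam]_(u in `[0, t]) \int[mu]_(s in `[0, T]) (K ((s - u) / h) * beta s) =
  \int[lam]_v (K v * \int[mu]_(s in window v) beta s).
Proof.
have fin := integrable_fin_num measurableT window_integrable.
have := smoothing_EFin; rewrite -(fineK fin) -EFinM => -[->].
by rewrite mulKf// lt0r_neq0.
Qed.

End smoothing.

Section window_increment.
Context {R : realType}.
Implicit Types (T h t v : R) (f : R -> R).
Local Notation lam := (@lebesgue_measure R).

(** Clamping the endpoints accounts for windows that leave [0, T], even
    completely: the interval is then empty. *)
Lemma window_clamp T h t v : window T h t v `&` `]0, T]%classic =
  `]clamp T (h * v), clamp T (h * v + t)]%classic.
Proof.
apply/seteqP; split => s; rewrite /window/= !in_itv/= /clamp.
  move=> [[/andP[s1 s2] /andP[s3 s4]] /andP[s5 _]].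
  by rewrite gt_max s5 gt_min s1/= le_max le_min s2 s4 orbT.
rewrite gt_max gt_min le_max le_min => /andP[/andP[s0 /orP s1] /orP[|/andP[s2 s3]]].
  by move=> /(lt_le_trans s0); rewrite ltxx.
case: s1 => [s1|]; first by rewrite s1 s2 s0 s3 ltW.
by move=> /lt_le_trans/(_ s3); rewrite ltxx.
Qed.

Lemma differential_measure_window T f nu h t v :
  is_differential_measure T f nu -> 0 <= T -> 0 <= t ->
  nu (window T h t v) = (f (clamp T (h * v + t)) - f (clamp T (h * v)))%:E.
Proof.
move=> [nuf nu0] T0 t0.
have mW : measurable (window T h t v) by exact: measurableI.
have mD : measurable (`]0, T]%classic : set (measurableTypeR R)) by exact: measurable_itv.
rewrite (chargeDI nu mW mD) nu0; last 2 first.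
- exact: measurableD.
- by apply/seteqP; split => // s [[_ ns] /ns].
have [c0 cT] := andP (clamp_itv (h * v) T0).
have [d0 dT] := andP (clamp_itv (h * v + t) T0).
by rewrite add0e window_clamp nuf// clamp_le// lerDl.
Qed.

Lemma Rintegral_window T f h t v : 0 <= T -> 0 <= t ->
  {within `[0, T], continuous f} ->
  \int[lam]_(s in window T h t v) f s =
  \int[lam]_(s in `[0, clamp T (h * v + t)]) f s -
  \int[lam]_(s in `[0, clamp T (h * v)]) f s.
Proof.
move=> T0 t0 cf.
have [c0 cT] := andP (clamp_itv (h * v) T0).
have [d0 dT] := andP (clamp_itv (h * v + t) T0).
have cd : clamp T (h * v) <= clamp T (h * v + t) by rewrite clamp_le// lerDl.
have mW : measurable (window T h t v) by exact: measurableI.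
have mD : measurable (`]0, T]%classic : set (measurableTypeR R)) by exact: measurable_itv.
rewrite Rintegral_itvB//; last first.
  by apply: within_itv_integrable; exact: subitv_within cf.
rewrite -window_clamp.
have -> : window T h t v = (window T h t v `&` `]0, T]) `|` (window T h t v `\` `]0, T]).
  by rewrite setUIDK.
rewrite Rintegral_setU//.
- rewrite [X in _ + X](_ : _ = 0); last first.
    rewrite /Rintegral (@integral_Sset1 _ _ _ 0)// => s [[_ sT] ns].
    move: sT ns; rewrite /= !in_itv/= => /andP[s0 sT]; rewrite sT andbT => /negP.
    by rewrite -leNgt => s0'; apply/eqP; rewrite eq_le s0 s0'.
  rewrite addr0; congr (Rintegral _ _ _).
  by rewrite setUIDK.
- exact: measurableI.
- exact: measurableD.
- rewrite setUIDK; have := within_itv_integrable cf; apply: integrableS => //.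
  exact: subIsetr.
- by apply/disj_setPS => s [[_ s1] [_]].
Qed.

End window_increment.

Section smoothing_identities.
Context {R : realType}.
Local Notation lam := (@lebesgue_measure R).
Variables (T h t M : R) (K : R -> R).
Hypotheses (h_gt0 : 0 < h) (T_gt0 : 0 < T) (t_ge0 : 0 <= t).
Hypotheses (mK : measurable_fun setT K) (K_ge0 : forall u, 0 <= K u).
Hypotheses (K_le : forall u, K u <= M).

Section finite_measure.
Variable mu : {finite_measure set (measurableTypeR R) -> \bar R}.

Let mu_fin : (mu `[0%R, T]%classic < +oo)%E.
Proof. by rewrite -ge0_fin_numE ?measure_ge0//; exact: fin_num_measure. Qed.

Let mcst1 : measurable_fun (`[0, T] : set (measurableTypeR R)) (cst (1 : R)).
Proof. exact: measurable_cst. Qed.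

Let cst1_ge0 (s : R) : s \in `[0, T] -> 0 <= (cst 1 : R -> R) s. Proof. by []. Qed.

Let cst1_le1 (s : R) : s \in `[0, T] -> (cst 1 : R -> R) s <= 1. Proof. by []. Qed.

Let mul1E (u : R) : \int[mu]_(s in `[0, T]) (K ((s - u) / h) * (cst 1 : R -> R) s) =
  \int[mu]_(s in `[0, T]) K ((s - u) / h).
Proof. by apply: eq_Rintegral => s _; rewrite mulr1. Qed.

Let windowE v : \int[mu]_(s in window T h t v) (cst 1 : R -> R) s = fine (mu (window T h t v)).
Proof. by rewrite Rintegral_cst ?mul1r//; exact: measurableI. Qed.

Lemma finite_smoothing_integrable : lam.-integrable `[0, t]
  (EFin \o (fun u => \int[mu]_(s in `[0, T]) K ((s - u) / h))).
Proof.
have := smoothing_integrable h t mK K_ge0 mcst1 cst1_ge0 K_le cst1_le1 mu_fin.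
by apply: eq_integrable => // u _ /=; rewrite mul1E.
Qed.

Lemma finite_window_integrable : lam.-integrable setT
  (EFin \o (fun v => K v * fine (mu (window T h t v)))).
Proof.
have := window_integrable t h_gt0 mK K_ge0 mcst1 cst1_ge0 K_le cst1_le1 mu_fin.
by apply: eq_integrable => // u _ /=; rewrite windowE.
Qed.

Lemma finite_smoothing :
  h^-1 * \int[lam]_(u in `[0, t]) \int[mu]_(s in `[0, T]) K ((s - u) / h) =
  \int[lam]_v (K v * fine (mu (window T h t v))).
Proof.
have := smoothing_Rintegral t h_gt0 mK K_ge0 mcst1 cst1_ge0 K_le cst1_le1 mu_fin.
under eq_Rintegral do rewrite mul1E.
by under [X in _ = X -> _]eq_Rintegral do rewrite windowE.
Qed.

End finite_measure.

(** The Stieltjes integral is treated on the two parts of the Hahn decomposition,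
    which are finite measures. *)
Section charge.
Variable f : R -> R.
Hypotheses (cf : {within `[0, T], continuous f}) (bvf : bounded_variation 0 T f).
Let nu := differential_measure T f.
Let pos := jordan_pos (svalP (hahn_sets nu)).
Let neg := jordan_neg (svalP (hahn_sets nu)).

Let windowE v : K v * (f (clamp T (h * v + t)) - f (clamp T (h * v))) =
  K v * fine (pos (window T h t v)) - K v * fine (neg (window T h t v)).
Proof.
rewrite -mulrBr; congr (_ * _).
have mW : measurable (window T h t v) by exact: measurableI.
have nuP := differential_measureP T_gt0 cf bvf.
have := differential_measure_window h v nuP (ltW T_gt0) t_ge0.
rewrite (jordan_decomp (svalP (hahn_sets nu)) mW) => E.
apply: EFin_inj; rewrite -E EFinB !fineK ?fin_num_measure//.
by rewrite /cadd/= cscaleN1.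
Qed.

Lemma charge_smoothing_integrable : lam.-integrable `[0, t]
  (EFin \o (fun u => charge_integral nu `[0, T] (fun s => K ((s - u) / h)))).
Proof.
have := integrableB _ (finite_smoothing_integrable pos) (finite_smoothing_integrable neg).
by move=> /(_ (measurable_itv _)).
Qed.

Lemma charge_window_integrable : lam.-integrable setT
  (EFin \o (fun v => K v * (f (clamp T (h * v + t)) - f (clamp T (h * v))))).
Proof.
have := integrableB measurableT (finite_window_integrable pos) (finite_window_integrable neg).
by apply: eq_integrable => // v _ /=; rewrite windowE.
Qed.

Lemma charge_smoothing :
  h^-1 * \int[lam]_(u in `[0, t]) charge_integral nu `[0, T] (fun s => K ((s - u) / h)) =
  \int[lam]_v (K v * (f (clamp T (h * v + t)) - f (clamp T (h * v)))).
Proof.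
rewrite (@RintegralB _ _ _ _ _ _ _ _ (finite_smoothing_integrable pos) (finite_smoothing_integrable neg))//.
rewrite mulrBr !finite_smoothing -RintegralB//; try exact: finite_window_integrable.
by apply: eq_Rintegral => v _; rewrite windowE.
Qed.

End charge.

Section drift.
Variable f : R -> R.
Hypothesis cf : {within `[0, T], continuous f}.
Let F r := \int[lam]_(s in `[0, r]) f s.

Let lam_fin : (lam `[0%R, T]%classic < +oo)%E.
Proof. by rewrite /= lebesgue_measure_itv/=; case: ifP => _; rewrite -?EFinB ltry. Qed.

Let f_bounded : exists2 N, 0 <= N & forall s, s \in `[0, T] -> `|f s| <= N.
Proof.
have cn : {within `[0, T], continuous (fun s => `|f s|)}.
  by move=> x; apply: cvg_norm; exact: cf.
have [c cT fc] := EVT_max (ltW T_gt0) cn.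
by exists `|f c|.
Qed.

Let mf : measurable_fun (`[0, T] : set (measurableTypeR R)) f.
Proof. exact: subspace_continuous_measurable_fun. Qed.

(** The identity for nonnegative integrands is applied to [f + N] and to [N],
    where [N] bounds [|f|]. *)
Lemma drift_smoothing : [/\
  lam.-integrable `[0, t] (EFin \o (fun u => \int[lam]_(s in `[0, T]) (K ((s - u) / h) * f s))),
  lam.-integrable setT (EFin \o (fun v => K v * (F (clamp T (h * v + t)) - F (clamp T (h * v))))) &
  h^-1 * \int[lam]_(u in `[0, t]) \int[lam]_(s in `[0, T]) (K ((s - u) / h) * f s) =
  \int[lam]_v (K v * (F (clamp T (h * v + t)) - F (clamp T (h * v))))].
Proof.
have [N N0 fN] := f_bounded.
pose g1 s := f s + N; pose g2 : R -> R := cst N.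
have mg1 : measurable_fun (`[0, T] : set (measurableTypeR R)) g1.
  by apply: measurable_funD.
have mg2 : measurable_fun (`[0, T] : set (measurableTypeR R)) g2 by exact: measurable_cst.
have g1_ge0 s : s \in `[0, T] -> 0 <= g1 s.
  by move=> /fN; rewrite ler_norml /g1 => /andP[+ _]; lra.
have g2_ge0 s : s \in `[0, T] -> 0 <= g2 s by [].
have g1_le s : s \in `[0, T] -> g1 s <= 2 * N.
  by move=> /fN; rewrite ler_norml /g1 => /andP[_]; lra.
have g2_le s : s \in `[0, T] -> g2 s <= N by [].
have i1 := smoothing_integrable h t mK K_ge0 mg1 g1_ge0 K_le g1_le lam_fin.
have i2 := smoothing_integrable h t mK K_ge0 mg2 g2_ge0 K_le g2_le lam_fin.
have w1 := window_integrable t h_gt0 mK K_ge0 mg1 g1_ge0 K_le g1_le lam_fin.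
have w2 := window_integrable t h_gt0 mK K_ge0 mg2 g2_ge0 K_le g2_le lam_fin.
have e1 := smoothing_Rintegral t h_gt0 mK K_ge0 mg1 g1_ge0 K_le g1_le lam_fin.
have e2 := smoothing_Rintegral t h_gt0 mK K_ge0 mg2 g2_ge0 K_le g2_le lam_fin.
have mKh u : measurable_fun (`[0, T] : set (measurableTypeR R)) (fun s => K ((s - u) / h)).
  apply: measurableT_comp => //.
  by apply: measurable_funM => //; exact: measurable_funB.
have itv_int (g : R -> R) (c : R) : measurable_fun (`[0, T] : set (measurableTypeR R)) g ->
    (forall s, s \in `[0, T] -> `|g s| <= c) -> lam.-integrable `[0, T] (EFin \o g).
  move=> mg gc; apply: measurable_bounded_integrable => //.
  exists c; split; first exact: num_real.
  by move=> r cr s sT /=; apply: le_trans (ltW cr); exact: gc.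
have Kg_int (g : R -> R) c u : measurable_fun (`[0, T] : set (measurableTypeR R)) g ->
    (forall s, s \in `[0, T] -> 0 <= g s) -> (forall s, s \in `[0, T] -> g s <= c) ->
    lam.-integrable `[0, T] (EFin \o (fun s => K ((s - u) / h) * g s)).
  move=> mg g0 gc; apply: (itv_int _ (M * c)); first exact: measurable_funM.
  move=> s sT; rewrite ger0_norm ?mulr_ge0 ?g0//.
  by apply: ler_pM => //; [exact: g0|exact: gc].
have phiE u : \int[lam]_(s in `[0, T]) (K ((s - u) / h) * f s) =
    \int[lam]_(s in `[0, T]) (K ((s - u) / h) * g1 s) -
    \int[lam]_(s in `[0, T]) (K ((s - u) / h) * g2 s).
  rewrite -RintegralB//; last 2 first.
  - exact: Kg_int mg1 g1_ge0 g1_le.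
  - exact: Kg_int mg2 g2_ge0 g2_le.
  by apply: eq_Rintegral => s _; rewrite /g1 /g2/=; ring.
have mW v : measurable (window T h t v) by exact: measurableI.
have psiE v : K v * (F (clamp T (h * v + t)) - F (clamp T (h * v))) =
    K v * \int[lam]_(s in window T h t v) g1 s - K v * \int[lam]_(s in window T h t v) g2 s.
  rewrite -mulrBr; congr (_ * _).
  rewrite -(Rintegral_window _ _ (ltW T_gt0) t_ge0 cf) -RintegralB//; last 2 first.
  - apply: (integrableS _ (mW v) _ (itv_int g1 (2 * N) mg1 _)) => //; first exact: subIsetr.
    by move=> s sT; rewrite ger0_norm ?g1_ge0// g1_le.
  - apply: (integrableS _ (mW v) _ (itv_int g2 N mg2 _)) => //; first exact: subIsetr.
    by move=> s sT; rewrite ger0_norm.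
  by apply: eq_Rintegral => s _; rewrite /g1 /g2/=; ring.
split.
- have mt : measurable (`[0, t]%classic : set (measurableTypeR R)) by exact: measurable_itv.
  have := integrableB mt i1 i2.
  by apply: eq_integrable => // u _ /=; rewrite phiE.
- have := integrableB measurableT w1 w2.
  by apply: eq_integrable => // v _ /=; rewrite psiE.
- under eq_Rintegral do rewrite phiE.
  rewrite RintegralB// mulrBr e1 e2 -RintegralB//.
  by apply: eq_Rintegral => v _; rewrite psiE.
Qed.

End drift.
End smoothing_identities.

(** * Pathwise error of the estimator *)

Section pathwise_error.
Context {R : realType}.
Local Notation lam := (@lebesgue_measure R).
Variables (T h t M rho : R) (K : R -> R).
Hypotheses (h_gt0 : 0 < h) (T_gt0 : 0 < T) (tT : t \in `[0, T]).
Hypotheses (mK : measurable_fun setT K) (K_ge0 : forall u, 0 <= K u).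
Hypotheses (K_le : forall u, K u <= M) (K_int : (\int[lam]_u (K u)%:E = 1)%E).
Hypothesis K_supp : forall v, K v != 0 -> `|v| <= rho.

Let K_integrable : lam.-integrable setT (EFin \o K).
Proof.
apply/integrableP; split; first exact/measurable_EFinP.
rewrite (_ : (\int[lam]_v `|(EFin \o K) v| = 1)%E) ?ltry// -K_int.
by apply: eq_integral => v _; rewrite gee0_abs ?lee_fin.
Qed.

Let K_Rintegral : \int[lam]_v K v = 1.
Proof. by rewrite /Rintegral K_int. Qed.

Lemma kernel_average_le (D : R -> R) (c e : R) :
  lam.-integrable setT (EFin \o (fun v => K v * D v)) ->
  (forall v, K v != 0 -> `|D v - c| <= e) ->
  `|\int[lam]_v (K v * D v) - c| <= e.
Proof.
move=> iKD De.
have iKc r : lam.-integrable setT (EFin \o (fun v => K v * r)).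
  exact: (@integrableZr _ _ _ lam _ measurableT r (EFin \o K) K_integrable).
have iKDc : lam.-integrable setT (EFin \o (fun v => K v * D v - K v * c)).
  exact: (integrableB measurableT iKD (iKc c)).
have cE r : r = \int[lam]_v (K v * r) by rewrite RintegralZr// K_Rintegral mul1r.
rewrite {1}(cE c) -RintegralB//.
apply: (le_trans (le_normr_Rintegral measurableT iKDc)).
rewrite (cE e); apply: le_Rintegral => //; first exact: integrable_norm.
move=> v _; rewrite -mulrBr normrM ger0_norm//.
have [->|K0] := eqVneq (K v) 0; first by rewrite !mul0r.
by apply: ler_wpM2l => //; exact: De.
Qed.

Variables (C : R -> set R) (b : R -> R) (x0 : R) (w X Y x y : R -> R).
Variables (S Lam eps : R) (W : R -> R).
Hypothesis b_lip : lipschitz b.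
Hypothesis sol : skorokhod_solution T C b x0 w X Y.
Hypothesis lim : skorokhod_solution T C b x0 (fun=> 0) x y.
Hypothesis near_x : forall s, s \in `[0, T] -> `|(X s - w s) - x s| <= S.
Hypothesis x_lip : forall r s, r \in `[0, T] -> s \in `[0, T] ->
  `|x s - x r| <= Lam * `|s - r|.
Hypothesis Lam_ge0 : 0 <= Lam.
Hypothesis W_int : lam.-integrable `[0, t] (EFin \o W).

Lemma trend_increment : trend b x0 x y t = x t - x 0.
Proof.
have [_ _ _ [y0 xE] _] := lim.
have zT : (0 : R) \in `[0, T] by rewrite in_itv/= lexx ltW.
by rewrite /trend [x 0]xE// [x t]xE// set_itv1 Rintegral_set1 y0; ring.
Qed.

(** The smoothed drift and reflection terms together average, over [v], the
    increment of [X - w] between the clamped points [h * v] and [h * v + t].  Both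
    endpoints move by at most [h * rho] from 0 and [t], and [X - w] is within [S]
    of [x]. *)
Lemma estimator_error_le :
  `|h^-1 * \int[lam]_(u in `[0, t])
      (\int[lam]_(s in `[0, T]) (K ((s - u) / h) * b (X s)) + eps * W u +
       charge_integral (differential_measure T Y) `[0, T] (fun s => K ((s - u) / h)))
    - trend b x0 x y t| <=
  2 * S + 2 * Lam * h * rho + `|eps| * (h^-1 * `|\int[lam]_(u in `[0, t]) W u|).
Proof.
have [[cX cY] bvY _ [_ XE] _] := sol.
have t0 : 0 <= t by move: tT; rewrite in_itv/= => /andP[].
have T0 := ltW T_gt0.
have mt : measurable (`[0, t]%classic : set (measurableTypeR R)) by exact: measurable_itv.
have cbX : {within `[0, T], continuous (fun s => b (X s))} := within_comp b_lip cX.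
have [iA iA' eA] := drift_smoothing h_gt0 T_gt0 t0 mK K_ge0 K_le cbX.
have iC := charge_smoothing_integrable T h t mK K_ge0 K_le Y.
have iC' := charge_window_integrable h_gt0 T_gt0 t0 mK K_ge0 K_le cY bvY.
have eC := charge_smoothing h_gt0 T_gt0 t0 mK K_ge0 K_le cY bvY.
have iW : lam.-integrable `[0, t] (EFin \o (fun u => eps * W u)).
  exact: (@integrableZl _ _ _ lam _ mt eps (EFin \o W) W_int).
have iAW : lam.-integrable `[0, t] (EFin \o (fun u =>
    \int[lam]_(s in `[0, T]) (K ((s - u) / h) * b (X s)) + eps * W u)).
  exact: (integrableD mt iA iW).
rewrite RintegralD// RintegralD// RintegralZl//.
set Fb := fun r => \int[lam]_(s in `[0, r]) b (X s) in iA' eA *.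
pose D v := (Fb (clamp T (h * v + t)) + Y (clamp T (h * v + t))) -
            (Fb (clamp T (h * v)) + Y (clamp T (h * v))).
have iD : lam.-integrable setT (EFin \o (fun v => K v * D v)).
  have := integrableD measurableT iA' iC'.
  by apply: eq_integrable => // v _ /=; rewrite /D /Fb -EFinD; congr (_%:E); ring.
have eD : h^-1 * (\int[lam]_(u in `[0, t]) \int[lam]_(s in `[0, T]) (K ((s - u) / h) * b (X s)) +
    \int[lam]_(u in `[0, t]) charge_integral (differential_measure T Y) `[0, T] (fun s => K ((s - u) / h))) =
    \int[lam]_v (K v * D v).
  rewrite mulrDr eA eC -RintegralD//.
  by apply: eq_Rintegral => v _; rewrite /D /Fb; ring.
set a := \int[lam]_(u in `[0, t]) \int[lam]_(s in `[0, T]) _ in eD *.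
set c := \int[lam]_(u in `[0, t]) charge_integral _ _ _ in eD *.
set IW := \int[lam]_(u in `[0, t]) W u.
have -> : h^-1 * (a + eps * IW + c) - trend b x0 x y t =
   (\int[lam]_v (K v * D v) - (x t - x 0)) + eps * (h^-1 * IW).
  by rewrite -eD trend_increment; ring.
apply: (le_trans (ler_normD _ _)); apply: lerD; last first.
  by rewrite !normrM (@ger0_norm _ h^-1)// invr_ge0 ltW.
apply: kernel_average_le => // v Kv.
have zT : (0 : R) \in `[0, T] by rewrite in_itv/= lexx.
have ZE r : r \in `[0, T] -> Fb r + Y r = X r - w r.
  by move=> rT; rewrite (XE r rT) /Fb; ring.
have c1 := clamp_itv (h * v + t) T0; have c2 := clamp_itv (h * v) T0.
have hv : `|h * v| <= h * rho.
  by rewrite normrM (gtr0_norm h_gt0); apply: ler_wpM2l; [exact: ltW|exact: K_supp].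
have l1 : `|x (clamp T (h * v + t)) - x t| <= Lam * h * rho.
  apply: (le_trans (x_lip tT c1)); rewrite -mulrA; apply: ler_wpM2l => //.
  rewrite -{2}(clamp_id tT); apply: (le_trans (clamp_lip _ _ _)).
  by rewrite addrK.
have l2 : `|x (clamp T (h * v)) - x 0| <= Lam * h * rho.
  apply: (le_trans (x_lip zT c2)); rewrite -mulrA; apply: ler_wpM2l => //.
  rewrite -(clamp_id zT); apply: (le_trans (clamp_lip _ _ _)).
  by rewrite subr0.
have n1 := near_x c1; have n2 := near_x c2.
rewrite /D ZE// ZE//.
have -> : X (clamp T (h * v + t)) - w (clamp T (h * v + t)) -
    (X (clamp T (h * v)) - w (clamp T (h * v))) - (x t - x 0) =
  (X (clamp T (h * v + t)) - w (clamp T (h * v + t)) - x (clamp T (h * v + t))) -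
  (X (clamp T (h * v)) - w (clamp T (h * v)) - x (clamp T (h * v))) +
  (x (clamp T (h * v + t)) - x t) - (x (clamp T (h * v)) - x 0) by ring.
move: n1 n2 l1 l2; rewrite !ler_norml => /andP[? ?] /andP[? ?] /andP[? ?] /andP[? ?].
by apply/andP; split; lra.
Qed.

End pathwise_error.

(** * Second moments of fractional Brownian motion *)

Section fBm_moments.
Context {R : realType} {d} {Omega : measurableType d}.
Variables (P : probability Omega R) (T H : R) (B : R -> {RV P >-> R}).
Hypotheses (fB : is_fBm T H B) (H_gt0 : 0 < H).

Definition fBm_cov (s t : R) : R :=
  2^-1 * (s `^ (2 * H) + t `^ (2 * H) - `|t - s| `^ (2 * H)).

Let covE s t : s \in `[0, T] -> t \in `[0, T] ->
  (\int[P]_w (B s w * B t w)%:E = (fBm_cov s t)%:E)%E.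
Proof.
move=> sT tT; have [_ EB cov _] := fB.
rewrite /fBm_cov -cov// covariance.unlock (EB _ sT) (EB _ tT) unlock; apply: eq_integral => w _.
by rewrite /GRing.mul/= !subr0.
Qed.

Lemma fBm_sqr_integrable t : t \in `[0, T] ->
  P.-integrable setT (EFin \o (fun w => B t w ^+ 2)).
Proof.
move=> tT; apply/integrableP; split.
  by apply/measurable_EFinP; exact: measurable_funX.
have -> : (\int[P]_w `|(EFin \o (fun w => (B t w ^+ 2)%R)) w| = (fBm_cov t t)%:E)%E.
  rewrite -covE//; apply: eq_integral => w _.
  by rewrite gee0_abs ?lee_fin ?sqr_ge0.
exact: ltry.
Qed.

Lemma fBm_mul_integrable s t : s \in `[0, T] -> t \in `[0, T] ->
  P.-integrable setT (EFin \o (fun w => B s w * B t w)).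
Proof.
move=> sT tT.
have := integrableD measurableT (fBm_sqr_integrable sT) (fBm_sqr_integrable tT).
apply: le_integrable => //; first by apply/measurable_EFinP; exact: measurable_funM.
move=> w _ /=; rewrite lee_fin [leRHS]ger0_norm ?addr_ge0 ?sqr_ge0//.
rewrite ler_norml; apply/andP.
have := sqr_ge0 (B s w + B t w); have := sqr_ge0 (B s w - B t w).
rewrite !expr2; split; nra.
Qed.

Lemma fBm_mul s t : s \in `[0, T] -> t \in `[0, T] ->
  \int[P]_w (B s w * B t w) = fBm_cov s t.
Proof. by move=> sT tT; rewrite /Rintegral covE. Qed.

Lemma fBm_increment_mul_integrable s t u v :
  s \in `[0, T] -> t \in `[0, T] -> u \in `[0, T] -> v \in `[0, T] ->
  P.-integrable setT (EFin \o (fun w => (B t w - B s w) * (B v w - B u w))).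
Proof.
move=> sT tT uT vT.
have := integrableB measurableT
  (integrableB measurableT (fBm_mul_integrable tT vT) (fBm_mul_integrable tT uT))
  (integrableB measurableT (fBm_mul_integrable sT vT) (fBm_mul_integrable sT uT)).
by apply: eq_integrable => // w _ /=; rewrite -!EFinB; congr (_%:E); ring.
Qed.

Lemma fBm_increment_mul s t u v :
  s \in `[0, T] -> t \in `[0, T] -> u \in `[0, T] -> v \in `[0, T] ->
  \int[P]_w ((B t w - B s w) * (B v w - B u w)) =
  2^-1 * (`|u - t| `^ (2 * H) + `|v - s| `^ (2 * H)
          - `|v - t| `^ (2 * H) - `|u - s| `^ (2 * H)).
Proof.
move=> sT tT uT vT.
transitivity (fBm_cov t v - fBm_cov t u - (fBm_cov s v - fBm_cov s u)).
  rewrite -!fBm_mul// -!RintegralB//; try exact: fBm_mul_integrable.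
  - by apply: eq_Rintegral => w _; ring.
  - exact: (integrableB measurableT (fBm_mul_integrable tT vT) (fBm_mul_integrable tT uT)).
  - exact: (integrableB measurableT (fBm_mul_integrable sT vT) (fBm_mul_integrable sT uT)).
by rewrite /fBm_cov; ring.
Qed.

Lemma fBm_increment_sqr s t : s \in `[0, T] -> t \in `[0, T] ->
  (\int[P]_w ((B t w - B s w) ^+ 2)%:E = (`|t - s| `^ (2 * H))%:E)%E.
Proof.
move=> sT tT.
have h := fBm_increment_mul_integrable sT tT sT tT.
rewrite -[LHS](@fineK _ (\int[P]_w ((B t w - B s w) ^+ 2)%:E)%E); last exact: integrable_fin_num h.
congr (_%:E); transitivity (\int[P]_w ((B t w - B s w) * (B t w - B s w))) => //.
rewrite fBm_increment_mul// !subrr normr0 powR0; last by rewrite mulf_neq0// gt_eqF.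
by rewrite [`|s - t|]distrC; field.
Qed.

End fBm_moments.

(** * A maximal inequality by dyadic chaining *)

Section dyadic_chaining.
Context {R : realType}.
Implicit Types (T p a : R) (w : R -> R).

Definition dyadic_point T n k : R := k%:R * T / 2 ^+ n.

Lemma dyadic_point_itv T n k : 0 <= T -> (k <= 2 ^ n)%N -> dyadic_point T n k \in `[0, T].
Proof.
move=> T0 kn; rewrite in_itv/= /dyadic_point !mulr_ge0//= ?invr_ge0 ?exprn_ge0//.
rewrite ler_pdivrMr ?exprn_gt0// mulrC; apply: ler_wpM2l => //.
by rewrite -natrX ler_nat.
Qed.

Lemma dyadic_point_even T n k : dyadic_point T n.+1 (k.*2) = dyadic_point T n k.
Proof.
rewrite /dyadic_point -muln2 natrM exprS; field.
by rewrite expf_neq0.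
Qed.

(** A point of level [n + 1] is a point of level [n] or the right neighbour of one,
    so the increments met along the way form a geometric series. *)
Lemma dyadic_bound T p a w : 0 < p < 1 -> 0 <= a -> 0 <= T ->
  (forall n k, (k < 2 ^ n)%N ->
    `|w (dyadic_point T n k.+1) - w (dyadic_point T n k)| <= a * p ^+ n) ->
  forall n k, (k <= 2 ^ n)%N -> `|w (dyadic_point T n k)| <= `|w 0| + a / (1 - p).
Proof.
move=> /andP[p0 p1] a0 T0 inc n k kn.
have q0 : 0 < 1 - p by rewrite subr_gt0.
suff h : `|w (dyadic_point T n k)| <= `|w 0| + a / (1 - p) * (1 - p ^+ n.+1).
  apply: (le_trans h); rewrite lerD2l; apply: ler_piMr; first by rewrite divr_ge0// ltW.
  by rewrite gerBl exprn_ge0// ltW.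
elim: n k kn => [|n IHn] k kn.
  rewrite expr1 mulfVK ?gt_eqF//.
  have d0 : dyadic_point T 0 0 = 0 by rewrite /dyadic_point !mul0r.
  case: k kn => [|[|//]] _; first by rewrite d0 lerDl.
  have := inc 0%N 0%N erefl; rewrite expr0 mulr1 d0 => h.
  have -> : w (dyadic_point T 0 1) = w 0 + (w (dyadic_point T 0 1) - w 0) by ring.
  by apply: (le_trans (ler_normD _ _)); rewrite lerD2l.
have step : a / (1 - p) * (1 - p ^+ n.+2) = a / (1 - p) * (1 - p ^+ n.+1) + a * p ^+ n.+1.
  by rewrite (exprS _ n.+1); field; rewrite gt_eqF.
have pn : 0 <= a * p ^+ n.+1 by rewrite mulr_ge0// exprn_ge0// ltW.
rewrite -(odd_double_half k); case: (boolP (odd k)) => ok /=; last first.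
  rewrite add0n dyadic_point_even step addrA; apply: ler_wpDr => //; apply: IHn.
  by rewrite -leq_double -[(2 ^ n).*2]mul2n -expnS (leq_trans _ kn)// -{2}(odd_double_half k) leq_addl.
have kn' : (k./2 < 2 ^ n)%N.
  by rewrite -ltn_double -[(2 ^ n).*2]mul2n -expnS (leq_trans _ kn)// -{2}(odd_double_half k) ok.
rewrite add1n.
have := inc n.+1 (k./2).*2; rewrite dyadic_point_even => /(_ _) h.
have {}h := h _; have -> : w (dyadic_point T n.+1 (k./2).*2.+1) =
  w (dyadic_point T n k./2) + (w (dyadic_point T n.+1 (k./2).*2.+1) - w (dyadic_point T n k./2)) by ring.
apply: (le_trans (ler_normD _ _)); rewrite step addrA; apply: lerD.
  by apply: IHn; exact: ltnW.
by apply: h; rewrite expnS mul2n ltn_double.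
Qed.

Lemma continuous_dyadic_bound T c w : 0 < T -> {within `[0, T], continuous w} ->
  (forall n k, (k <= 2 ^ n)%N -> `|w (dyadic_point T n k)| <= c) ->
  forall t, t \in `[0, T] -> `|w t| <= c.
Proof.
move=> T0 cw wc t tT.
have cg := continuous_clamp_comp (ltW T0) cw.
apply/ler_addgt0Pr => e e0.
have /cvgrPdist_le/(_ e e0) := cg t.
move=> [dl /= dl0 near_t].
have [n Tn] : exists n, T / 2 ^+ n < dl.
  exists (Num.bound (T / dl)); rewrite ltr_pdivrMr ?exprn_gt0// mulrC -ltr_pdivrMr//.
  apply: lt_trans (archi_boundP _) _; first by rewrite divr_ge0 ?ltW.
  by rewrite -natrX ltr_nat ltn_expl.
have [t0 tT'] : 0 <= t /\ t <= T by move: tT; rewrite in_itv/= => /andP[].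
pose k := Num.truncn (t / T * 2 ^+ n).
have x0 : 0 <= t / T * 2 ^+ n by rewrite !mulr_ge0 ?invr_ge0 ?exprn_ge0// ltW.
have /andP[k1 k2] := truncn_itv x0; rewrite -/k in k1 k2.
have kn : (k <= 2 ^ n)%N.
  rewrite -(ler_nat R) (le_trans k1)// natrX ler_piMl ?exprn_ge0//.
  by rewrite ler_pdivrMr// mul1r.
have n0 : 0 < 2 ^+ n :> R by rewrite exprn_gt0.
have dist : `|t - dyadic_point T n k| < dl.
  apply: le_lt_trans Tn; rewrite ler_norml /dyadic_point.
  have -> : t = t / T * 2 ^+ n * (T / 2 ^+ n) by field; rewrite !gt_eqF.
  set z := t / T * 2 ^+ n in k1 k2 *.
  rewrite -mulrA -mulrBl; set y := T / 2 ^+ n.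
  have y0 : 0 <= y by rewrite divr_ge0 ?ltW.
  have k3 : z <= k%:R + 1 by rewrite natr1 ltW.
  apply/andP; split; nra.
have kT := dyadic_point_itv (ltW T0) kn.
have := near_t _ dist; rewrite /= !clamp_id// => h.
have -> : w t = w (dyadic_point T n k) + (w t - w (dyadic_point T n k)) by ring.
by apply: (le_trans (ler_normD _ _)); apply: lerD => //; exact: wc.
Qed.

End dyadic_chaining.

Section fBm_maximal.
Context {R : realType}.
Variables (T H : R).
Hypotheses (T_gt0 : 0 < T) (H_gt : 2^-1 < H).

(** The squared increments of level [n] have total expectation
    [T ^ (2 H) * p ^ (4 n)].  Dividing them by [p ^ (2 n)] leaves a summable
    expectation, and bounds each increment of level [n] by [p ^ n] times the square
    root of the sum: one half of the gain is spent on each. *)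
Let p : R := 2 `^ (- (2 * H - 1) / 4).

Let p_gt0 : 0 < p. Proof. exact: powR_gt0. Qed.

Let p_lt1 : p < 1.
Proof.
have h : 0 < (2 * H - 1) / 4.
  by rewrite divr_gt0// subr_gt0 mulrC -ltr_pdivrMr// mul1r.
rewrite lt_neqAle /p mulNr powR_eq1; apply/andP; split; last first.
  by rewrite -[leRHS](powRr0 2); apply: ler_powR; rewrite ?ler1n// oppr_le0 ltW.
rewrite oppr_eq0 (gt_eqF h) ltNge ler0n orbF/= orbF.
by rewrite -[2 == 1]/(2%:R == 1%:R :> R) eqr_nat.
Qed.

Let level_moment n : 2 ^+ n * (T / 2 ^+ n) `^ (2 * H) = T `^ (2 * H) * p ^+ (4 * n).
Proof.
have -> : p ^+ (4 * n) = 2 `^ (n%:R - n%:R * (2 * H)).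
  rewrite -powR_mulrn; last exact: ltW.
  by rewrite /p -powRrM natrM; congr (_ `^ _); field.
rewrite powRM; [|exact: ltW|by rewrite invr_ge0 exprn_ge0].
have -> : ((2 : R) ^+ n)^-1 = 2 `^ (- n%:R) by rewrite powRN powR_mulrn.
rewrite -powRrM mulrCA; congr (_ * _).
rewrite -[2 ^+ n]powR_mulrn// -powRD; last by rewrite pnatr_eq0 implybT.
by congr (_ `^ _); ring.
Qed.

Section process.
Context {d} {Omega : measurableType d}.
Variables (P : probability Omega R) (B : R -> {RV P >-> R}).
Hypothesis fB : is_fBm T H B.

Let H_gt0 : 0 < H. Proof. by apply: lt_trans H_gt; rewrite invr_gt0. Qed.

Let incr n k w := B (dyadic_point T n k.+1) w - B (dyadic_point T n k) w.

Let lvl n w := \sum_(k < 2 ^ n) ((p ^+ (2 * n))^-1 * incr n k w ^+ 2).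

Let lvl_ge0 n w : 0 <= lvl n w.
Proof. by apply: sumr_ge0 => k _; rewrite mulr_ge0 ?sqr_ge0// invr_ge0 exprn_ge0// ltW. Qed.

Let mincr n k : measurable_fun setT (incr n k).
Proof. exact: measurable_funB. Qed.

Let mlvl n : measurable_fun setT (lvl n).
Proof.
apply: measurable_sum => k; apply: measurable_funM => //.
exact: measurable_funX.
Qed.

Let int_lvl n : (\int[P]_w (lvl n w)%:E = (T `^ (2 * H) * (p ^+ 2) ^+ n)%:E)%E.
Proof.
have pn : p ^+ (2 * n) != 0 by rewrite expf_neq0// gt_eqF.
transitivity (\sum_(k < 2 ^ n) \int[P]_w ((p ^+ (2 * n))^-1 * incr n k w ^+ 2)%:E)%E.
  rewrite -ge0_integral_sum//.
  - by apply: eq_integral => w _; rewrite /lvl sumEFin.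
  - move=> k; apply/measurable_EFinP; apply: measurable_funM => //.
    exact: measurable_funX.
  - by move=> k w _; rewrite lee_fin mulr_ge0 ?sqr_ge0// invr_ge0 exprn_ge0// ltW.
transitivity (\sum_(k < 2 ^ n) ((p ^+ (2 * n))^-1 * (T / 2 ^+ n) `^ (2 * H))%:E)%E.
  apply: eq_bigr => k _; rewrite EFinM.
  have T0 := ltW T_gt0.
  have kT : dyadic_point T n k \in `[0, T] by exact: dyadic_point_itv T0 (ltnW (ltn_ord k)).
  have kT' : dyadic_point T n k.+1 \in `[0, T] by exact: dyadic_point_itv T0 (ltn_ord k).
  have -> : T / 2 ^+ n = `|dyadic_point T n k.+1 - dyadic_point T n k|.
    have -> : dyadic_point T n k.+1 - dyadic_point T n k = T / 2 ^+ n.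
      by rewrite /dyadic_point -natr1; field; rewrite expf_neq0.
    by rewrite ger0_norm// divr_ge0// exprn_ge0.
  rewrite -(fBm_increment_sqr fB H_gt0 kT kT') -ge0_integralZl//.
  - by apply/measurable_EFinP; apply: measurable_funX; exact: mincr.
  - by move=> w _; rewrite lee_fin sqr_ge0.
  - by rewrite lee_fin invr_ge0 exprn_ge0// ltW.
rewrite sumEFin sumr_const card_ord -[X in X%:E = _]mulr_natl; congr (_%:E).
rewrite mulrCA natrX level_moment -exprM mulrCA; congr (_ * _).
have -> : (4 * n = 2 * n + 2 * n)%N by rewrite -mulnDl.
by rewrite exprD mulKf.
Qed.

Let S w := (\sum_(n <oo) (lvl n w)%:E)%E.

Let S_ge0 w : (0 <= S w)%E.
Proof. by apply: nneseries_ge0 => n _ _; rewrite lee_fin. Qed.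

Let mS : measurable_fun setT S.
Proof.
apply: ge0_emeasurable_sum => [n w _ _|n _]; first by rewrite lee_fin.
exact/measurable_EFinP.
Qed.

Let int_S : (\int[P]_w S w <= (T `^ (2 * H) / (1 - p ^+ 2))%:E)%E.
Proof.
rewrite integral_nneseries//; last 2 first.
- by move=> n; apply/measurable_EFinP.
- by move=> n w _; rewrite lee_fin.
apply: lime_le.
  by apply: is_cvg_nneseries => n _ _; apply: integral_ge0 => w _; rewrite lee_fin.
apply: nearW => n; under eq_bigr do rewrite int_lvl.
rewrite sumEFin lee_fin -mulr_sumr; apply: ler_wpM2l; first exact: powR_ge0.
have q1 : p ^+ 2 < 1 by rewrite exprn_ilt1// ltW.
have q0 : 0 <= p ^+ 2 by rewrite sqr_ge0.
rewrite -[leRHS]mul1r ler_pdivlMr ?subr_gt0//.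
rewrite big_mkord -opprB mulrN mulrC -subrX1 opprB gerBl.
by rewrite exprn_ge0.
Qed.

Let max_le w : {within `[0, T], continuous (fun t => B t w)} ->
  forall t, t \in `[0, T] ->
  ((B t w ^+ 2)%:E <= (2 * B 0 w ^+ 2)%:E + (2 / (1 - p) ^+ 2)%:E * S w)%E.
Proof.
move=> cB t tT; have q0 : 0 < 1 - p by rewrite subr_gt0.
have c0 : 0 < 2 / (1 - p) ^+ 2 by rewrite divr_gt0// exprn_gt0.
have := S_ge0 w; case E : (S w) => [s| |//] s0; last first.
  by rewrite gt0_muley ?lte_fin// addey// leey.
rewrite lee_fin in s0; rewrite -EFinM -EFinD lee_fin.
have inc n k : (k < 2 ^ n)%N ->
    `|B (dyadic_point T n k.+1) w - B (dyadic_point T n k) w| <= Num.sqrt s * p ^+ n.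
  have a0 : 0 <= Num.sqrt s * p ^+ n by rewrite mulr_ge0 ?sqrtr_ge0// exprn_ge0// ltW.
  move=> kn; rewrite -(@ler_pXn2r _ 2)// ?nnegrE//.
  rewrite real_normK ?num_real// exprMn sqr_sqrtr// -exprM mulnC.
  have pn : 0 < p ^+ (2 * n) by rewrite exprn_gt0.
  rewrite -ler_pdivrMr// mulrC -/(incr n k w).
  apply: (@le_trans _ _ (lvl n w)).
    rewrite /lvl (bigD1 (Ordinal kn))//= lerDl; apply: sumr_ge0 => i _.
    by rewrite mulr_ge0 ?sqr_ge0// invr_ge0 ltW.
  rewrite -lee_fin -E; apply: (@le_trans _ _ (\sum_(0 <= i < n.+1) (lvl i w)%:E)%E).
    by rewrite big_nat_recr//= leeDr// sume_ge0// => i _; rewrite lee_fin.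
  by apply: nneseries_lim_ge => i _; rewrite lee_fin.
have pp : 0 < p < 1 by rewrite p_gt0.
have db := @dyadic_bound _ T p (Num.sqrt s) (fun t => B t w) pp (sqrtr_ge0 s) (ltW T_gt0) inc.
have v0 : 0 <= Num.sqrt s / (1 - p) by rewrite divr_ge0 ?sqrtr_ge0// ltW.
have h := continuous_dyadic_bound T_gt0 cB db tT.
apply: (@le_trans _ _ ((`|B 0 w| + Num.sqrt s / (1 - p)) ^+ 2)).
  by rewrite -[B t w ^+ 2]real_normK ?num_real// lerXn2r ?nnegrE ?addr_ge0.
have -> : 2 / (1 - p) ^+ 2 * s = 2 * (Num.sqrt s / (1 - p)) ^+ 2.
  by rewrite expr_div_n sqr_sqrtr//; field; rewrite gt_eqF.
rewrite -[B 0 w ^+ 2]real_normK ?num_real//.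
set u := `|_|; set v := Num.sqrt s / _; have := sqr_ge0 (u - v); rewrite !expr2; nra.
Qed.

Lemma fBm_sup_sqr : exists Z : Omega -> \bar R,
  [/\ measurable_fun setT Z, forall w, (0 <= Z w)%E,
      (\int[P]_w Z w <=
        (2 * fBm_cov H 0 0 + 2 / (1 - p) ^+ 2 * (T `^ (2 * H) / (1 - p ^+ 2)))%:E)%E &
      {ae P, forall w, forall t, t \in `[0, T] -> ((B t w ^+ 2)%:E <= Z w)%E}].
Proof.
have c0 : 0 <= 2 / (1 - p) ^+ 2 by rewrite divr_ge0// sqr_ge0.
have zT : (0 : R) \in `[0, T] by rewrite in_itv/= lexx ltW.
have mB0 : measurable_fun setT (fun w => (2 * B 0 w ^+ 2)%:E).
  by apply/measurable_EFinP; apply: measurable_funM => //; exact: measurable_funX.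
have mcS : measurable_fun setT (fun w => ((2 / (1 - p) ^+ 2)%:E * S w)%E).
  exact: measurable_funeM.
exists (fun w => (2 * B 0 w ^+ 2)%:E + (2 / (1 - p) ^+ 2)%:E * S w)%E; split.
- exact: emeasurable_funD.
- move=> w; apply: adde_ge0; first by rewrite lee_fin mulr_ge0 ?sqr_ge0.
  by apply: mule_ge0.
- rewrite ge0_integralD//; last 2 first.
  + by move=> w _; rewrite lee_fin mulr_ge0 ?sqr_ge0.
  + by move=> w _; rewrite mule_ge0.
  rewrite EFinD; apply: leeD.
    rewrite EFinM; under eq_integral do rewrite EFinM.
    rewrite ge0_integralZl//; last 2 first.
    + by apply/measurable_EFinP; exact: measurable_funX.
    + by move=> w _; rewrite lee_fin sqr_ge0.
    rewrite -(fBm_mul fB zT zT) /Rintegral fineK//.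
    exact: (integrable_fin_num measurableT (fBm_mul_integrable fB zT zT)).
  rewrite ge0_integralZl// [leRHS]EFinM; apply: lee_wpmul2l => //.
- have [_ _ _ cB] := fB; apply: filterS cB => w cB t tT; exact: max_le.
Qed.

End process.

(** The measurable bound [Z] replaces the supremum, whose measurability would need
    an argument; the constant is chosen before the probability space. *)
Lemma fBm_sup_moment : exists2 c : R, 0 < c &
  forall d (Omega : measurableType d) (P : probability Omega R) (B : R -> {RV P >-> R}),
  is_fBm T H B -> exists Z : Omega -> \bar R,
  [/\ measurable_fun setT Z, forall w, (0 <= Z w)%E, (\int[P]_w Z w <= c%:E)%E &
      {ae P, forall w, forall t, t \in `[0, T] -> ((B t w ^+ 2)%:E <= Z w)%E}].
Proof.
set c := 2 * fBm_cov H 0 0 + 2 / (1 - p) ^+ 2 * (T `^ (2 * H) / (1 - p ^+ 2)).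
exists (`|c| + 1); first by rewrite ltr_pwDr.
move=> d Omega P B fB; have [Z [mZ Z0 IZ Zs]] := fBm_sup_sqr fB.
exists Z; split => //; apply: (le_trans IZ); rewrite lee_fin.
by apply: (le_trans (ler_norm _)); rewrite lerDl.
Qed.

End fBm_maximal.

(** * The Riesz kernel and the covariance *)

Section riesz_kernel.
Context {R : realType}.
Local Notation lam := (@lebesgue_measure R).
Implicit Types (be al x r a b : R).

Lemma powR_continuous_gt0 be x : 0 < x -> {for x, continuous (fun z : R => z `^ be)}.
Proof.
move=> x0; apply: differentiable_continuous.
by apply/derivable1_diffP; apply: ex_derive; exact: is_derive1_powR.
Qed.

Lemma integral_powR_pos be a x : 0 < be -> 0 < a -> a < x ->
  (\int[lam]_(z in `[a, x]) (z `^ (be - 1))%:E = ((x `^ be - a `^ be) / be)%:E)%E.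
Proof.
move=> be0 a0 ax.
have x0 := lt_trans a0 ax.
have d (z : R) : 0 < z -> is_derive z 1 (fun z : R => be^-1 * z `^ be) (z `^ (be - 1)).
  move=> z0; have -> : z `^ (be - 1) = be^-1 *: (be * z `^ (be - 1)).
    by rewrite /GRing.scale/= mulKf// gt_eqF.
  apply: (@is_deriveZ _ R^o R^o (fun z : R => z `^ be)).
  exact: is_derive1_powR.
have c (z : R) : 0 < z -> {for z, continuous (fun z : R => be^-1 * z `^ be)}.
  by move=> z0; apply: cvgM; [exact: cvg_cst|exact: powR_continuous_gt0].
rewrite (@continuous_FTC2 _ _ (fun z => be^-1 * z `^ be))//.
- by rewrite -EFinB; congr (_%:E); field; rewrite gt_eqF.
- apply: continuous_in_subspaceT => z; rewrite inE/= in_itv/= => /andP[az _].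
  exact: powR_continuous_gt0 (lt_le_trans a0 az).
- split.
  + move=> z; rewrite in_itv/= => /andP[az _]; apply: ex_derive.
    exact: d (lt_trans a0 az).
  + by apply: cvg_at_right_filter; exact: c.
  + by apply: cvg_at_left_filter; exact: c.
- move=> z; rewrite in_itv/= => /andP[az _]; rewrite derive1E.
  by have [_ ->] := d _ (lt_trans a0 az).
Qed.

(** The integrand may be singular at 0; monotone convergence along the intervals
    [1 / (n + 1), x] reduces to the fundamental theorem of calculus. *)
Lemma integral_powR be x : 0 < be -> 0 <= x ->
  (\int[lam]_(z in `]0%R, x]) (z `^ (be - 1))%:E = (x `^ be / be)%:E)%E.
Proof.
move=> be0; rewrite le_eqVlt => /predU1P[<-|x0].
  by rewrite set_itvoc0 integral_set0 powR0 ?mul0r// gt_eqF.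
pose F (n : nat) : set (measurableTypeR R) := `[n.+1%:R^-1, x]%classic.
have FE : \bigcup_n F n = `]0, x]%classic.
  apply/seteqP; split => [z [n _]|z]; rewrite /F /= !in_itv/=.
    by move=> /andP[nz ->]; rewrite andbT; apply: lt_le_trans nz; rewrite invr_gt0.
  move=> /andP[z0 zx]; exists (Num.bound z^-1) => //=; rewrite in_itv/= zx andbT.
  rewrite -[leRHS]invrK lef_pV2 ?posrE ?invr_gt0//.
  apply: le_trans (ltW (archi_boundP _)) _; first by rewrite invr_ge0 ltW.
  by rewrite ler_nat.
have mpow : measurable_fun setT (fun z : R => (z `^ (be - 1))%:E).
  by apply/measurable_EFinP; exact: measurable_powR.
have ndF : nondecreasing_seq F.
  move=> m n mn; rewrite subsetEset => z; rewrite /F/= !in_itv/= => /andP[mz ->].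
  rewrite andbT; apply: le_trans mz; rewrite lef_pV2 ?posrE//.
  by rewrite ler_nat ltnS.
have := @ge0_nondecreasing_set_cvg_integral _ _ R F (fun z => (z `^ (be - 1))%:E) lam ndF
  (fun n => measurable_itv _) (fun n => measurable_funTS mpow)
  (fun n z _ => powR_ge0 _ _).
rewrite FE => cv; apply: (cvg_unique _ cv) => //.
have lim0 : (x `^ be - (n.+1%:R^-1) `^ be) / be @[n --> \oo] --> x `^ be / be.
  apply: cvgM; last exact: cvg_cst.
  rewrite -[X in _ --> X]subr0; apply: cvgB; first exact: cvg_cst.
  have /cvg_at_rightP := powR_cvg0 be0.
  apply; split => [n|]; first by rewrite invr_gt0.
  exact: cvg_harmonic.
have lim0E : ((x `^ be - (n.+1%:R^-1) `^ be) / be)%:E @[n --> \oo] --> (x `^ be / be)%:E.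
  by apply: cvg_EFin lim0; exact: nearW.
apply: cvg_trans lim0E.
apply: near_eq_cvg; near=> n.
rewrite /F integral_powR_pos//.
by near: n; exact: (near_infty_natSinv_lt (PosNum x0)).
Unshelve. all: by end_near. Qed.

Lemma riesz_kernel_left al a r : 0 < al -> a <= r ->
  (\int[lam]_(q in `]a, r]) (`|r - q| `^ (al - 1))%:E = ((r - a) `^ al / al)%:E)%E.
Proof.
move=> al0 ar.
have mk : measurable_fun setT (fun q : R => (`|r - q| `^ (al - 1))%:E).
  apply/measurable_EFinP; apply: (measurableT_comp (measurable_powR _)) => //.
  by apply: measurableT_comp => //; exact: measurable_funB.
rewrite integral_mkcond (@ge0_integral_reflect_scale _ r 1) ?ltr01//; last 2 first.
- by apply/(measurable_restrictT _ _).1; [exact: measurable_itv|exact: measurable_funTS].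
- by move=> q; rewrite patchE; case: ifPn; rewrite ?lee_fin ?powR_ge0.
rewrite mul1e -(integral_powR al0) ?subr_ge0//.
rewrite [RHS]integral_itv_obnd_cbnd; last first.
  by apply: measurable_funTS; apply/measurable_EFinP; exact: measurable_powR.
rewrite -[RHS]integral_itv_bndo_bndc; last first.
  by apply: measurable_funTS; apply/measurable_EFinP; exact: measurable_powR.
rewrite [RHS]integral_mkcond; apply: eq_integral => z _; rewrite !patchE mul1r.
have -> : (r - z \in `]a, r]%classic) = (z \in `[0, r - a[%classic).
  by rewrite !mem_setE !in_itv/= ltrBrDl ltrBrDr addrC andbC gerBl.
case: ifPn => // /[!inE]/=; rewrite in_itv/= => /andP[z0 _].
by rewrite opprB addrC subrK ger0_norm.
Qed.

(** The reflection that exchanges [r] and [b] maps the singularity to the other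
    endpoint. *)
Lemma riesz_kernel_right al r b : 0 < al -> r <= b ->
  (\int[lam]_(q in `]r, b]) (`|r - q| `^ (al - 1))%:E = ((b - r) `^ al / al)%:E)%E.
Proof.
move=> al0 rb.
have mk : measurable_fun setT (fun q : R => (`|r - q| `^ (al - 1))%:E).
  apply/measurable_EFinP; apply: (measurableT_comp (measurable_powR _)) => //.
  by apply: measurableT_comp => //; exact: measurable_funB.
rewrite integral_mkcond (@ge0_integral_reflect_scale _ (b + r) 1) ?ltr01//; last 2 first.
- by apply/(measurable_restrictT _ _).1; [exact: measurable_itv|exact: measurable_funTS].
- by move=> q; rewrite patchE; case: ifPn; rewrite ?lee_fin ?powR_ge0.
rewrite mul1e -(riesz_kernel_left al0 rb).
rewrite [RHS]integral_itv_obnd_cbnd; last first.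
  apply: measurable_funTS; apply/measurable_EFinP.
  apply: (measurableT_comp (measurable_powR _)) => //.
  by apply: measurableT_comp => //; exact: measurable_funB.
rewrite -[RHS]integral_itv_bndo_bndc; last first.
  apply: measurable_funTS; apply/measurable_EFinP.
  apply: (measurableT_comp (measurable_powR _)) => //.
  by apply: measurableT_comp => //; exact: measurable_funB.
rewrite [RHS]integral_mkcond; apply: eq_integral => z _; rewrite !patchE mul1r.
have -> : (b + r - z \in `]r, b]%classic) = (z \in `[r, b[%classic).
  rewrite !mem_setE !in_itv/=; apply/andP/andP => -[]; split; lra.
case: ifPn => // _; congr (_ `^ _)%:E; rewrite distrC; congr `|_|; ring.
Qed.

Lemma riesz_kernel al a r b : 0 < al -> a <= r -> r <= b ->
  (\int[lam]_(q in `]a, b]) (`|r - q| `^ (al - 1))%:E =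
   (((r - a) `^ al + (b - r) `^ al) / al)%:E)%E.
Proof.
move=> al0 ar rb.
have -> : `]a, b]%classic = `]a, r]%classic `|` `]r, b]%classic.
  by rewrite -itv_bndbnd_setU// bnd_simp.
rewrite ge0_integral_setU//.
- by rewrite riesz_kernel_left// riesz_kernel_right// mulrDl.
- apply: measurable_funTS; apply/measurable_EFinP.
  apply: (measurableT_comp (measurable_powR _)) => //.
  by apply: measurableT_comp => //; exact: measurable_funB.
- apply/disj_setPS => q [/=]; rewrite !in_itv/= => /andP[_ qr] /andP[].
  by rewrite ltNge qr.
Qed.

End riesz_kernel.

Lemma Rintegral_seq_sum d (S : measurableType d) (R : realType)
    (mu : {measure set S -> \bar R}) (D : set S) (I : eqType) (s : seq I)
    (f : I -> S -> R) : measurable D ->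
  (forall i, i \in s -> mu.-integrable D (EFin \o f i)) ->
  mu.-integrable D (EFin \o (fun x => \sum_(i <- s) f i x)) /\
  \int[mu]_(x in D) (\sum_(i <- s) f i x) = \sum_(i <- s) \int[mu]_(x in D) f i x.
Proof.
move=> mD; elim: s => [|i s IHs] fi.
  have -> : (fun x => \sum_(i <- [::]) f i x) = cst 0 by apply/funext => x; rewrite big_nil.
  by rewrite big_nil; split; [exact: integrable0|rewrite /Rintegral integral0].
have [|int_s eq_s] := IHs; first by move=> j js; apply: fi; rewrite inE js orbT.
have int_i : mu.-integrable D (EFin \o f i) by apply: fi; rewrite inE eqxx.
have -> : (fun x => \sum_(j <- i :: s) f j x) = (fun x => f i x + \sum_(j <- s) f j x).
  by apply/funext => x; rewrite big_cons.
rewrite big_cons -eq_s; split; last by rewrite RintegralD.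
exact: (integrableD mD int_i int_s).
Qed.

Section riesz_energy.
Context {R : realType}.
Local Notation lam := (@lebesgue_measure R).
Variable H : R.
Hypothesis H_gt : 2^-1 < H.

Definition riesz (r q : R) : R := `|r - q| `^ (2 * H - 2).

Lemma riesz_ge0 r q : 0 <= riesz r q. Proof. exact: powR_ge0. Qed.

Let al_gt0 : 0 < 2 * H - 1.
Proof. by rewrite subr_gt0 mulrC -ltr_pdivrMr// mul1r. Qed.

Let H_gt0 : 0 < H. Proof. by apply: lt_trans H_gt; rewrite invr_gt0. Qed.

Let rieszE r q : riesz r q = `|r - q| `^ ((2 * H - 1) - 1).
Proof. by rewrite /riesz; congr (_ `^ _); ring. Qed.

Lemma measurable_riesz : measurable_fun setT
  (fun p : measurableTypeR R * measurableTypeR R => riesz p.1 p.2).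
Proof.
apply: (measurableT_comp (measurable_powR _)) => //.
apply: measurableT_comp => //.
by apply: measurable_funB; [exact: measurable_fst|exact: measurable_snd].
Qed.

Lemma measurable_riesz_r r : measurable_fun setT (riesz r).
Proof.
apply: (measurableT_comp (measurable_powR _)) => //.
by apply: measurableT_comp => //; exact: measurable_funB.
Qed.

Lemma integral_riesz a r b : a <= r -> r <= b ->
  (\int[lam]_(q in `]a, b]) (riesz r q)%:E =
   (((r - a) `^ (2 * H - 1) + (b - r) `^ (2 * H - 1)) / (2 * H - 1))%:E)%E.
Proof. by move=> ar rb; under eq_integral do rewrite rieszE; exact: riesz_kernel. Qed.

Lemma integral_riesz_le a r b : a <= r -> r <= b ->
  (\int[lam]_(q in `]a, b]) (riesz r q)%:E <=
   (2 * (b - a) `^ (2 * H - 1) / (2 * H - 1))%:E)%E.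
Proof.
move=> ar rb; rewrite integral_riesz// lee_fin ler_pM2r ?invr_gt0// [leRHS]mulr_natl mulr2n.
by apply: lerD; apply: ge0_ler_powR; rewrite ?nnegrE ?(ltW al_gt0)//; lra.
Qed.

(** The kernel is, up to the factor, the mixed second derivative of the
    covariance.  The inner integral is explicit once [x <= y], which is no
    restriction because the kernel is symmetric. *)
Lemma fBm_cov_riesz x y : 0 <= x -> 0 <= y ->
  (\int[lam]_(r in `]0%R, x]) \int[lam]_(q in `]0%R, y]) (riesz r q)%:E =
  (fBm_cov H x y / (H * (2 * H - 1)))%:E)%E.
Proof.
wlog xy : x y / x <= y => [wl x0 y0|x0 y0].
  have [|/ltW yx] := leP x y; first by move=> xy; exact: wl.
  have -> : fBm_cov H x y = fBm_cov H y x by rewrite /fBm_cov distrC; ring.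
  rewrite -(wl y x yx y0 x0) [LHS]integral_mkcond [RHS]integral_mkcond.
  pose f (p : measurableTypeR R * measurableTypeR R) : \bar R :=
    (riesz p.1 p.2 * \1_(`]0, x]%classic) p.1 * \1_(`]0, y]%classic) p.2)%:E.
  have mf : measurable_fun setT f.
    apply/measurable_EFinP; apply: measurable_funM; first apply: measurable_funM.
    - exact: measurable_riesz.
    - by apply: measurableT_comp; [exact: measurable_indic|exact: measurable_fst].
    - by apply: measurableT_comp; [exact: measurable_indic|exact: measurable_snd].
  have f0 p : (0 <= f p)%E by rewrite lee_fin !mulr_ge0 ?riesz_ge0.
  transitivity (\int[lam]_r \int[lam]_q f (r, q))%E.
    apply: eq_integral => r _; rewrite patchE; case: ifPn => rx; last first.
      by apply/esym/integral0_eq => q _; rewrite /f/= indicE (negbTE rx) mulr0 mul0r.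
    rewrite integral_mkcond; apply: eq_integral => q _.
    by rewrite patchE /f/= !indicE rx mulr1; case: ifPn; rewrite ?mulr1 ?mulr0.
  rewrite (fubini_tonelli f)//; apply: eq_integral => q _; rewrite patchE.
  case: ifPn => qy; last first.
    by apply: integral0_eq => r _; rewrite /f/= [\1__ q]indicE (negbTE qy) mulr0.
  rewrite [RHS]integral_mkcond; apply: eq_integral => r _.
  rewrite patchE /f/= !indicE qy mulr1 {1}/riesz distrC.
  by case: ifPn; rewrite ?mulr1 ?mulr0.
have b0 : 0 < 2 * H by rewrite mulr_gt0.
have mpow (f : R -> R) : measurable_fun setT f ->
    measurable_fun `]0, x] (fun z => (f z `^ (2 * H - 1))%:E).
  move=> mf; apply: measurable_funTS; apply/measurable_EFinP.
  exact: (measurableT_comp (measurable_powR _)).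
have i1 : (\int[lam]_(r in `]0%R, x]) (r `^ (2 * H - 1))%:E = (x `^ (2 * H) / (2 * H))%:E)%E.
  exact: integral_powR.
have i2 : (\int[lam]_(r in `]0%R, x]) (`|y - r| `^ (2 * H - 1))%:E =
    ((y `^ (2 * H) - (y - x) `^ (2 * H)) / (2 * H))%:E)%E.
  have E1 := riesz_kernel_left b0 y0; have E2 := riesz_kernel_left b0 xy.
  have mk D : measurable_fun D (fun q : R => (`|y - q| `^ (2 * H - 1))%:E).
    apply: measurable_funTS; apply/measurable_EFinP.
    apply: (measurableT_comp (measurable_powR _)) => //.
    by apply: measurableT_comp => //; exact: measurable_funB.
  have U : `]0, y]%classic = `]0, x]%classic `|` `]x, y]%classic.
    by rewrite -itv_bndbnd_setU// bnd_simp.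
  move: E1; rewrite U ge0_integral_setU//; [|exact: mk|]; last first.
    apply/disj_setPS => q [/=]; rewrite !in_itv/= => /andP[_ qr] /andP[].
    by rewrite ltNge qr.
  rewrite E2 subr0; case: (integral _ _ _) => [z| |]//=; rewrite -EFinD => -[E].
  by congr (_%:E); rewrite mulrBl -E addrK.
transitivity (\int[lam]_(r in `]0%R, x])
    ((2 * H - 1)^-1%:E * ((r `^ (2 * H - 1))%:E + (`|y - r| `^ (2 * H - 1))%:E)))%E.
  apply: eq_integral => r; rewrite inE/= in_itv/= => /andP[r0 rx].
  have ry := le_trans rx xy.
  rewrite integral_riesz// ?(ltW r0)// subr0 ger0_norm ?subr_ge0//.
  by rewrite -EFinD -EFinM mulrC.
rewrite ge0_integralZl//; last 3 first.
- apply: emeasurable_funD; first exact: mpow.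
  by apply: mpow; apply: measurableT_comp => //; exact: measurable_funB.
- by move=> r _; rewrite -EFinD lee_fin addr_ge0// powR_ge0.
- by rewrite lee_fin invr_ge0 ltW.
have mpow1 := mpow id (@measurable_id _ _ _).
have mpow2 : measurable_fun `]0, x] (fun r => (`|y - r| `^ (2 * H - 1))%:E).
  by apply: mpow; apply: measurableT_comp => //; exact: measurable_funB.
have -> : (\int[lam]_(r in `]0%R, x]) ((r `^ (2 * H - 1))%:E + (`|y - r| `^ (2 * H - 1))%:E) =
    \int[lam]_(r in `]0%R, x]) (r `^ (2 * H - 1))%:E +
    \int[lam]_(r in `]0%R, x]) (`|y - r| `^ (2 * H - 1))%:E)%E.
  by apply: ge0_integralD => // r _; rewrite lee_fin powR_ge0.
rewrite i1 i2 -EFinD -EFinM /fBm_cov ger0_norm ?subr_ge0//; congr (_%:E).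
by field; rewrite !gt_eqF.
Qed.

End riesz_energy.

(** * Second moments of step integrals *)

Section step_energy.
Context {R : realType}.
Local Notation lam := (@lebesgue_measure R).
Variables (T H : R).
Hypothesis H_gt : 2^-1 < H.
Local Notation riesz := (riesz H).

Let al_gt0 : 0 < 2 * H - 1.
Proof. by rewrite subr_gt0 mulrC -ltr_pdivrMr// mul1r. Qed.

Let H_gt0 : 0 < H. Proof. by apply: lt_trans H_gt; rewrite invr_gt0. Qed.

Let cH_gt0 : 0 < H * (2 * H - 1). Proof. by rewrite mulr_gt0. Qed.

(** Step functions written with intervals that start at 0, so that their integrals
    are combinations of values of the process instead of increments. *)
Definition combination (c : seq (R * R)) (u : R) : R := \sum_(i <- c) i.1 * \1_(`]0, i.2]) u.

Definition points_in (c : seq (R * R)) := forall i, i \in c -> i.2 \in `[0, T].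

Let sub_itv y : y \in `[0, T] -> `]0, y]%classic `<=` `[0, T]%classic.
Proof.
move=> /=; rewrite in_itv/= => /andP[_ yT] q /=; rewrite !in_itv/= => /andP[q0 qy].
by rewrite ltW//= (le_trans qy yT).
Qed.

Lemma measurable_combination c : measurable_fun setT (combination c).
Proof.
by apply: measurable_sum => i; exact: measurable_funM.
Qed.

Lemma riesz_integrable r : r \in `[0, T] -> lam.-integrable `[0, T] (EFin \o riesz r).
Proof.
rewrite in_itv/= => /andP[r0 rT]; apply/integrableP; split.
  by apply/measurable_EFinP; apply: measurable_funTS; exact: measurable_riesz_r.
rewrite -integral_itv_obnd_cbnd; last first.
  apply: measurableT_comp => //; apply/measurable_EFinP.
  by apply: measurable_funTS; exact: measurable_riesz_r.
under eq_integral do rewrite /= ger0_norm ?riesz_ge0//.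
by apply: le_lt_trans (integral_riesz_le H_gt r0 rT) _; rewrite ltry.
Qed.

(** The Riesz potential of the indicator of ]0, y]. *)
Definition potential y r := \int[lam]_(q in `]0, y]) riesz r q.

Let cut_integrable y r : r \in `[0, T] -> y \in `[0, T] ->
  lam.-integrable `]0, y] (EFin \o riesz r).
Proof. by move=> rT yT; apply: integrableS (riesz_integrable rT) => //; exact: sub_itv. Qed.

Let potentialE y r : r \in `[0, T] -> y \in `[0, T] ->
  (\int[lam]_(q in `]0%R, y]) (riesz r q)%:E = (potential y r)%:E)%E.
Proof.
by move=> rT yT; rewrite /potential /Rintegral fineK//; apply: integrable_fin_num => //; exact: cut_integrable.
Qed.

Let potential_ge0 y r : 0 <= potential y r.
Proof. by apply: Rintegral_ge0 => q _; exact: riesz_ge0. Qed.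

Let CT := 2 * T `^ (2 * H - 1) / (2 * H - 1).

Let potential_le y r : r \in `[0, T] -> y \in `[0, T] -> potential y r <= CT.
Proof.
move=> rT yT; rewrite -lee_fin -potentialE//.
move: (rT); rewrite in_itv/= => /andP[r0 rT'].
apply: (@le_trans _ _ (\int[lam]_(q in `]0%R, T]) (riesz r q)%:E)%E).
  apply: ge0_subset_integral => //.
  - by apply/measurable_EFinP; apply: measurable_funTS; exact: measurable_riesz_r.
  - by move=> q _; rewrite lee_fin riesz_ge0.
  - move: yT; rewrite in_itv/= => /andP[_ yT]; apply: subset_itvl.
    by rewrite bnd_simp.
by apply: le_trans (integral_riesz_le H_gt r0 rT') _; rewrite subr0.
Qed.

Let measurable_potential y : y \in `[0, T] -> measurable_fun (`[0, T] : set (measurableTypeR R)) (potential y).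
Proof.
move=> yT.
pose f (p : measurableTypeR R * measurableTypeR R) : \bar R :=
  (riesz p.1 p.2 * \1_(`]0, y]%classic) p.2)%:E.
have mf : measurable_fun setT f.
  apply/measurable_EFinP; apply: measurable_funM; first exact: measurable_riesz.
  by apply: measurableT_comp; [exact: measurable_indic|exact: measurable_snd].
have f0 p : (0 <= f p)%E by rewrite lee_fin mulr_ge0 ?riesz_ge0.
have mF := @measurable_fun_fubini_tonelli_F _ _ _ _ _ lam f mf f0.
apply/measurable_EFinP; apply: (eq_measurable_fun (fubini_F lam f)).
  move=> r /[!inE] rT; rewrite /= -potentialE// /fubini_F [RHS]integral_mkcond.
  apply: eq_integral => q _; rewrite patchE /f/= indicE.
  by case: ifPn; rewrite ?mulr1 ?mulr0.
exact: measurable_funTS.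
Qed.

Let potential_integrable x y : x \in `[0, T] -> y \in `[0, T] ->
  lam.-integrable `]0, x] (EFin \o potential y).
Proof.
move=> xT yT; apply: (@integrableS _ _ _ lam `[0, T]) => //; first exact: sub_itv.
apply: measurable_bounded_integrable => //.
- by rewrite /= lebesgue_measure_itv/=; case: ifP => _; rewrite -?EFinB ltry.
- exact: measurable_potential.
- exists CT; split; first exact: num_real.
  move=> z cz r rT /=; rewrite ger0_norm ?potential_ge0//.
  by apply: le_trans (ltW cz); exact: potential_le.
Qed.

Lemma fBm_cov_potential x y : x \in `[0, T] -> y \in `[0, T] ->
  fBm_cov H x y = H * (2 * H - 1) * \int[lam]_(r in `]0, x]) potential y r.
Proof.
move=> xT yT.
have [x0 y0] : 0 <= x /\ 0 <= y by move: xT yT; rewrite !in_itv/= => /andP[-> _] /andP[-> _].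
have := fBm_cov_riesz H_gt x0 y0.
have -> : (\int[lam]_(r in `]0%R, x]) \int[lam]_(q in `]0%R, y]) (riesz r q)%:E =
    (\int[lam]_(r in `]0%R, x]) potential y r)%:E)%E.
  rewrite /Rintegral fineK; last by apply: integrable_fin_num => //; exact: potential_integrable.
  by apply: eq_integral => r; rewrite inE => rx; rewrite potentialE//; exact: sub_itv rx.
by move=> -[->]; rewrite mulrC divfK// gt_eqF.
Qed.

(** The left side is the signed double integral
    [H (2 H - 1) * \iint phi r * phi q * |r - q| ^ (2 H - 2)], which is at most the
    one with absolute values. *)
Lemma combination_energy c : points_in c ->
  ((\sum_(i <- c) \sum_(j <- c) i.1 * j.1 * fBm_cov H i.2 j.2)%:E <=
   absH_norm2 T H (combination c))%E.
Proof.
move=> cT.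
have mT : measurable (`[0, T]%classic : set (measurableTypeR R)) by exact: measurable_itv.
have mphi := measurable_combination c.
pose phi := combination c.
(* [g] is the potential of the charge [phi]. *)
pose g r := \sum_(j <- c) j.1 * potential j.2 r.
have cutE (f : R -> R) i : i \in c ->
    \int[lam]_(q in `]0, i.2]) f q = \int[lam]_(q in `[0, T]) (\1_(`]0, i.2]) q * f q).
  move=> ic; rewrite Rintegral_mkcond [RHS]Rintegral_mkcond; apply: eq_Rintegral => q _.
  rewrite !patchE indicE; case: ifPn => [|qi].
    by move=> /[dup] qi /set_mem/(sub_itv (cT _ ic))/mem_set ->; rewrite mul1r.
  by rewrite mul0r; case: ifPn.
have cut_int1 (f : R -> R) i : i \in c -> lam.-integrable `]0, i.2] (EFin \o f) ->
    lam.-integrable `[0, T] (EFin \o (fun q => \1_(`]0, i.2]) q * f q)).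
  move=> ic fi.
  have : lam.-integrable `[0, T] ((EFin \o f) \_ `]0, i.2]).
    apply/integrable_restrict => //.
    by rewrite setIidr//; exact: sub_itv (cT _ ic).
  apply: eq_integrable => // q _; rewrite patchE /= indicE.
  by case: ifPn; rewrite ?mul1r ?mul0r.
have cut_int (f : R -> R) i : i \in c -> lam.-integrable `]0, i.2] (EFin \o f) ->
    lam.-integrable `[0, T] (EFin \o (fun q => i.1 * (\1_(`]0, i.2]) q * f q))).
  move=> ic fi.
  exact: (@integrableZl _ _ _ lam _ mT i.1 (EFin \o (fun q => \1_(`]0, i.2]) q * f q)) (cut_int1 _ _ ic fi)).
have gE r : r \in `[0, T] ->
    lam.-integrable `[0, T] (EFin \o (fun q => phi q * riesz r q)) /\
    g r = \int[lam]_(q in `[0, T]) (phi q * riesz r q).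
  move=> rT.
  have [|I1 I2] := @Rintegral_seq_sum _ _ _ lam `[0, T] _ c
    (fun i q => i.1 * (\1_(`]0, i.2]) q * riesz r q)) mT.
    by move=> i ic; apply: cut_int => //; apply: cut_integrable => //; exact: cT.
  have E : (fun q => \sum_(i <- c) i.1 * (\1_(`]0, i.2]) q * riesz r q)) = (fun q => phi q * riesz r q).
    apply/funext => q; rewrite /phi /combination mulr_suml; apply: eq_bigr => i _.
    by rewrite mulrA.
  rewrite E in I1 I2; split => //; rewrite I2 /g !big_seq.
  apply: eq_bigr => i ic; rewrite /potential (cutE _ _ ic).
  rewrite RintegralZl//; apply: cut_int1 => //.
  by apply: cut_integrable => //; exact: cT.
have g_int x : x \in `[0, T] -> lam.-integrable `]0, x] (EFin \o g).
  move=> xT; apply: (@Rintegral_seq_sum _ _ _ lam _ _ c (fun j r => j.1 * potential j.2 r) _ _).1 => //.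
  move=> j jc; apply: (@integrableZl _ _ _ lam _ _ j.1 (EFin \o potential j.2)) => //.
  by apply: potential_integrable => //; exact: cT.
have g_cut x : x \in `[0, T] -> \int[lam]_(r in `]0, x]) g r =
    \sum_(j <- c) j.1 * \int[lam]_(r in `]0, x]) potential j.2 r.
  move=> xT; rewrite /g (@Rintegral_seq_sum _ _ _ lam _ _ c (fun j r => j.1 * potential j.2 r) _ _).2 //.
    rewrite !big_seq; apply: eq_bigr => j jc; rewrite RintegralZl//.
    by apply: potential_integrable => //; exact: cT.
  move=> j jc; apply: (@integrableZl _ _ _ lam _ _ j.1 (EFin \o potential j.2)) => //.
  by apply: potential_integrable => //; exact: cT.
have [|G1 G2] := @Rintegral_seq_sum _ _ _ lam `[0, T] _ c
    (fun i r => i.1 * (\1_(`]0, i.2]) r * g r)) mT.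
  by move=> i ic; apply: cut_int => //; apply: g_int; exact: cT.
have E : (fun r => \sum_(i <- c) i.1 * (\1_(`]0, i.2]) r * g r)) = (fun r => phi r * g r).
  apply/funext => r; rewrite /phi /combination mulr_suml; apply: eq_bigr => i _.
  by rewrite mulrA.
rewrite E in G1 G2.
have -> : \sum_(i <- c) \sum_(j <- c) i.1 * j.1 * fBm_cov H i.2 j.2 =
    H * (2 * H - 1) * \int[lam]_(r in `[0, T]) (phi r * g r).
  rewrite G2 mulr_sumr !big_seq; apply: eq_bigr => i ic.
  rewrite RintegralZl//; last by apply: cut_int1 => //; apply: g_int; exact: cT.
  rewrite -cutE// g_cut; last exact: cT.
  rewrite !mulr_sumr !big_seq; apply: eq_bigr => j jc.
  rewrite fBm_cov_potential; [ring|exact: cT|exact: cT].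
rewrite EFinM /absH_norm2; apply: lee_wpmul2l; first by rewrite lee_fin ltW.
have nG := integrable_norm G1.
apply: (@le_trans _ _ (\int[lam]_(r in `[0, T]) `|phi r * g r|)%:E).
  by rewrite lee_fin (le_trans (ler_norm _))//; exact: le_normr_Rintegral.
rewrite /Rintegral fineK; last exact: integrable_fin_num nG.
pose f (p : measurableTypeR R * measurableTypeR R) : \bar R :=
  (`|phi p.1| * `|phi p.2| * riesz p.1 p.2 * \1_(`[0, T]%classic) p.2)%:E.
have mf : measurable_fun setT f.
  apply/measurable_EFinP; apply: measurable_funM; first apply: measurable_funM.
  - apply: measurable_funM; apply: measurableT_comp => //; apply: measurableT_comp => //.
  - exact: measurable_riesz.
  - by apply: measurableT_comp; [exact: measurable_indic|exact: measurable_snd].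
have f0 p : (0 <= f p)%E by rewrite lee_fin !mulr_ge0 ?riesz_ge0.
have mF := @measurable_fun_fubini_tonelli_F _ _ _ _ _ lam f mf f0.
apply: ge0_le_integral => //.
- apply: (measurable_int lam); exact: nG.
- apply: (eq_measurable_fun (fubini_F lam f)); last exact: measurable_funTS.
  move=> r _; rewrite /fubini_F [RHS]integral_mkcond; apply: eq_integral => q _.
  rewrite patchE /f/= indicE; case: ifPn; rewrite ?mulr1 ?mulr0//.
- move=> r rT; rewrite /= normrM EFinM.
  have [I1 ->] := gE r rT.
  rewrite (_ : (fun u : R => (`|combination c r| * `|combination c u| * `|r - u| `^ (2 * H - 2))%:E)
     = (fun u => `|phi r|%:E * (`|phi u * riesz r u|)%:E)%E); last first.
    by apply/funext => u; rewrite -EFinM normrM mulrA (ger0_norm (riesz_ge0 _ _ _)).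
  rewrite ge0_integralZl//; last by apply: (measurable_int lam); exact: integrable_norm I1.
  apply: lee_wpmul2l => //.
  rewrite -[leRHS]fineK; last exact: integrable_fin_num (integrable_norm I1).
  by rewrite lee_fin; exact: le_normr_Rintegral.
Qed.

End step_energy.

Section step_moment.
Context {R : realType} {d} {Omega : measurableType d}.
Variables (P : probability Omega R) (T H : R) (B : R -> {RV P >-> R}).
Hypotheses (H_gt : 2^-1 < H) (fB : is_fBm T H B).

(** Each ]s, t] is the difference of ]0, t] and ]0, s]. *)
Definition step_points (l : seq (R * R * R)) : seq (R * R) :=
  [seq (p.1.1, p.2) | p <- l] ++ [seq (- p.1.1, p.1.2) | p <- l].

Lemma step_points_in l : step_in T l -> points_in T (step_points l).
Proof.
move=> lT i; rewrite mem_cat => /orP[] /mapP[p pl ->] /=; have [p0 p1 p2] := lT p pl;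
  by rewrite in_itv/= ?p0 ?p2 ?(le_trans p0 p1) ?(le_trans p1 p2).
Qed.

Lemma step_fun_combination l : step_in T l -> step_fun l = combination (step_points l).
Proof.
move=> lT; apply/funext => u; rewrite /combination big_cat !big_map/= -big_split/=.
rewrite /step_fun !big_seq; apply: eq_bigr => p pl; have [p0 p1 p2] := lT p pl.
rewrite mulNr -mulrBr; congr (_ * _); rewrite !indicE !mem_setE !in_itv/=.
have [u0|u0] := ltP 0 u; have [pu|pu] := ltP p.1.2 u; have [up|up] := leP u p.2;
  rewrite ?subr0 ?subrr//=; first by move: (le_lt_trans (le_trans pu p1) up); rewrite ltxx.
by move: (lt_le_trans pu (le_trans u0 p0)); rewrite ltxx.
Qed.

Lemma step_integral_combination l w :
  step_integral B l w = \sum_(i <- step_points l) i.1 * B i.2 w.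
Proof.
rewrite big_cat !big_map/= -big_split/=; apply: eq_bigr => p _.
by rewrite mulNr -mulrBr.
Qed.

Lemma combination_moment c : points_in T c ->
  (\int[P]_w ((\sum_(i <- c) i.1 * B i.2 w) ^+ 2)%:E =
   (\sum_(i <- c) \sum_(j <- c) i.1 * j.1 * fBm_cov H i.2 j.2)%:E)%E.
Proof.
move=> cT.
have int1 i j : i \in c -> j \in c ->
    P.-integrable setT (EFin \o (fun w => i.1 * j.1 * (B i.2 w * B j.2 w))).
  move=> ic jc.
  apply: (@integrableZl _ _ _ P _ measurableT (i.1 * j.1) (EFin \o (fun w => B i.2 w * B j.2 w))).
  exact: fBm_mul_integrable fB _ _ (cT _ ic) (cT _ jc).
have int2 i : i \in c -> P.-integrable setT
    (EFin \o (fun w => \sum_(j <- c) i.1 * j.1 * (B i.2 w * B j.2 w))) /\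
    \int[P]_w (\sum_(j <- c) i.1 * j.1 * (B i.2 w * B j.2 w)) =
    \sum_(j <- c) i.1 * j.1 * fBm_cov H i.2 j.2.
  move=> ic; have [|I1 I2] := @Rintegral_seq_sum _ _ _ P setT _ c
    (fun j w => i.1 * j.1 * (B i.2 w * B j.2 w)) measurableT.
    by move=> j jc; exact: int1.
  split => //; rewrite I2 !big_seq; apply: eq_bigr => j jc.
  rewrite RintegralZl//; last exact: fBm_mul_integrable fB _ _ (cT _ ic) (cT _ jc).
  by rewrite (fBm_mul fB (cT _ ic) (cT _ jc)).
have [|I1 I2] := @Rintegral_seq_sum _ _ _ P setT _ c
  (fun i w => \sum_(j <- c) i.1 * j.1 * (B i.2 w * B j.2 w)) measurableT.
  by move=> i ic; exact: (int2 i ic).1.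
have E : (fun w => \sum_(i <- c) \sum_(j <- c) i.1 * j.1 * (B i.2 w * B j.2 w)) =
    (fun w => (\sum_(i <- c) i.1 * B i.2 w) ^+ 2).
  apply/funext => w; rewrite expr2 mulr_suml; apply: eq_bigr => i _.
  by rewrite mulr_sumr; apply: eq_bigr => j _; ring.
rewrite E in I1 I2.
rewrite -[LHS]fineK; last exact: integrable_fin_num I1.
congr (_%:E); transitivity (\int[P]_w ((\sum_(i <- c) i.1 * B i.2 w) ^+ 2)) => //.
by rewrite I2 !big_seq; apply: eq_bigr => i ic; exact: (int2 i ic).2.
Qed.

Lemma measurable_step_integral l : measurable_fun setT (step_integral B l).
Proof.
apply: measurable_sum => p; apply: measurable_funM => //.
exact: measurable_funB.
Qed.

Lemma step_second_moment l : step_in T l ->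
  (\int[P]_w (step_integral B l w ^+ 2)%:E <= absH_norm2 T H (step_fun l))%E.
Proof.
move=> lT; rewrite (step_fun_combination lT).
under eq_integral do rewrite step_integral_combination.
rewrite combination_moment; last exact: step_points_in.
by apply: combination_energy => //; exact: step_points_in.
Qed.

End step_moment.

(** * Energy of nonnegative densities *)

Section energy.
Context {R : realType}.
Local Notation lam := (@lebesgue_measure R).
Variables (H : R).
Hypotheses (H_gt : 2^-1 < H) (H_lt : H < 1).
Local Notation riesz := (riesz H).
Implicit Types (f g : R -> R).

Let al_gt0 : 0 < 2 * H - 1.
Proof. by rewrite subr_gt0 mulrC -ltr_pdivrMr// mul1r. Qed.

Definition energy_density f g (p : measurableTypeR R * measurableTypeR R) : \bar R :=
  (f p.1 * g p.2 * riesz p.1 p.2)%:E.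

Definition energy f g : \bar R := (\int[lam]_s \int[lam]_u energy_density f g (s, u))%E.

Definition density f := measurable_fun setT f /\ forall s, 0 <= f s.

Lemma energy_density_ge0 f g p : density f -> density g -> (0 <= energy_density f g p)%E.
Proof. by move=> [_ f0] [_ g0]; rewrite lee_fin !mulr_ge0 ?riesz_ge0. Qed.

Lemma measurable_energy_density f g : density f -> density g ->
  measurable_fun setT (energy_density f g).
Proof.
move=> [mf _] [mg _]; apply/measurable_EFinP; apply: measurable_funM.
  by apply: measurable_funM; apply: measurableT_comp => //.
exact: measurable_riesz.
Qed.

Let measurable_row f g s : density f -> density g ->
  measurable_fun setT (fun u => energy_density f g (s, u)).
Proof. by move=> df dg; exact: measurable_fun_pair2 (measurable_energy_density df dg). Qed.

Let measurable_rows f g : density f -> density g ->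
  measurable_fun setT (fun s => \int[lam]_u energy_density f g (s, u))%E.
Proof.
move=> df dg; exact: (@measurable_fun_fubini_tonelli_F _ _ _ _ _ lam _
  (measurable_energy_density df dg) (fun p => energy_density_ge0 p df dg)).
Qed.

Let rows_ge0 f g s : density f -> density g ->
  (0 <= \int[lam]_u energy_density f g (s, u))%E.
Proof. by move=> df dg; apply: integral_ge0 => u _; exact: energy_density_ge0. Qed.

Lemma energyC f g : density f -> density g -> energy f g = energy g f.
Proof.
move=> df dg; rewrite /energy (fubini_tonelli (energy_density f g)); last 2 first.
- exact: measurable_energy_density.
- by move=> p; exact: energy_density_ge0.
apply: eq_integral => u _; apply: eq_integral => s _.
by rewrite /energy_density/= /riesz distrC [f s * _]mulrC.
Qed.

Lemma energyD f f' g : density f -> density f' -> density g ->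
  energy (f \+ f') g = (energy f g + energy f' g)%E.
Proof.
move=> df df' dg; rewrite /energy -ge0_integralD//; last 4 first.
- by move=> s _; exact: rows_ge0.
- exact: measurable_rows.
- by move=> s _; exact: rows_ge0.
- exact: measurable_rows.
apply: eq_integral => s _; rewrite -ge0_integralD//; last 4 first.
- by move=> u _; exact: energy_density_ge0.
- exact: measurable_row.
- by move=> u _; exact: energy_density_ge0.
- exact: measurable_row.
by apply: eq_integral => u _; rewrite /energy_density/= -EFinD; congr (_%:E); ring.
Qed.

Lemma le_energy f f' g g' : density f -> density f' -> density g -> density g' ->
  (forall s, f s <= f' s) -> (forall s, g s <= g' s) -> (energy f g <= energy f' g')%E.
Proof.
move=> df df' dg dg' ff' gg'; apply: ge0_le_integral => //.
- by move=> s _; exact: rows_ge0.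
- exact: measurable_rows.
- exact: measurable_rows.
move=> s _; apply: ge0_le_integral => //.
- by move=> u _; exact: energy_density_ge0.
- exact: measurable_row.
- exact: measurable_row.
move=> u _; rewrite lee_fin; apply: ler_wpM2r; first exact: riesz_ge0.
by apply: ler_pM => //; [exact: df.2|exact: dg.2].
Qed.

Lemma densityD f g : density f -> density g -> density (f \+ g).
Proof.
move=> [mf f0] [mg g0]; split; first exact: measurable_funD.
by move=> s; rewrite addr_ge0.
Qed.

(** The potential of [f] is bounded on the support of [g]. *)
Lemma energy_bound a b M f g : a <= b -> 0 <= M -> density f -> density g ->
  (forall s, g s != 0 -> s \in `[a, b]) ->
  (forall u, f u <= M * \1_(`]a, b]%classic) u) ->
  (energy g f <= (M * (2 * (b - a) `^ (2 * H - 1) / (2 * H - 1)))%:E * \int[lam]_s (g s)%:E)%E.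
Proof.
move=> ab M0 df dg gab fM; rewrite -ge0_integralZl//; last 3 first.
- by apply/measurable_EFinP; exact: dg.1.
- by move=> s _; rewrite lee_fin; exact: dg.2.
- by rewrite lee_fin !mulr_ge0 ?invr_ge0 ?powR_ge0 ?(ltW al_gt0).
apply: ge0_le_integral => //.
- by move=> s _; exact: rows_ge0.
- exact: measurable_rows.
- by apply/measurable_EFinP; apply: measurable_funM => //; exact: dg.1.
move=> s _; have [gs|gs] := eqVneq (g s) 0.
  rewrite gs mule0 integral0_eq// => u _.
  by rewrite /energy_density/= gs !mul0r.
have /andP[as_ sb] := gab s gs.
apply: (@le_trans _ _ (\int[lam]_u ((g s * M)%:E * ((EFin \o riesz s) \_ `]a, b]) u))%E).
  apply: ge0_le_integral => //.
  - by move=> u _; exact: energy_density_ge0.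
  - exact: measurable_row.
  - apply: measurable_funeM; apply/(measurable_restrictT _ _).1 => //.
    by apply/measurable_EFinP; apply: measurable_funTS; exact: measurable_riesz_r.
  move=> u _; rewrite patchE /energy_density/=.
  have := fM u; rewrite indicE; case: ifPn => ut; rewrite ?mulr1 ?mulr0 => fu.
    rewrite -EFinM lee_fin; apply: ler_wpM2r; first exact: riesz_ge0.
    by apply: ler_wpM2l => //; exact: dg.2.
  have -> : f u = 0 by apply/eqP; rewrite eq_le fu df.2.
  by rewrite mulr0 mul0r mule0.
rewrite ge0_integralZl//; last 3 first.
- apply/(measurable_restrictT _ _).1 => //.
  by apply/measurable_EFinP; apply: measurable_funTS; exact: measurable_riesz_r.
- by move=> u _; rewrite patchE; case: ifPn; rewrite ?lee_fin ?riesz_ge0.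
- by rewrite lee_fin mulr_ge0//; exact: dg.2.
rewrite -integral_mkcond.
have := integral_riesz_le H_gt as_ sb.
move=> /(lee_wpmul2l (_ : 0 <= (g s * M)%:E)%E) h.
apply: (le_trans (h _)); first by rewrite lee_fin mulr_ge0//; exact: dg.2.
by rewrite -!EFinM lee_fin le_eqVlt; apply/orP; left; apply/eqP; ring.
Qed.

(** On [0, T] the kernel is at least [T ^ (2 H - 2)], except on the diagonal where
    the value of the power function at 0 is conventional; each section of the
    diagonal is a single point, hence negligible. *)
Lemma energy_lower T g : 0 < T -> density g ->
  (forall s, g s != 0 -> s \in `[0, T]) ->
  ((T `^ (2 * H - 2))%:E * ((\int[lam]_s (g s)%:E) * (\int[lam]_s (g s)%:E)) <= energy g g)%E.
Proof.
move=> T0 dg gT; set I := (\int[lam]_s (g s)%:E)%E.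
have mg : measurable_fun setT (EFin \o g) by apply/measurable_EFinP; exact: dg.1.
have I0 : (0 <= I)%E by apply: integral_ge0 => s _; rewrite lee_fin; exact: dg.2.
have powT u s : g s != 0 -> g u != 0 -> s != u -> T `^ (2 * H - 2) <= riesz s u.
  move=> /gT; rewrite in_itv/= => /andP[s0 sT] /gT; rewrite in_itv/= => /andP[u0 uT] su.
  have su0 : 0 < `|s - u| by rewrite normr_gt0 subr_eq0.
  have suT : `|s - u| <= T by rewrite ler_norml; apply/andP; split; lra.
  have -> : 2 * H - 2 = - (2 - 2 * H) by ring.
  rewrite /riesz (_ : 2 * H - 2 = - (2 - 2 * H)); last by ring.
  rewrite !powRN lef_pV2 ?posrE ?powR_gt0//.
  apply: ge0_ler_powR; rewrite ?nnegrE//; last exact: ltW.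
  by have := H_lt; lra.
apply: (@le_trans _ _ (\int[lam]_s (((T `^ (2 * H - 2))%:E * I) * (g s)%:E))%E).
  rewrite ge0_integralZl//; first by rewrite muleA.
  - by move=> s _; rewrite lee_fin; exact: dg.2.
  - by rewrite mule_ge0// lee_fin powR_ge0.
apply: ge0_le_integral => //.
- by move=> s _; rewrite !mule_ge0 ?lee_fin ?powR_ge0//; exact: dg.2.
- exact: measurable_funeM.
- exact: measurable_rows.
move=> s _; rewrite muleAC -EFinM /I -ge0_integralZl//; last 2 first.
- by move=> u _; rewrite lee_fin; exact: dg.2.
- by rewrite lee_fin mulr_ge0 ?powR_ge0//; exact: dg.2.
apply: ae_ge0_le_integral => //.
- by move=> u _; rewrite -EFinM lee_fin !mulr_ge0 ?powR_ge0//; exact: dg.2.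
- exact: measurable_funeM.
- by move=> u _; exact: energy_density_ge0.
- exact: measurable_row.
exists [set s]; split => //; first exact: lebesgue_measure_set1.
move=> u /= /existsNP[_]; rewrite /energy_density/= -EFinM lee_fin.
apply: contra_notP => /eqP us.
have [->|gs] := eqVneq (g s) 0; first by rewrite mulr0 !mul0r.
have [->|gu] := eqVneq (g u) 0; first by rewrite !mulr0 mul0r.
rewrite [leRHS]mulrC -mulrA; apply: ler_wpM2r; last by apply: powT => //; rewrite eq_sym.
by apply: mulr_ge0; exact: dg.2.
Qed.

End energy.

Section reproducing_norm.
Context {R : realType}.
Local Notation lam := (@lebesgue_measure R).
Variables (T H : R).
Hypotheses (T_gt0 : 0 < T) (H_gt : 2^-1 < H) (H_lt : H < 1).

Let al_gt0 : 0 < 2 * H - 1.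
Proof. by rewrite subr_gt0 mulrC -ltr_pdivrMr// mul1r. Qed.

Let H_gt0 : 0 < H. Proof. by apply: lt_trans H_gt; rewrite invr_gt0. Qed.

Let cH := H * (2 * H - 1).

Let cH_gt0 : 0 < cH. Proof. by rewrite mulr_gt0. Qed.

Definition abs_trunc (phi : R -> R) : R -> R := (fun s => `|phi s|) \_ `[0, T].

Lemma abs_trunc_density (phi : R -> R) : measurable_fun (`[0, T] : set (measurableTypeR R)) phi ->
  density (abs_trunc phi).
Proof.
move=> mphi; split.
  by apply/(measurable_restrictT _ _).1 => //; exact: measurableT_comp.
by move=> s; rewrite /abs_trunc patchE; case: ifPn.
Qed.

Lemma abs_trunc_supp phi s : abs_trunc phi s != 0 -> s \in `[0, T].
Proof. by rewrite /abs_trunc patchE; case: ifPn; rewrite ?eqxx// inE. Qed.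

Lemma absH_norm2_energy phi :
  absH_norm2 T H phi = (cH%:E * energy H (abs_trunc phi) (abs_trunc phi))%E.
Proof.
rewrite /absH_norm2; apply: (congr1 (mule cH%:E)).
rewrite [LHS]integral_mkcond.
apply: eq_integral => s _; rewrite patchE; case: ifPn => sT; last first.
  apply/esym/integral0_eq => u _; rewrite /energy_density/= /abs_trunc patchE (negbTE sT).
  by rewrite !mul0r.
rewrite [LHS]integral_mkcond; apply: eq_integral => u _.
rewrite patchE /energy_density/= /abs_trunc !patchE sT; case: ifPn => //.
by rewrite mulr0 mul0r.
Qed.

(** One integration over the window of length [b - a] gains [2 H - 1] powers of
    the length, and the other one gains 1. *)
Lemma absH_norm2_window (a b M : R) (phi : R -> R) : a <= b -> 0 <= M ->
  measurable_fun (`[0, T] : set (measurableTypeR R)) phi ->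
  (forall s, `|phi s| <= M) -> (forall s, phi s != 0 -> s \in `]a, b[) ->
  (absH_norm2 T H phi <= (2 * H * M ^+ 2 * (b - a) `^ (2 * H))%:E)%E.
Proof.
move=> ab M0 mphi phiM phis.
have df := abs_trunc_density mphi.
have fM u : abs_trunc phi u <= M * \1_(`]a, b]%classic) u.
  rewrite /abs_trunc patchE indicE; case: ifPn => _; last by rewrite mulr_ge0.
  have [->|/phis] := eqVneq (phi u) 0; first by rewrite normr0 mulr_ge0.
  rewrite in_itv/= => /andP[au ub]; rewrite mem_set ?mulr1//= in_itv/= au ltW//.
rewrite absH_norm2_energy.
have h : (energy H (abs_trunc phi) (abs_trunc phi) <=
    (M * (2 * (b - a) `^ (2 * H - 1) / (2 * H - 1)))%:E * (M * (b - a))%:E)%E.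
  apply: (le_trans (energy_bound H_gt ab M0 df df _ fM)).
    move=> s; rewrite /abs_trunc patchE; case: ifPn; rewrite ?eqxx// normr_eq0 => _ /phis.
    by rewrite !in_itv/= => /andP[/ltW -> /ltW ->].
  apply: lee_wpmul2l; first by rewrite lee_fin !mulr_ge0 ?invr_ge0 ?powR_ge0 ?(ltW al_gt0).
  apply: (@le_trans _ _ (\int[lam]_s (M%:E * (\1_(`]a, b]%classic) s)%:E))%E).
    apply: ge0_le_integral => //.
    - by move=> s _; rewrite lee_fin; exact: df.2.
    - by apply/measurable_EFinP; exact: df.1.
    - by apply/measurable_EFinP; exact: measurable_funM.
    - by move=> s _; rewrite -EFinM lee_fin.
  rewrite ge0_integralZl//; last by apply/measurable_EFinP.
  rewrite integral_indic// setIT /= lebesgue_measure_itv/= lte_fin.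
  case: ltP => [_|ba]; first by rewrite -EFinD -EFinM.
  by rewrite mule0 lee_fin mulr_ge0 ?subr_ge0.
apply: (le_trans (lee_wpmul2l _ h)); first by rewrite lee_fin ltW.
rewrite -!EFinM lee_fin le_eqVlt; apply/orP; left; apply/eqP.
have -> : (b - a) `^ (2 * H) = (b - a) * (b - a) `^ (2 * H - 1).
  by rewrite mulr_powRB1 ?subr_ge0// mulr_gt0.
by rewrite /cH; field; rewrite gt_eqF.
Qed.

(** Bounds the potential on [0, T] of a density bounded by [M]: the half-open
    interval ]-1, T] contains [0, T] with its left endpoint. *)
Let c1 M := M * (2 * (T - -1) `^ (2 * H - 1) / (2 * H - 1)).

Let rho_bound (D : \bar R) rho : 0 < rho -> (0 <= D)%E ->
  ((T `^ (2 * H - 2))%:E * (D * D) <= (T `^ (2 * H - 2) * rho ^+ 2)%:E)%E ->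
  (D <= rho%:E)%E.
Proof.
move=> r0; have Tg : 0 < T `^ (2 * H - 2) by exact: powR_gt0.
case: D => [D| |//] D0; last by rewrite mulyy gt0_muley ?lte_fin// leye_eq.
rewrite lee_fin in D0; rewrite -!EFinM !lee_fin ler_pM2l// -expr2.
by rewrite ler_pXn2r// nnegrE ltW.
Qed.

(** The energy of the error [de] bounds its L^1 norm by [energy_lower], and the
    cross term is at most this L^1 norm times the bounded potential of [phi]. *)
Lemma absH_norm2_perturb (M rho : R) (phi psi : R -> R) : 0 <= M -> 0 < rho -> rho <= 1 ->
  measurable_fun (`[0, T] : set (measurableTypeR R)) phi ->
  measurable_fun (`[0, T] : set (measurableTypeR R)) psi ->
  (forall s, `|phi s| <= M) ->
  (absH_norm2 T H (fun s => (phi s - psi s)%R) <= (cH * (T `^ (2 * H - 2) * rho ^+ 2))%:E)%E ->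
  (absH_norm2 T H psi <= absH_norm2 T H phi +
    ((2 * cH * c1 M + cH * T `^ (2 * H - 2)) * rho)%:E)%E.
Proof.
move=> M0 r0 r1 mphi mpsi phiM; rewrite !absH_norm2_energy.
set f := abs_trunc phi; set l := abs_trunc psi; set de := abs_trunc (fun s => phi s - psi s).
have df : density f := abs_trunc_density mphi.
have dl : density l := abs_trunc_density mpsi.
have dd : density de by apply: abs_trunc_density; exact: measurable_funB.
have cHE : (0 < cH%:E)%E by rewrite lte_fin.
have -> : (cH * (T `^ (2 * H - 2) * rho ^+ 2))%:E =
    (cH%:E * (T `^ (2 * H - 2) * rho ^+ 2)%:E)%E by exact: EFinM.
have cancel (u v : \bar R) : (cH%:E * u <= cH%:E * v)%E -> (u <= v)%E by rewrite lee_pmul2l.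
move=> /cancel Q.
have D0 : (0 <= \int[lam]_s (de s)%:E)%E.
  by apply: integral_ge0 => s _; rewrite lee_fin; exact: dd.2.
have Dr := rho_bound r0 D0 (le_trans (energy_lower H_lt T_gt0 dd (@abs_trunc_supp _)) Q).
have T0 := ltW T_gt0.
have c10 : 0 <= c1 M.
  by rewrite /c1 !mulr_ge0 ?invr_ge0 ?powR_ge0 ?(ltW al_gt0).
have cross : (energy H de f <= (c1 M * rho)%:E)%E.
  have := @energy_bound _ H H_gt (-1) T M f de _ M0 df dd.
  move=> /(_ _ _ _)/le_trans; apply.
  - by rewrite (le_trans _ T0)// lerN10.
  - move=> s /abs_trunc_supp; rewrite !in_itv/= => /andP[s0 ->].
    by rewrite (le_trans _ s0)// lerN10.
  - move=> u; rewrite /f /abs_trunc patchE indicE; case: ifPn; last by rewrite mulr_ge0.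
    move=> /set_mem/=; rewrite in_itv/= => /andP[u0 uT].
    by rewrite mem_set ?mulr1//= in_itv/= uT (lt_le_trans _ u0)// ltrN10.
  - by rewrite (EFinM (c1 M)); apply: lee_wpmul2l; rewrite ?lee_fin.
have dfd := densityD df dd.
have l_le s : l s <= (f \+ de) s.
  rewrite /l /f /de /abs_trunc /= !patchE; case: ifPn => _; last by rewrite addr0.
  rewrite -{1}(subKr (phi s) (psi s)).
  exact: ler_normB.
have e0 g g' : density g -> density g' -> (0 <= energy H g g')%E.
  move=> dg dg'; apply: integral_ge0 => s _; apply: integral_ge0 => u _.
  exact: energy_density_ge0.
apply: (@le_trans _ _ (cH%:E * (energy H f f + ((2 * c1 M + T `^ (2 * H - 2)) * rho)%:E))%E).
  apply: lee_wpmul2l; first by rewrite lee_fin ltW.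
  apply: (le_trans (le_energy H dl dfd dl dfd l_le l_le)).
  have -> : energy H (f \+ de) (f \+ de) =
      (energy H f f + energy H de f + (energy H de f + energy H de de))%E.
    rewrite (energyD _ df dd dfd) (energyC _ df dfd) (energyC _ dd dfd).
    by rewrite (energyD _ df dd df) (energyD _ df dd dd) (energyC _ df dd).
  move: (energy H f f) (energy H de f) (energy H de de) cross Q => x y z yr zr.
  rewrite (_ : (2 * c1 M + T `^ (2 * H - 2)) * rho =
    c1 M * rho + (c1 M * rho + T `^ (2 * H - 2) * rho)); last by ring.
  rewrite -addeA; apply: leeD => //.
  rewrite (EFinD (c1 M * rho)); apply: leeD => //.
  rewrite (EFinD (c1 M * rho)); apply: leeD => //.
  apply: (le_trans zr); rewrite lee_fin; apply: ler_wpM2l; first exact: powR_ge0.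
  by rewrite expr2 ler_piMl// ltW.
rewrite ge0_muleDr ?e0//; last first.
  rewrite lee_fin; apply: mulr_ge0; last exact: ltW.
  by rewrite addr_ge0 ?powR_ge0// mulr_ge0.
by rewrite -EFinM; apply: leeD => //; rewrite lee_fin le_eqVlt; apply/orP; left; apply/eqP; ring.
Qed.

End reproducing_norm.

(** * Second moment of the Wiener integral *)

Lemma ge0_cvg0_le (R : realType) (u : nat -> \bar R) (e : R) : 0 < e ->
  u n @[n --> \oo] --> 0%E -> \forall n \near \oo, (u n <= e%:E)%E.
Proof.
move=> e0 u0.
have : nbhs (0%E : \bar R) [set y | (y < e%:E)%E].
  by apply: open_nbhs_nbhs; split; [exact: open_ereal_lt_ereal|rewrite /= lte_fin].
move=> /u0 lt_e.
have {lt_e} : \forall n \near \oo, (u n < e%:E)%E by exact: lt_e.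
by apply: filterS => n /ltW.
Qed.

Section wiener_moment.
Context {R : realType} {d} {Omega : measurableType d}.
Local Notation lam := (@lebesgue_measure R).
Variables (P : probability Omega R) (T H : R) (B : R -> {RV P >-> R}).
Hypotheses (T_gt0 : 0 < T) (H_gt : 2^-1 < H) (H_lt : H < 1).
Hypothesis fB : is_fBm T H B.

(** One step function close to [phi] in both senses is enough: its integral has a
    second moment close to at most the squared norm of [phi].  Comparing the
    integrals by [(u + v)^2 <= 2 u^2 + 2 v^2] costs a factor 2, so the constant is
    twice that of [absH_norm2_window]. *)
Lemma wiener_moment (a b M : R) (phi : R -> R) (W : Omega -> R) : a <= b -> 0 <= M ->
  (forall s, `|phi s| <= M) -> (forall s, phi s != 0 -> s \in `]a, b[) ->
  is_wiener_integral T H B phi W ->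
  (\int[P]_w (W w ^+ 2)%:E <= (4 * H * M ^+ 2 * (b - a) `^ (2 * H))%:E)%E.
Proof.
move=> ab M0 phiM phis [mphi mW [l [lT lphi lW]]].
have al_gt0 : 0 < 2 * H - 1 by rewrite subr_gt0 mulrC -ltr_pdivrMr// mul1r.
have H_gt0 : 0 < H by apply: lt_trans H_gt; rewrite invr_gt0.
set cH := H * (2 * H - 1).
have cH_gt0 : 0 < cH by rewrite mulr_gt0.
have Tg : 0 < T `^ (2 * H - 2) by exact: powR_gt0.
set c1 := M * (2 * (T - -1) `^ (2 * H - 1) / (2 * H - 1)).
have c10 : 0 <= c1 by rewrite /c1 !mulr_ge0 ?invr_ge0 ?powR_ge0 ?(ltW al_gt0).
set kap := 2 * cH * c1 + cH * T `^ (2 * H - 2).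
have kap0 : 0 < kap.
  apply: ltr_wpDl; last exact: mulr_gt0.
  by apply: mulr_ge0 => //; apply: mulr_ge0 => //; exact: ltW.
apply/lee_addgt0Pr => e e0.
(* Chosen so that the error [kap * rho] of [absH_norm2_perturb] is at most
   [e / 4]. *)
pose rho := Num.min 1 (e / (4 * kap)).
have r0 : 0 < rho by rewrite lt_min ltr01/= divr_gt0// pmulr_rgt0.
have r1 : rho <= 1 by rewrite ge_min lexx.
have re : kap * rho <= e / 4.
  apply: (@le_trans _ _ (kap * (e / (4 * kap)))).
    by apply: ler_wpM2l; [exact: ltW|rewrite ge_min lexx orbT].
  by rewrite le_eqVlt; apply/orP; left; apply/eqP; field; rewrite gt_eqF.
have e4 : 0 < e / 4 by rewrite divr_gt0.
have rQ : 0 < cH * (T `^ (2 * H - 2) * rho ^+ 2) by apply: mulr_gt0 => //; apply: mulr_gt0 => //; exact: exprn_gt0.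
have [n [nW nQ]] : exists n,
    (('E_P[fun w => ((W w - step_integral B (l n) w) ^+ 2)%R] <= (e / 4)%:E)%E /\
    (absH_norm2 T H (fun u => (phi u - step_fun (l n) u)%R) <=
      (cH * (T `^ (2 * H - 2) * rho ^+ 2))%:E)%E).
  have h1 := ge0_cvg0_le e4 lW; have h2 := ge0_cvg0_le rQ lphi.
  have : \forall n \near \oo,
    (('E_P[fun w => ((W w - step_integral B (l n) w) ^+ 2)%R] <= (e / 4)%:E)%E /\
    (absH_norm2 T H (fun u => (phi u - step_fun (l n) u)%R) <=
      (cH * (T `^ (2 * H - 2) * rho ^+ 2))%:E)%E).
    by apply: filterS2 h1 h2 => n.
  by move=> [n _ /(_ n (leqnn n))]; exists n.
have mS := measurable_step_integral B (l n).
have ml : measurable_fun (`[0, T] : set (measurableTypeR R)) (step_fun (l n)).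
  rewrite (step_fun_combination (lT n)); apply: measurable_funTS.
  exact: measurable_combination.
have Q0 := absH_norm2_window H_gt ab M0 mphi phiM phis.
have Q1 := absH_norm2_perturb T_gt0 H_gt H_lt M0 r0 r1 mphi ml phiM nQ.
have ES := step_second_moment H_gt fB (lT n).
have {}ES : (\int[P]_w (step_integral B (l n) w ^+ 2)%:E <=
    (2 * H * M ^+ 2 * (b - a) `^ (2 * H) + e / 4)%:E)%E.
  apply: (le_trans ES); apply: (le_trans Q1); rewrite EFinD; apply: leeD => //.
rewrite unlock in nW.
have sq_ge0 (f : Omega -> R) w : (0 <= (f w ^+ 2)%:E)%E by rewrite lee_fin sqr_ge0.
have msq (f : Omega -> R) : measurable_fun setT f -> measurable_fun setT (fun w => (f w ^+ 2)%:E).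
  by move=> mf; apply/measurable_EFinP; exact: measurable_funX.
have mWS : measurable_fun setT (fun w => W w - step_integral B (l n) w).
  exact: measurable_funB.
apply: (@le_trans _ _ (\int[P]_w (2%:E * ((W w - step_integral B (l n) w) ^+ 2)%:E +
    2%:E * (step_integral B (l n) w ^+ 2)%:E))%E).
  apply: ge0_le_integral => //.
  - exact: msq.
  - by apply: emeasurable_funD; apply: measurable_funeM; exact: msq.
  - move=> w _; rewrite -!EFinM -EFinD lee_fin.
    set s := step_integral _ _ _; have := sqr_ge0 (W w - 2 * s); rewrite !expr2; nra.
have mZ (f : Omega -> R) : measurable_fun setT f ->
    measurable_fun setT (fun w => 2%:E * (f w ^+ 2)%:E)%E.
  by move=> mf; apply: measurable_funeM; exact: msq.
have Z0 (f : Omega -> R) w : (0 <= 2%:E * (f w ^+ 2)%:E)%E by rewrite mule_ge0// lee_fin.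
rewrite (ge0_integralD P measurableT (fun w _ => Z0 _ w) (mZ _ mWS) (fun w _ => Z0 _ w) (mZ _ mS)).
rewrite !ge0_integralZl//; try exact: msq; try by move=> w _; rewrite lee_fin sqr_ge0.
apply: (@le_trans _ _ (2%:E * (e / 4)%:E +
  2%:E * (2 * H * M ^+ 2 * (b - a) `^ (2 * H) + e / 4)%:E)%E).
  by apply: leeD; apply: lee_wpmul2l.
rewrite -!EFinM -!EFinD lee_fin le_eqVlt; apply/orP; left; apply/eqP.
by field.
Qed.

End wiener_moment.

(** * Time integrals of random functions *)

Section random_integral.
Context {R : realType}.
Local Notation lam := (@lebesgue_measure R).

(** The Cauchy-Schwarz inequality, by integrating [(I / T - |f|)^2 >= 0] where [I]
    is the integral of [|f|]. *)
Lemma sqr_Rintegral_le (T t : R) (f : R -> R) : 0 < T -> t \in `[0, T] ->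
  measurable_fun (`[0, T] : set (measurableTypeR R)) f ->
  (\int[lam]_(u in `[0%R, T]) (f u ^+ 2)%:E < +oo)%E ->
  lam.-integrable `[0, t] (EFin \o f) /\
  (((\int[lam]_(u in `[0, t]) f u) ^+ 2)%:E <=
    T%:E * \int[lam]_(u in `[0%R, T]) (f u ^+ 2)%:E)%E.
Proof.
move=> T0 tT mf ffin; have := tT; rewrite in_itv/= => /andP[t0 tleT].
have mT : measurable (`[0, T]%classic : set (measurableTypeR R)) by exact: measurable_itv.
have mt : measurable (`[0, t]%classic : set (measurableTypeR R)) by exact: measurable_itv.
have sub : `[0, t]%classic `<=` `[0, T]%classic.
  by move=> u; rewrite /= !in_itv/= => /andP[-> /le_trans]; exact.
have mft : measurable_fun (`[0, t] : set (measurableTypeR R)) f := measurable_funS mT sub mf.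
have mf2 : measurable_fun (`[0, T] : set (measurableTypeR R)) (fun u => f u ^+ 2) by exact: measurable_funX.
have i2T : lam.-integrable `[0, T] (EFin \o (fun u => f u ^+ 2)).
  apply/integrableP; split; first exact/measurable_EFinP.
  by under eq_integral do rewrite /= ger0_norm ?sqr_ge0//.
have i2 : lam.-integrable `[0, t] (EFin \o (fun u => f u ^+ 2)) := integrableS mT mt sub i2T.
have icst (c : R) : lam.-integrable `[0, t] (EFin \o (fun=> c)).
  apply/integrableP; split; first exact: measurable_cst.
  by rewrite integral_cst//= lebesgue_measure_itv/=; case: ifP => _; rewrite -?EFinB -?EFinM ?mule0 ltry.
have i1 : lam.-integrable `[0, t] (EFin \o f).
  apply: (@le_integrable _ _ _ lam _ mt _ (EFin \o (fun u => 1 + f u ^+ 2))).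
  - exact/measurable_EFinP.
  - move=> u _; rewrite /= lee_fin; apply: le_trans (ler_norm _).
    by have := sqr_ge0 (`|f u| - 1); rewrite sqrrB1 real_normK ?num_real//; have := normr_ge0 (f u); lra.
  - exact: (integrableD mt (icst 1) i2).
split => //.
have i1n : lam.-integrable `[0, t] (EFin \o (fun u => `|f u|)) by exact: integrable_norm.
set I := \int[lam]_(u in `[0, t]) `|f u|; set S := \int[lam]_(u in `[0, t]) f u ^+ 2.
have I0 : 0 <= I by apply: Rintegral_ge0.
have h : 2 * (I / T) * I <= (I / T) ^+ 2 * t + S.
  rewrite /I /S; set a := I / T.
  have ct : (a ^+ 2) * t = \int[lam]_(u in `[0, t]) (a ^+ 2).
    rewrite Rintegral_cst//= lebesgue_measure_itv/= lte_fin.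
    by move: t0; rewrite le_eqVlt => /predU1P[<-|->]; rewrite ?ltxx ?mulr0//= subr0.
  rewrite ct -RintegralD// -RintegralZl//.
  apply: le_Rintegral => //.
  - exact: (@integrableZl _ _ _ lam _ mt (2 * a) (EFin \o (fun u => `|f u|)) i1n).
  - exact: (integrableD mt (icst (a ^+ 2)) i2).
  - by move=> u _; have := sqr_ge0 (a - `|f u|); rewrite sqrrB real_normK ?num_real//; lra.
have IS : I ^+ 2 <= T * S.
  rewrite -ler_pdivrMl//.
  have e1 : 2 * (I / T) * I = 2 * (T^-1 * I ^+ 2) by ring.
  have e2 : (I / T) ^+ 2 * t <= T^-1 * I ^+ 2.
    have -> : T^-1 * I ^+ 2 = (I / T) ^+ 2 * T by field; rewrite gt_eqF.
    by apply: ler_wpM2l => //; exact: sqr_ge0.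
  lra.
have ES : (S%:E <= \int[lam]_(u in `[0%R, T]) (f u ^+ 2)%:E)%E.
  have -> : (S%:E = \int[lam]_(u in `[0%R, t]) (f u ^+ 2)%:E)%E.
    by rewrite /S /Rintegral fineK//; exact: integrable_fin_num i2.
  apply: ge0_subset_integral => //; first exact/measurable_EFinP.
  by move=> u _; rewrite lee_fin sqr_ge0.
apply: (@le_trans _ _ (T%:E * S%:E)%E); last by apply: lee_wpmul2l => //; rewrite lee_fin ltW.
rewrite -EFinM lee_fin; apply: le_trans IS.
rewrite -[leLHS]real_normK ?num_real// ler_pXn2r// ?nnegrE//.
exact: le_normr_Rintegral.
Qed.

(** [Z w] is [T] times the integral of [W u w ^ 2] over [0, T], which is measurable
    and has the stated expectation by Tonelli's theorem; the time integral of [W]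
    is under control at every [w] where [Z] is finite. *)
Lemma random_integral_moment d (Omega : measurableType d) (P : probability Omega R)
    (T c : R) (W : R -> Omega -> R) : 0 < T ->
  measurable_fun (`[0, T] `*` setT) (fun p : measurableTypeR R * Omega => W p.1 p.2) ->
  (forall u, u \in `[0, T] -> (\int[P]_w (W u w ^+ 2)%:E <= c%:E)%E) ->
  exists Z : Omega -> \bar R,
  [/\ measurable_fun setT Z, forall w, (0 <= Z w)%E, (\int[P]_w Z w <= (T * (T * c))%:E)%E &
      forall w t, t \in `[0, T] -> (Z w < +oo)%E ->
        lam.-integrable `[0, t] (EFin \o W^~ w) /\
        (((\int[lam]_(u in `[0, t]) W u w) ^+ 2)%:E <= Z w)%E].
Proof.
move=> T0 mW Wc.
have mT : measurable (`[0, T]%classic : set (measurableTypeR R)) by exact: measurable_itv.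
have mD : measurable (`[0, T] `*` setT : set (measurableTypeR R * Omega)) by exact: measurableX.
pose V : measurableTypeR R * Omega -> R := (fun p => W p.1 p.2) \_ (`[0, T] `*` setT).
have mV : measurable_fun setT V by exact/(measurable_restrictT _ mD).
have VE u w : V (u, w) = ((W ^~ w) \_ `[0, T]) u.
  by rewrite /V /patch; congr (if _ then _ else _); apply/idP/idP; rewrite !inE => -[].
pose F p := (V p ^+ 2)%:E.
have mF : measurable_fun setT F by apply/measurable_EFinP; exact: measurable_funX.
have F0 p : (0 <= F p)%E by rewrite lee_fin sqr_ge0.
have FE u w : F (u, w) = ((fun u => (W u w ^+ 2)%:E) \_ `[0, T]) u.
  by rewrite /F VE /patch; case: ifP => //; rewrite expr0n.
pose Z w := (T%:E * \int[lam]_u F (u, w))%E.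
have mI : measurable_fun setT (fun w => \int[lam]_u F (u, w))%E.
  exact: (@measurable_fun_fubini_tonelli_G _ _ _ _ _ lam F mF F0).
have TE : (0 <= T%:E)%E by rewrite lee_fin ltW.
have I0 w : (0 <= \int[lam]_u F (u, w))%E by apply: integral_ge0.
exists Z; split.
- exact: measurable_funeM.
- by move=> w; exact: mule_ge0.
- rewrite ge0_integralZl// EFinM; apply: lee_wpmul2l => //.
  rewrite -(@fubini_tonelli _ _ _ _ _ lam P F)//.
  apply: (@le_trans _ _ (\int[lam]_(u in `[0%R, T]) c%:E)%E).
    rewrite [leRHS]integral_mkcond; apply: ge0_le_integral => //.
    + by move=> u _; apply: integral_ge0.
    + exact: (@measurable_fun_fubini_tonelli_F _ _ _ _ _ P F mF F0).
    + by apply/(measurable_restrictT _ mT); exact: measurable_cst.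
    + move=> u _; rewrite /patch; case: ifPn => uT.
        rewrite (_ : (\int[P]_w F (u, w))%E = (\int[P]_w (W u w ^+ 2)%:E)%E).
          by apply: Wc; rewrite inE in uT.
        by apply: eq_integral => w _; rewrite FE /patch uT.
      by rewrite integral0_eq// => w _; rewrite FE /patch (negbTE uT).
  rewrite integral_cst//= lebesgue_measure_itv/= lte_fin T0 -EFinB subr0 -EFinM.
  by rewrite lee_fin mulrC.
- move=> w t tT Zw.
  have mWw : measurable_fun (`[0, T] : set (measurableTypeR R)) (W^~ w).
    apply/(measurable_restrictT _ mT).
    have := measurable_fun_pair1 w mV.
    by apply: eq_measurable_fun => u _; rewrite VE.
  have ZE : (\int[lam]_u F (u, w) = \int[lam]_(u in `[0%R, T]) (W u w ^+ 2)%:E)%E.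
    by rewrite [RHS]integral_mkcond; apply: eq_integral => u _; rewrite FE.
  have [] := @sqr_Rintegral_le T t (W^~ w) T0 tT mWw.
    rewrite -ZE; move: Zw; rewrite /Z; case: (\int[lam]_u F (u, w))%E (I0 w) => [r||] //=.
      by move=> _ _; exact: ltry.
    by move=> _; rewrite gt0_muley ?lte_fin.
  by rewrite -ZE.
Qed.

End random_integral.

(** * Risk and consistency of the estimator *)

Lemma sqr_sum3_le (R : realType) (a b c : R) :
  (a + b + c) ^+ 2 <= 3 * (a ^+ 2 + b ^+ 2 + c ^+ 2).
Proof.
have := sqr_ge0 (a - b); have := sqr_ge0 (b - c); have := sqr_ge0 (a - c).
rewrite !expr2; nra.
Qed.

Section estimator_risk.
Context {R : realType} {d} {Omega : measurableType d}.
Local Notation lam := (@lebesgue_measure R).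
Variables (P : probability Omega R) (T H L : R) (C : R -> set R) (K b : R -> R).
Variables (x0 : R) (x y : R -> R) (B X Y tau_hat : R -> {RV P >-> R}).
Variables (lo hi M Lam cB eps h t : R).
Hypotheses (T_gt0 : 0 < T) (H_gt : 2^-1 < H) (H_lt : H < 1) (L_gt0 : 0 < L).
Hypotheses (mK : measurable_fun setT K) (K_ge0 : forall u, 0 <= K u).
Hypotheses (K_le : forall u, K u <= M) (K_int : (\int[lam]_u (K u)%:E = 1)%E).
Hypotheses (lohi : lo < hi) (K_supp : forall v, K v != 0 -> v \in `]lo, hi[).
Hypotheses (b_lip : lipschitz b) (bL : `|b 0| + lip_seminorm b <= L).
Hypothesis lim : skorokhod_solution T C b x0 (fun=> 0) x y.
Hypothesis x_lip : forall r s, r \in `[0, T] -> s \in `[0, T] ->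
  `|x s - x r| <= Lam * `|s - r|.
Hypothesis Lam_ge0 : 0 <= Lam.
Hypothesis fB : is_fBm T H B.
Hypothesis B_sup : exists Z : Omega -> \bar R,
  [/\ measurable_fun setT Z, forall w, (0 <= Z w)%E, (\int[P]_w Z w <= cB%:E)%E &
      {ae P, forall w, forall t, t \in `[0, T] -> ((B t w ^+ 2)%:E <= Z w)%E}].
Hypotheses (eps_gt0 : 0 < eps) (h_gt0 : 0 < h) (tT : t \in `[0, T]).
Hypothesis sol : {ae P, forall w, skorokhod_solution T C b x0
  (fun t => eps * B t w) (fun t => X t w) (fun t => Y t w)}.
Hypothesis est : is_trend_estimator T H b K B eps h X Y tau_hat.

Let cE := 4 * expR (4 * L * T) + 1.
Let rho : R := `|lo| + `|hi|.
Let cW := 4 * H * M ^+ 2 * ((hi - lo) * h) `^ (2 * H).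

(** The square of the pathwise error is at most three times the sum of the squares
    of its terms, which are dominated by the measurable functions of
    [fBm_sup_moment] and [random_integral_moment].  Where one of these is infinite
    the bound is trivial. *)
Lemma estimator_risk_le :
  ('E_P[fun w => (`|tau_hat t w - trend b x0 x y t| ^+ 2)%R] <=
   (12 * cE ^+ 2 * cB * eps ^+ 2 + 12 * (Lam * rho) ^+ 2 * h ^+ 2 +
    3 * eps ^+ 2 * h ^- 2 * (T * (T * cW)))%:E)%E.
Proof.
have cE_gt0 : 0 < cE by rewrite ltr_pwDr// mulr_ge0// expR_ge0.
have [Z [mZ Z0 IZ BZ]] := B_sup.
have [W [mW Wu tauE]] := est.
have M_ge0 : 0 <= M by exact: le_trans (K_le 0).
have W_moment u : u \in `[0, T] -> (\int[P]_w (W u w ^+ 2)%:E <= cW%:E)%E.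
  move=> uT.
  have ab : u + lo * h <= u + hi * h by rewrite lerD2l ler_pM2r// ltW.
  have -> : cW = 4 * H * M ^+ 2 * ((u + hi * h) - (u + lo * h)) `^ (2 * H).
    by rewrite /cW; congr (_ * _ `^ _); ring.
  apply: (wiener_moment T_gt0 H_gt H_lt fB ab M_ge0 _ _ (Wu u uT)).
    by move=> s; rewrite ger0_norm.
  move=> s /K_supp; rewrite !in_itv/= ltr_pdivlMr// ltr_pdivrMr//.
  by move=> /andP[? ?]; apply/andP; split; lra.
have [V [mV V0 IV VW]] := random_integral_moment T_gt0 mW W_moment.
pose G w : \bar R := ((12 * cE ^+ 2 * eps ^+ 2)%:E * Z w +
  ((12 * (Lam * rho) ^+ 2 * h ^+ 2)%:E + (3 * eps ^+ 2 * h ^- 2)%:E * V w))%E.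
have c1 : 0 < 12 * cE ^+ 2 * eps ^+ 2 by rewrite !mulr_gt0// exprn_gt0.
have c2 : 0 <= 12 * (Lam * rho) ^+ 2 * h ^+ 2.
  by apply: mulr_ge0; [apply: mulr_ge0 => //|]; exact: sqr_ge0.
have c3 : 0 < 3 * eps ^+ 2 * h ^- 2 by rewrite !mulr_gt0// ?invr_gt0 exprn_gt0.
have G1 w : (0 <= (12 * cE ^+ 2 * eps ^+ 2)%:E * Z w)%E.
  by apply: mule_ge0 => //; rewrite lee_fin ltW.
have G3 w : (0 <= (3 * eps ^+ 2 * h ^- 2)%:E * V w)%E.
  by apply: mule_ge0 => //; rewrite lee_fin ltW.
have G2 w : (0 <= (12 * (Lam * rho) ^+ 2 * h ^+ 2)%:E + (3 * eps ^+ 2 * h ^- 2)%:E * V w)%E.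
  by apply: adde_ge0 => //; rewrite lee_fin.
have mG1 : measurable_fun setT (fun w => (12 * cE ^+ 2 * eps ^+ 2)%:E * Z w)%E.
  exact: measurable_funeM.
have mG3 : measurable_fun setT (fun w => (3 * eps ^+ 2 * h ^- 2)%:E * V w)%E.
  exact: measurable_funeM.
have mG2 : measurable_fun setT (fun w =>
    (12 * (Lam * rho) ^+ 2 * h ^+ 2)%:E + (3 * eps ^+ 2 * h ^- 2)%:E * V w)%E.
  by apply: emeasurable_funD => //; exact: measurable_cst.
have G0 w : (0 <= G w)%E by exact: adde_ge0.
have mG : measurable_fun setT G by exact: emeasurable_funD.
rewrite unlock; apply: (@le_trans _ _ (\int[P]_w G w)%E).
  apply: ae_ge0_le_integral => //.
  - by apply/measurable_EFinP; apply: measurable_funX; apply: measurableT_comp => //; exact: measurable_funB.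
  apply: filterS3 sol BZ (tauE t tT) => w solw BZw tauw _.
  have [Zoo|Zoo] := leP +oo%E (Z w).
    have Zy : Z w = +oo%E by apply/eqP; rewrite -leye_eq.
    rewrite /G Zy gt0_muley ?lte_fin// addye ?leey//.
    by move: (G2 w); case: (_ + _)%E.
  have [Voo|Voo] := leP +oo%E (V w).
    have Vy : V w = +oo%E by apply/eqP; rewrite -leye_eq.
    rewrite /G Vy gt0_muley ?lte_fin//.
    have -> (a : R) : (a%:E + +oo = +oo)%E by [].
    rewrite addey ?leey//.
    by move: (G1 w); case: (_ * _)%E.
  have [Wi WV] := VW w t tT Voo.
  have [z zE] : exists z, Z w = z%:E.
    by move: (Z0 w) Zoo; case: (Z w) => // r _ _; exists r.
  have [v vE] : exists v, V w = v%:E.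
    by move: (V0 w) Voo; case: (V w) => // r _ _; exists r.
  have z0 : 0 <= z by rewrite -lee_fin -zE.
  have Bs s : s \in `[0, T] -> `|eps * B s w - 0| <= eps * Num.sqrt z.
    move=> sT; rewrite subr0 normrM gtr0_norm//; apply: ler_wpM2l; first exact: ltW.
    by rewrite -sqrtr_sqr; apply: ler_wsqrtr; rewrite -lee_fin -zE; exact: BZw.
  have near_x s : s \in `[0, T] -> `|(X s w - eps * B s w) - x s| <= cE * (eps * Num.sqrt z).
    move=> sT; have := skorokhod_stability T_gt0 L_gt0 b_lip bL lim solw Bs sT.
    by rewrite subr0.
  have K_supp' v' : K v' != 0 -> `|v'| <= rho.
    move=> /K_supp; rewrite in_itv/= => /andP[lov vhi]; rewrite /rho ler_norml.
    have := ler_norm hi; have := ler_norm (- lo); rewrite normrN.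
    by have := normr_ge0 lo; have := normr_ge0 hi => ? ? ? ?; apply/andP; split; lra.
  rewrite tauw /G zE vE.
  set I := \int[lam]_(u in `[0, t]) W u w in WV.
  rewrite -!EFinM -!EFinD lee_fin.
  have := estimator_error_le h_gt0 T_gt0 tT mK K_ge0 K_le K_int K_supp' eps b_lip solw lim near_x x_lip Lam_ge0 Wi.
  rewrite -/I (gtr0_norm eps_gt0) => errw.
  set D := `|_ - trend b x0 x y t| in errw *.
  have D0 : 0 <= D by rewrite /D.
  have {}errw : D ^+ 2 <= (2 * (cE * (eps * Num.sqrt z)) + 2 * Lam * h * rho + eps * (h^-1 * `|I|)) ^+ 2.
    by rewrite ler_pXn2r// nnegrE; exact: le_trans errw.
  apply: (le_trans errw); apply: (le_trans (sqr_sum3_le _ _ _)).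
  have Iv : I ^+ 2 <= v by rewrite -lee_fin -vE.
  have sz : Num.sqrt z ^+ 2 = z by rewrite sqr_sqrtr.
  have -> : (2 * (cE * (eps * Num.sqrt z))) ^+ 2 = 4 * cE ^+ 2 * eps ^+ 2 * z.
    by rewrite -[in RHS]sz; ring.
  have -> : (eps * (h^-1 * `|I|)) ^+ 2 = eps ^+ 2 * h ^- 2 * I ^+ 2.
    by rewrite !exprMn real_normK ?num_real// exprVn mulrA.
  have Iv' : 3 * (eps ^+ 2 * h ^- 2 * I ^+ 2) <= 3 * eps ^+ 2 * h ^- 2 * v.
    have -> : 3 * (eps ^+ 2 * h ^- 2 * I ^+ 2) = 3 * eps ^+ 2 * h ^- 2 * I ^+ 2.
      by rewrite !mulrA.
    by apply: ler_wpM2l => //; exact: ltW.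
  have -> : 12 * (Lam * rho) ^+ 2 * h ^+ 2 = 3 * (2 * Lam * h * rho) ^+ 2 by ring.
  have -> : 12 * cE ^+ 2 * eps ^+ 2 * z = 3 * (4 * cE ^+ 2 * eps ^+ 2 * z) by ring.
  by move: Iv'; set q1 := 4 * _ * _ * z; set q2 := (2 * Lam * h * rho) ^+ 2;
     set q3 := _ * I ^+ 2; set q4 := _ * v; lra.
rewrite /G (ge0_integralD P measurableT (fun w _ => G1 w) mG1 (fun w _ => G2 w) mG2).
have mG4 : measurable_fun setT (fun _ : Omega => (12 * (Lam * rho) ^+ 2 * h ^+ 2)%:E).
  exact: measurable_cst.
have G4 (w : Omega) : (0 <= (12 * (Lam * rho) ^+ 2 * h ^+ 2)%:E)%E by rewrite lee_fin.
rewrite (ge0_integralD P measurableT (fun w _ => G4 w) mG4 (fun w _ => G3 w) mG3).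
rewrite !ge0_integralZl//; try by rewrite lee_fin ltW.
rewrite integral_cst//= probability_setT mule1.
apply: (@le_trans _ _ ((12 * cE ^+ 2 * eps ^+ 2)%:E * cB%:E +
  ((12 * (Lam * rho) ^+ 2 * h ^+ 2)%:E + (3 * eps ^+ 2 * h ^- 2)%:E * (T * (T * cW))%:E))%E).
  apply: leeD; first by apply: lee_wpmul2l => //; rewrite lee_fin ltW.
  by apply: leeD => //; apply: lee_wpmul2l => //; rewrite lee_fin ltW.
rewrite -!EFinM -!EFinD lee_fin le_eqVlt; apply/orP; left; apply/eqP.
ring.
Qed.

End estimator_risk.

(** Chebyshev's inequality. *)
Lemma cvg_in_probability0_sqr (R : realType) d (Omega : measurableType d)
    (P : probability Omega R) (Z : R -> {RV P >-> R}) (z : R) (v : R -> R) :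
  v eps @[eps --> 0^'+] --> 0 ->
  (forall eps, 0 < eps -> ('E_P[fun w => (`|Z eps w - z| ^+ 2)%R] <= (v eps)%:E)%E) ->
  cvg_in_probability0 P Z z.
Proof.
move=> v0 Zv delta delta_gt0.
have d2 : 0 < delta ^+ 2 by exact: exprn_gt0.
apply: (@squeeze_cvge _ _ _ _ (cst 0%E) _ (fun eps => (delta ^- 2 * v eps)%:E)).
- near=> eps; rewrite measure_ge0/=.
  have eps0 : 0 < eps by near: eps; exact: nbhs_right_gt.
  rewrite EFinM -lee_pdivrMl ?invr_gt0// invrK.
  apply: le_trans (Zv _ eps0).
  have sqr_nd : {in Num.nneg &, {homo (fun r : R => r ^+ 2) : r s / r <= s}}.
    by move=> r s; rewrite !nnegrE => r0 s0 rs; rewrite ler_pXn2r.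
  apply: (@markov _ _ _ P (Z eps \- cst z) (fun r => r ^+ 2) delta delta_gt0 _ _ sqr_nd).
    exact: measurable_funX.
  by move=> r _; exact: sqr_ge0.
- exact: cvg_cst.
- apply: cvg_EFin; first by near=> eps.
  have dv0 : delta ^- 2 * v eps @[eps --> 0^'+] --> 0.
    by rewrite -[X in _ --> X](mulr0 (delta ^- 2)); apply: cvgM; [exact: cvg_cst|exact: v0].
  exact: dv0.
Unshelve. all: by end_near. Qed.

(** The last term is the square of [eps / h ^ (1 - H)], which tends to 0 by
    assumption. *)
Lemma bandwidth_rate_cvg0 (R : realType) (H c : R) (h : R -> R) :
  (forall eps, 0 < eps -> 0 < h eps) -> h eps @[eps --> 0^'+] --> 0 ->
  (fun eps : R => eps) =o_ (0^'+) (fun eps : R => h eps `^ (1 - H)) ->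
  c * (eps ^+ 2 + h eps ^+ 2 + eps ^+ 2 * h eps `^ (2 * H - 2)) @[eps --> 0^'+] --> 0.
Proof.
move=> h_gt0 h0 /eqoP eh.
have e0 : (eps : R) @[eps --> 0^'+] --> (0 : R).
  by apply: cvg_at_right_filter; exact: cvg_id.
have r0 : eps * h eps `^ (H - 1) @[eps --> 0^'+] --> (0 : R).
  apply/cvgr0Pnorm_le => e e_gt0; near=> eps.
  have eps0 : 0 < eps by near: eps; exact: nbhs_right_gt.
  have q0 : 0 < h eps `^ (1 - H) by apply: powR_gt0; exact: h_gt0.
  rewrite -(opprB 1 H) powRN normrM [X in _ * X]gtr0_norm ?invr_gt0// ler_pdivrMr//.
  rewrite -[X in _ * X]gtr0_norm//.
  by near: eps; exact: eh.
have sq (f : R -> R) : f eps @[eps --> 0^'+] --> 0 -> f eps ^+ 2 @[eps --> 0^'+] --> 0.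
  by move=> f0; rewrite -[X in _ --> X](mulr0 0); exact: cvgM.
have rate : eps ^+ 2 + h eps ^+ 2 + (eps * h eps `^ (H - 1)) ^+ 2 @[eps --> 0^'+] --> 0.
  by rewrite -[X in _ --> X](addr0 0); apply: cvgD; last exact: sq;
     rewrite -[X in _ --> X](addr0 0); apply: cvgD; exact: sq.
rewrite -[X in _ --> X](mulr0 c); apply: cvgM; first exact: cvg_cst.
apply: cvg_trans rate; apply: near_eq_cvg; near=> eps.
have eps0 : 0 < eps by near: eps; exact: nbhs_right_gt.
rewrite exprMn -(powR_mulrn _ (powR_ge0 _ _)) -powRrM.
by congr (_ + _ * _ `^ _); ring.
Unshelve. all: by end_near. Qed.

Theorem theorem3p4 (R : realType) (T H L : R) (C : R -> set R) (K : R -> R)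
  (T_gt0 : 0 < T) (H_gt : 2^-1 < H) (H_lt : H < 1) (L_gt0 : 0 < L)
  (C_lip : hausdorff_lipschitz T C)
  (C_compact_itv : forall t : R, t \in `[0, T] -> compact (C t) /\ is_interval (C t))
  (C_int : exists (r : R) (gamma : R -> R),
     [/\ 0 < r, {within `[0, T], continuous gamma} &
         forall t : R, t \in `[0, T] ->
           C t (gamma t) /\ `[gamma t - r, gamma t + r] `<=` (C t)°])
  (K_kernel : is_kernel K)
  (K_bounded : exists M : R, forall u, K u <= M)
  (K_supp : exists A B : R, A < B /\ [set u : R | K u != 0] = `]A, B[%classic) :
  exists c : R, 0 < c /\
  forall (b : R -> R) (x0 : R) (x y : R -> R) (h : R -> R)
    (d : measure_display) (Omega : measurableType d) (P : probability Omega R)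
    (B : R -> {RV P >-> R}) (X Y tau_hat : R -> R -> {RV P >-> R}),
  lipschitz b -> `|b 0| + lip_seminorm b <= L ->
  C 0 x0 ->
  skorokhod_solution T C b x0 (fun _ => 0) x y ->
  is_fBm T H B ->
  (forall eps : R, 0 < eps ->
     {ae P, forall omega,
        skorokhod_solution T C b x0 (fun t => eps * B t omega)
          (fun t => X eps t omega) (fun t => Y eps t omega)}) ->
  (forall eps : R, 0 < eps -> 0 < h eps) ->
  h eps @[eps --> 0^'+] --> 0 ->
  (forall eps : R, 0 < eps ->
     is_trend_estimator T H b K B eps (h eps) (X eps) (Y eps) (tau_hat eps)) ->
  (forall eps : R, 0 < eps ->
     (ereal_sup [set 'E_P[fun omega =>
                        (`|tau_hat eps t omega - trend b x0 x y t| ^+ 2)%R]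
                | t in `[0%R, T]%classic]
      <= (c * (eps ^+ 2 + h eps ^+ 2
               + eps ^+ 2 * h eps `^ (2 * H - 2)))%:E)%E) /\
  ((fun eps : R => eps) =o_ (0^'+) (fun eps : R => h eps `^ (1 - H)) ->
   forall t : R, t \in `[0, T] ->
     cvg_in_probability0 P (fun eps : R => tau_hat eps t) (trend b x0 x y t)).
Proof.
have zT : (0 : R) \in `[0, T] by rewrite in_itv/= lexx ltW.
have H_gt0 : 0 < H by apply: lt_trans H_gt; rewrite invr_gt0.
have [k k_gt0 near_C] := hausdorff_lipschitz_near C_lip.
have [Cmax Cmax_gt0 C_le] := hausdorff_lipschitz_bounded T_gt0 C_lip (C_compact_itv 0 zT).1.
have [mK K_ge0 K_int] := K_kernel.
have [M K_le] := K_bounded.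
have [lo [hi [lohi /seteqP[K_lohi _]]]] := K_supp.
have {}K_lohi v : K v != 0 -> v \in `]lo, hi[ by move=> /K_lohi.
have [cB cB_gt0 B_sup] := fBm_sup_moment T_gt0 H_gt.
pose Lam := k + L * (1 + Cmax).
have Lam_ge0 : 0 <= Lam by rewrite addr_ge0 ?mulr_ge0 ?addr_ge0 ?(ltW k_gt0)// ltW.
(* The contributions of the reflection, of the smoothing bias and of the Wiener
   integrals, in this order. *)
pose c1 := 12 * (4 * expR (4 * L * T) + 1) ^+ 2 * cB.
pose c2 := 12 * (Lam * (`|lo| + `|hi|)) ^+ 2.
pose c3 := 3 * (T * (T * (4 * H * M ^+ 2 * (hi - lo) `^ (2 * H)))).
have c1_ge0 : 0 <= c1 by apply: mulr_ge0; [apply: mulr_ge0 => //; exact: sqr_ge0|exact: ltW].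
have c2_ge0 : 0 <= c2 by apply: mulr_ge0 => //; exact: sqr_ge0.
have c3_ge0 : 0 <= c3.
  have T0 := ltW T_gt0; have H0 := ltW H_gt0.
  apply: mulr_ge0 => //; apply: mulr_ge0 => //; apply: mulr_ge0 => //.
  by apply: mulr_ge0; [apply: mulr_ge0; [exact: mulr_ge0|exact: sqr_ge0]|exact: powR_ge0].
exists (c1 + c2 + c3 + 1); split; first by rewrite ltr_wpDl// !addr_ge0.
move=> b x0 x y h d Omega P B X Y tau_hat b_lip bL _ lim fB sol h_gt0 h0 est.
have b_le t z : t \in `[0, T] -> C t z -> `|b z| <= L * (1 + Cmax).
  move=> tT Cz; apply: (le_trans (lip_growth z b_lip bL)).
  by rewrite ler_pM2l// lerD2l; exact: C_le Cz.
have x_lip s t : s \in `[0, T] -> t \in `[0, T] -> `|x t - x s| <= Lam * `|t - s|.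
  exact: (solution_lipschitz T_gt0 lim b_lip b_le near_C k_gt0).
have risk eps t : 0 < eps -> t \in `[0, T] ->
    ('E_P[fun omega => (`|tau_hat eps t omega - trend b x0 x y t| ^+ 2)%R] <=
     ((c1 + c2 + c3 + 1) *
      (eps ^+ 2 + h eps ^+ 2 + eps ^+ 2 * h eps `^ (2 * H - 2)))%:E)%E.
  move=> eps_gt0 tT; have heps := h_gt0 _ eps_gt0.
  apply: (le_trans (estimator_risk_le T_gt0 H_gt H_lt L_gt0 mK K_ge0 K_le K_int
    lohi K_lohi b_lip bL lim x_lip Lam_ge0 fB (B_sup _ _ _ _ fB) eps_gt0 heps tT
    (sol _ eps_gt0) (est _ eps_gt0))).
  rewrite lee_fin -/c1 -/c2 powRM ?subr_ge0 ?(ltW lohi) ?(ltW heps)//.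
  have -> : 3 * eps ^+ 2 / h eps ^+ 2 *
      (T * (T * (4 * H * M ^+ 2 * ((hi - lo) `^ (2 * H) * h eps `^ (2 * H))))) =
      c3 * (eps ^+ 2 * h eps `^ (2 * H - 2)).
    rewrite powRB ?(gt_eqF heps) ?implybT// powR_mulrn ?(ltW heps)//.
    by rewrite /c3; field; rewrite gt_eqF.
  set e2 := eps ^+ 2; set h2 := h eps ^+ 2; set q := e2 * _.
  have e2_ge0 : 0 <= e2 by exact: sqr_ge0.
  have h2_ge0 : 0 <= h2 by exact: sqr_ge0.
  have q_ge0 : 0 <= q by rewrite mulr_ge0 ?powR_ge0.
  have l1 : c1 * e2 <= c1 * (e2 + h2 + q) by apply: ler_wpM2l => //; lra.
  have l2 : c2 * h2 <= c2 * (e2 + h2 + q) by apply: ler_wpM2l => //; lra.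
  have l3 : c3 * q <= c3 * (e2 + h2 + q) by apply: ler_wpM2l => //; lra.
  by lra.
split=> [eps eps_gt0|rate t tT].
  by apply: ge_ereal_sup => _ [t tT <-]; exact: risk.
apply: (cvg_in_probability0_sqr (bandwidth_rate_cvg0 _ h_gt0 h0 rate)) => eps eps_gt0.
exact: risk.
Qed.
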